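(* Let $f\colon D^*\to H^3$ be a centered regular WCF-end of a flat front. Then its principal axis coincides with the axis of the flux matrix $\Phi_f$.
   Context: $H^3=\{uu^*:u\in SL(2,\mathbb{C})\}$, points regarded as matrices; $u\in SL(2,\mathbb{C})$ acts by $\iota_u(X)=uXu^*$ and on the ideal boundary $\mathbb{C}\cup\{\infty\}$ by $u\star\zeta=(u_{11}\zeta+u_{12})/(u_{21}\zeta+u_{22})$. Flat front on $D^*=\{0<|z|<1\}$: $f=\mathcal{E}\mathcal{E}^*$ with $\mathcal{E}=(E_{ij})$ a holomorphic immersion of the universal cover into $SL(2,\mathbb{C})$, $\mathcal{E}^{-1}d\mathcal{E}=\begin{pmatrix}0&\theta\\ \omega&0\end{pmatrix}$, $z$ compatible with $ds^2_{1,1}=|\omega|^2+|\theta|^2$; $G=E_{11}/E_{21}$, $G_*=E_{12}/E_{22}$. WCF-end: $ds^2_{1,1}$ complete at $0$ with finite total curvature near $0$; regular: $G,G_*$ have at most poles at $0$ (then $G(0)=G_*(0)$). Multiplicity $m$: with $G(0)\ne\infty$, $m=\min\{\mathrm{ord}_0G',\mathrm{ord}_0G_*'\}+1$ (or ramification order of the nonconstant one). One assumes $(G,\omega)$ dominant, i.e. $|(dG_*/dG)(0)|\le1$ (otherwise replace $\mathcal{E}$ by $\mathcal{E}\begin{pmatrix}0&\mathrm{i}\\ \mathrm{i}&0\end{pmatrix}$, swapping $(G,\omega)$ and $(G_*,\theta)$). Indentation number: for a geodesic $\gamma$ with $\gamma(+\infty)=G(0)$, choose $u$ with $\iota_u\circ\gamma(-\infty)=\infty$,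 $\iota_u\circ\gamma(+\infty)=0$; $l_\gamma$ is the ramification order at $0$ of $A_\gamma=d(u\star G_* )/d(u\star G)$ ($\infty$ if constant). The end is centered if it is not horospherical (i.e. $Q=\omega\theta=z^{-2}(q_{-2}+o(1))dz^2$ with $q_{-2}\ne0$) and there is a unique geodesic image $[\sigma]$, $\sigma(+\infty)=G(0)$, with $l_\sigma>m$ while $l_\gamma=m$ for all other $\gamma$ with $\gamma(+\infty)=G(0)$; $\sigma$ is the principal axis. Flux matrix $\Phi_f=\frac{\mathrm{i}}{2\pi}\oint_\gamma(\partial f)f^{-1}$ (loop around $0$ counterclockwise); for non-horospherical ends it is diagonalizable with two linearly independent eigenvectors $\mathbf{v}_1,\mathbf{v}_2$, and its axis is the geodesic joining $\Pi(\mathbf{v}_1)$ and $\Pi(\mathbf{v}_2)$ in $\mathbb{C}\cup\{\infty\}$, where $\Pi(x,y)=x/y$. *)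

(* Defs.v *)
From Stdlib Require Import Reals ZArith.
From Coquelicot Require Import Coquelicot.
Open Scope R_scope.

Definition cexp (w : C) : C := (exp (fst w) * cos (snd w), exp (fst w) * sin (snd w)).

Fixpoint cpow (z : C) (n : nat) : C :=
  match n with O => 1%C | S k => (z * cpow z k)%C end.

Definition cpowZ (z : C) (n : Z) : C :=
  match n with
  | Z0 => 1%C
  | Zpos p => cpow z (Pos.to_nat p)
  | Zneg p => Cinv (cpow z (Pos.to_nat p))
  end.

Definition mero_order (h : C -> C) (n : Z) : Prop :=
  exists (r : R) (phi : C -> C), 0 < r /\
    (forall z : C, Cmod z < r -> ex_derive phi z) /\ phi 0%C <> 0%C /\
    (forall z : C, 0 < Cmod z < r -> h z = (cpowZ z n * phi z)%C).

Definition vanishes_near0 (h : C -> C) : Prop :=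
  exists r : R, 0 < r /\ forall z : C, 0 < Cmod z < r -> h z = 0%C.

Definition mero_at0 (h : C -> C) : Prop :=
  vanishes_near0 h \/ exists n : Z, mero_order h n.

(* Points of the ideal boundary C u {oo}: None = oo. *)
Definition sphere := option C.

Definition mero_val (h : C -> C) (v : sphere) : Prop :=
  match v with
  | None => exists n : Z, (n < 0)%Z /\ mero_order h n
  | Some c => vanishes_near0 (fun z => (h z - c)%C)
              \/ exists n : Z, (0 < n)%Z /\ mero_order (fun z => (h z - c)%C) n
  end.

(* ramification order at 0 of a meromorphic germ (as a map to C u {oo});
   None = oo (h constant near 0) *)
Definition ram_order (h : C -> C) (l : option nat) : Prop :=
  match l with
  | None => exists c : C, vanishes_near0 (fun z => (h z - c)%C)
  | Some k => (0 < k)%nat /\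
      (mero_order h (- Z.of_nat k)%Z
       \/ exists c : C, mero_order (fun z => (h z - c)%C) (Z.of_nat k))
  end.

Definition omin (a b : option nat) : option nat :=
  match a, b with
  | None, x => x
  | x, None => x
  | Some a, Some b => Some (Nat.min a b)
  end.

Record mat2 := Mat2 { m11 : C; m12 : C; m21 : C; m22 : C }.

Definition mzero : mat2 := Mat2 0%C 0%C 0%C 0%C.
Definition mmul (A B : mat2) : mat2 :=
  Mat2 (m11 A * m11 B + m12 A * m21 B)%C (m11 A * m12 B + m12 A * m22 B)%C
       (m21 A * m11 B + m22 A * m21 B)%C (m21 A * m12 B + m22 A * m22 B)%C.
Definition mscale (c : C) (A : mat2) : mat2 :=
  Mat2 (c * m11 A)%C (c * m12 A)%C (c * m21 A)%C (c * m22 A)%C.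
Definition mstar (A : mat2) : mat2 :=
  Mat2 (Cconj (m11 A)) (Cconj (m21 A)) (Cconj (m12 A)) (Cconj (m22 A)).
Definition mdet (A : mat2) : C := (m11 A * m22 A - m12 A * m21 A)%C.
Definition minv (A : mat2) : mat2 :=
  mscale (Cinv (mdet A)) (Mat2 (m22 A) (- m12 A)%C (- m21 A)%C (m11 A)).
Definition mvec (A : mat2) (v : C * C) : C * C :=
  ((m11 A * fst v + m12 A * snd v)%C, (m21 A * fst v + m22 A * snd v)%C).

Definition mob_rel (u : mat2) (p q : sphere) : Prop :=
  match p, q with
  | Some z, Some w => (m21 u * z + m22 u)%C <> 0%C /\
                      w = ((m11 u * z + m12 u) / (m21 u * z + m22 u))%C
  | Some z, None => (m21 u * z + m22 u)%C = 0%C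
  | None, Some w => m21 u <> 0%C /\ w = (m11 u / m21 u)%C
  | None, None => m21 u = 0%C
  end.

Definition mob (u : mat2) (h : C -> C) : C -> C :=
  fun z => ((m11 u * h z + m12 u) / (m21 u * h z + m22 u))%C.

Definition proj (v : C * C) (p : sphere) : Prop :=
  match p with
  | None => snd v = 0%C
  | Some z => snd v <> 0%C /\ z = (fst v / snd v)%C
  end.

Definition eigvec (M : mat2) (v : C * C) : Prop :=
  v <> (RtoC 0, RtoC 0) /\ exists lam : C, mvec M v = ((lam * fst v)%C, (lam * snd v)%C).

Definition lin_indep (v1 v2 : C * C) : Prop :=
  (fst v1 * snd v2 - fst v2 * snd v1)%C <> 0%C.

(* The universal cover of D^* is Omega = {Re w < 0}, with z = exp w.   *)

Definition Omega (w : C) : Prop := fst w < 0.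

Definition two_pi_i : C := (0, 2 * PI).

Definition Ed (E : C -> mat2) (w : C) : mat2 :=
  Mat2 (C_derive (fun x => m11 (E x)) w) (C_derive (fun x => m12 (E x)) w)
       (C_derive (fun x => m21 (E x)) w) (C_derive (fun x => m22 (E x)) w).

Definition holo_on_Omega (E : C -> mat2) : Prop :=
  forall w, Omega w ->
    ex_derive (fun x => m11 (E x)) w /\ ex_derive (fun x => m12 (E x)) w /\
    ex_derive (fun x => m21 (E x)) w /\ ex_derive (fun x => m22 (E x)) w.

(* E^{-1} dE/dw = [[0, theta_hat], [omega_hat, 0]] ; omega = omega_hat dw etc. *)
Definition MC (E : C -> mat2) (w : C) : mat2 := mmul (minv (E w)) (Ed E w).
Definition omega_hat (E : C -> mat2) (w : C) : C := m21 (MC E w).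
Definition theta_hat (E : C -> mat2) (w : C) : C := m12 (MC E w).

Definition ffront (E : C -> mat2) (w : C) : mat2 := mmul (E w) (mstar (E w)).

(* f = E E^* is a flat front on D^* with holomorphic Legendrian lift E *)
Definition flat_front_end (E : C -> mat2) : Prop :=
  holo_on_Omega E /\
  (forall w, Omega w -> mdet (E w) = 1%C) /\
  (forall w, Omega w -> Ed E w <> mzero) /\
  (* Legendrian: E^{-1} dE is off-diagonal *)
  (forall w, Omega w -> m11 (MC E w) = 0%C /\ m22 (MC E w) = 0%C) /\
  (* f is well defined on D^* *)
  (forall w, Omega w -> ffront E (w + two_pi_i)%C = ffront E w).

(* ds^2_{1,1} = |omega|^2 + |theta|^2 = lam^2 |dw|^2 *)
Definition lam (E : C -> mat2) (w : C) : R :=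
  sqrt (Cmod (omega_hat E w) ^ 2 + Cmod (theta_hat E w) ^ 2).

(* completeness at the end z = 0: every C^1 path tending to the end
   (Re w -> -oo, i.e. z -> 0) has infinite length *)
Definition complete_at0 (l : C -> R) : Prop :=
  forall gx gy : R -> R,
    (forall t, 0 <= t < 1 -> Omega (gx t, gy t)) ->
    (forall t, 0 <= t < 1 -> ex_derive gx t /\ ex_derive gy t) ->
    (forall t, 0 <= t < 1 -> continuous (Derive gx) t /\ continuous (Derive gy) t) ->
    filterlim gx (at_left 1) (Rbar_locally m_infty) ->
    filterlim (fun s => RInt (fun t => l (gx t, gy t) *
                          sqrt (Derive gx t ^ 2 + Derive gy t ^ 2)) 0 s)
           (at_left 1) (Rbar_locally p_infty).

Definition laplacian (u : R -> R -> R) (x y : R) : R :=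
  Derive (fun a => Derive (fun b => u b y) a) x
  + Derive (fun b => Derive (fun c => u x c) b) y.

(* finite total (absolute) curvature near 0: for lam^2|dw|^2,
   |K| dA = |Laplacian (log lam)| dx dy; integrate over
   {Re w < a, 0 <= Im w <= 2 pi}, a fundamental domain of a punctured
   neighbourhood of 0 *)
Definition finite_total_curvature_at0 (l : C -> R) : Prop :=
  exists a : R, a < 0 /\
    ex_RInt_gen
      (fun x => RInt (fun y => Rabs (laplacian (fun x y => ln (l (x, y))) x y)) 0 (2 * PI))
      (Rbar_locally m_infty) (at_point a).

Definition WCF_end (E : C -> mat2) : Prop :=
  complete_at0 (lam E) /\ finite_total_curvature_at0 (lam E).

Definition gauss_maps (E : C -> mat2) (g gs : C -> C) : Prop :=
  forall w, Omega w ->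
    (m21 (E w) <> 0%C -> g (cexp w) = (m11 (E w) / m21 (E w))%C) /\
    (m22 (E w) <> 0%C -> gs (cexp w) = (m12 (E w) / m22 (E w))%C).

Definition regular (g gs : C -> C) : Prop := mero_at0 g /\ mero_at0 gs.

(* Q = omega theta = z^{-2} (q + o(1)) dz^2 with q <> 0;
   in the w coordinate, omega_hat theta_hat -> q as Re w -> -oo *)
Definition non_horospherical (E : C -> mat2) : Prop :=
  exists q : C, q <> 0%C /\
    forall eps : R, 0 < eps -> exists a : R, a < 0 /\
      forall w : C, fst w < a -> Cmod (omega_hat E w * theta_hat E w - q)%C < eps.

Definition multiplicity (g gs : C -> C) (m : nat) : Prop :=
  exists l1 l2, ram_order g l1 /\ ram_order gs l2 /\ omin l1 l2 = Some m.

(* (G, omega) dominant: |(dG_*/dG)(0)| <= 1, computed in a chart at G(0) *)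
Definition dominant (g gs : C -> C) : Prop :=
  ~ ram_order g None /\
  exists c : C, Cmod c <= 1 /\
    (((exists g0, mero_val g (Some g0)) /\
       mero_val (fun z => (C_derive gs z / C_derive g z)%C) (Some c))
     \/ (mero_val g None /\
       mero_val (fun z => (C_derive (fun y => Cinv (gs y)) z
                           / C_derive (fun y => Cinv (g y)) z)%C) (Some c))).

Definition A_fun (u : mat2) (g gs : C -> C) : C -> C :=
  fun z => (C_derive (mob u gs) z / C_derive (mob u g) z)%C.

(* indentation number l of the geodesic gamma with gamma(-oo) = p,
   gamma(+oo) = G0 *)
Definition indentation (g gs : C -> C) (G0 p : sphere) (l : option nat) : Prop :=
  forall u : mat2, mdet u = 1%C -> mob_rel u p None -> mob_rel u G0 (Some (RtoC 0)) ->
    ram_order (A_fun u g gs) l.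

Definition opt_gt (l : option nat) (m : nat) : Prop :=
  match l with None => True | Some k => (m < k)%nat end.

(* s = sigma(-oo) for the principal axis sigma (sigma(+oo) = G0) *)
Definition principal_axis_end (g gs : C -> C) (G0 : sphere) (m : nat) (s : sphere) : Prop :=
  s <> G0 /\ (exists l, indentation g gs G0 s l /\ opt_gt l m) /\
  forall p : sphere, p <> G0 -> p <> s -> indentation g gs G0 p (Some m).

Definition centered (E : C -> mat2) (g gs : C -> C) : Prop :=
  non_horospherical E /\
  exists (G0 : sphere) (m : nat), mero_val g G0 /\ multiplicity g gs m /\
    exists! s : sphere, principal_axis_end g gs G0 m s.

Definition dx (F : C -> C) (w : C) : C :=
  (Derive (fun a => fst (F (a, snd w))) (fst w), Derive (fun a => snd (F (a, snd w))) (fst w)).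
Definition dy (F : C -> C) (w : C) : C :=
  (Derive (fun b => fst (F (fst w, b))) (snd w), Derive (fun b => snd (F (fst w, b))) (snd w)).
Definition wirt (F : C -> C) (w : C) : C := ((dx F w - Ci * dy F w) / 2)%C.
Definition mwirt (f : C -> mat2) (w : C) : mat2 :=
  Mat2 (wirt (fun x => m11 (f x)) w) (wirt (fun x => m12 (f x)) w)
       (wirt (fun x => m21 (f x)) w) (wirt (fun x => m22 (f x)) w).

Definition cRInt (h : R -> C) (a b : R) : C :=
  (RInt (fun t => fst (h t)) a b, RInt (fun t => snd (h t)) a b).
Definition mRInt (h : R -> mat2) (a b : R) : mat2 :=
  Mat2 (cRInt (fun t => m11 (h t)) a b) (cRInt (fun t => m12 (h t)) a b)
       (cRInt (fun t => m21 (h t)) a b) (cRInt (fun t => m22 (h t)) a b).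

(* Phi_f = (i / 2 pi) \oint (df) f^{-1} over the counterclockwise loop
   z = e^{x0} e^{i t}, t in [0, 2 pi], i.e. w(t) = x0 + i t, dw = i dt *)
Definition flux (E : C -> mat2) (x0 : R) : mat2 :=
  mscale (Ci / RtoC (2 * PI))%C
    (mRInt (fun t => mscale Ci (mmul (mwirt (ffront E) (x0, t)) (minv (ffront E (x0, t)))))
           0 (2 * PI)).

(* Main.v *)
(* With [z = exp w], the lift satisfies [(partial f) f^{-1} = E' E^{-1}], so the flux matrix is, up to a
   constant, the period of the holomorphic [E' E^{-1}], and conjugating [E] by [u] conjugates it.  Take [u] sending
   [s] to infinity and [G0] to 0, and let [H], [Hs] be the transformed Gauss maps.  Since
   [Q = - H' Hs' / (H - Hs)^2] has a nonzero limit, both vanish at 0 to the same order [m], with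
   [Hs / H -> c], [c <> 0, 1].  The indentation number of the principal axis gives [Hs' = (c + o(z^m)) H'], hence
   [Hs = (c + o(z^m)) H].  In the entries
   [- (Hs H' + H Hs') / (H - Hs)^2], [(Hs^2 H' + H^2 Hs') / (H - Hs)^2], [- (H' + Hs') / (H - Hs)^2]
   of [E' E^{-1}], the first tends to a nonzero constant, the second to 0, and the third is
   the derivative of a multiple of [1 / H] up to [o(1)].  So the period is [diag (mu, - mu)] with [mu <> 0], whose
   eigenvectors project to infinity and 0. *)
Require Import Defs.
From Stdlib Require Import Reals ZArith.
From Coquelicot Require Import Coquelicot.
From Stdlib Require Import Lra Lia Psatz ClassicalEpsilon.
Open Scope R_scope.

(** * Complex derivatives and integrals of complex functions of a real variable *)

(** The lift is given only as a pointwise differentiable map on the half plane and may have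
    monodromy. Single-valuedness of the form comes from its expression through [f]; integrating it
    and moving the loop needs differentiability of [E'], hence Goursat's theorem and Cauchy's
    formula on squares. Laurent series and residues are avoided: the period does not depend on
    [Re w], so it can be read off from the limit of the integrand at the end, once the derivative of
    a function of [z] has been subtracted. The obstacle is the third entry, which may have a pole of
    order [m]: after replacing [Hs] by [c H] and [Hs'] by [c H'] the error is still divided by
    [z^m], which is why the indentation number has to exceed [m]. Sending [G0] to 0 makes both Gauss
    maps vanish there, so no constant of integration appears when the estimate passes from
    derivatives to functions. The nonzero limit of [Q] also ensures that the Gauss maps are not
    constant and that their quotient formulas hold at every point close to the end. *)

Lemma Cmod_minus_sym (x y : C) : Cmod (x - y) = Cmod (y - x).
Proof. rewrite <- Cmod_opp. f_equal. ring. Qed.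

(** Differentiability becomes an inequality between moduli, free of filters; the quantitative
    arguments below start from this form. *)
Lemma is_derive_C_iff (f : C -> C) (z l : C) :
  is_derive f z l <->
  forall eps, 0 < eps -> exists d, 0 < d /\ forall y, Cmod (y - z) < d ->
    Cmod (f y - f z - l * (y - z)) <= eps * Cmod (y - z).
Proof.
  split.
  - intros [_ H] eps He.
    destruct (H z (fun P HP => HP) (mkposreal eps He)) as [d Hd].
    exists d; split; [apply cond_pos|]. intros y Hy.
    specialize (Hd y Hy).
    change (Cmod ((f y - f z) - ((y - z) * l)) <= eps * Cmod (y - z)) in Hd.
    rewrite (Cmult_comm l). exact Hd.
  - intros H. split.
    + apply @is_linear_scal_l.
    + intros x Hx eps.
      assert (Ex : x = z). { symmetry. apply (is_filter_lim_locally_unique (V := AbsRing_NormedModule C_AbsRing)). exact Hx. }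
      subst x.
      destruct (H eps (cond_pos eps)) as [d [Hd0 Hd]].
      exists (mkposreal d Hd0). intros y Hy.
      change (Cmod ((f y - f z) - ((y - z) * l)) <= eps * Cmod (y - z)).
      rewrite (Cmult_comm _ l). apply Hd. exact Hy.
Qed.

(** The plane is treated as a normed space over the reals, so that norm bounds, additivity and the
    fundamental theorem of calculus apply to a single vector-valued integral; [CI_cRInt] connects it
    with the componentwise [cRInt] in the definition of the flux. *)
Definition CI (f : R -> C) (a b : R) : C := RInt (V := C_R_CompleteNormedModule) f a b.
Definition exCI (f : R -> C) (a b : R) : Prop := ex_RInt (V := C_R_NormedModule) f a b.
Definition ccont (f : R -> C) (t : R) : Prop :=
  forall eps, 0 < eps -> exists d, 0 < d /\ forall s, Rabs (s - t) < d -> Cmod (f s - f t) < eps.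

Lemma ccont_continuous (f : R -> C) (t : R) : ccont f t -> continuous (U := C_UniformSpace) f t.
Proof.
  intros H P [e He].
  destruct (H e (cond_pos e)) as [d [Hd0 Hd]].
  exists (mkposreal d Hd0). intros s Hs. apply He.
  apply C_NormedModule_mixin_compat1.
  apply (Hd s). exact Hs.
Qed.

Lemma exCI_cont (f : R -> C) (a b : R) :
  a <= b -> (forall t, a <= t <= b -> ccont f t) -> exCI f a b.
Proof.
  intros Hab H. apply (ex_RInt_continuous (V := C_R_CompleteNormedModule)).
  rewrite Rmin_left, Rmax_right by lra. intros. now apply ccont_continuous, H.
Qed.

Lemma CI_bound (f : R -> C) (a b M : R) :
  a <= b -> exCI f a b -> (forall t, a <= t <= b -> Cmod (f t) <= M) ->
  Cmod (CI f a b) <= (b - a) * M.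
Proof.
  intros Hab Hex H. rewrite Cmod_norm.
  apply (norm_RInt_le_const (V := C_R_NormedModule) f a b); auto.
  - intros; rewrite <- Cmod_norm. auto.
  - apply (RInt_correct (V := C_R_CompleteNormedModule)); auto.
Qed.

Lemma CI_plus (f g : R -> C) (a b : R) :
  exCI f a b -> exCI g a b -> CI (fun t => f t + g t)%C a b = (CI f a b + CI g a b)%C.
Proof. intros. now apply (RInt_plus (V := C_R_CompleteNormedModule)). Qed.
Lemma CI_minus (f g : R -> C) (a b : R) :
  exCI f a b -> exCI g a b -> CI (fun t => f t - g t)%C a b = (CI f a b - CI g a b)%C.
Proof. intros. now apply (RInt_minus (V := C_R_CompleteNormedModule)). Qed.
Lemma exCI_plus (f g : R -> C) (a b : R) :
  exCI f a b -> exCI g a b -> exCI (fun t => f t + g t)%C a b.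
Proof. intros. now apply (ex_RInt_plus (V := C_R_NormedModule)). Qed.
Lemma exCI_minus (f g : R -> C) (a b : R) :
  exCI f a b -> exCI g a b -> exCI (fun t => f t - g t)%C a b.
Proof. intros. now apply (ex_RInt_minus (V := C_R_NormedModule)). Qed.
Lemma CI_const (c : C) (a b : R) : CI (fun _ => c) a b = (RtoC (b - a) * c)%C.
Proof.
  unfold CI. rewrite (RInt_const (V := C_R_CompleteNormedModule)).
  now rewrite scal_R_Cmult.
Qed.
Lemma exCI_const (c : C) (a b : R) : exCI (fun _ => c) a b.
Proof. apply (ex_RInt_const (V := C_R_NormedModule)). Qed.
Lemma CI_ext (f g : R -> C) (a b : R) :
  a <= b -> (forall t, a <= t <= b -> f t = g t) -> CI f a b = CI g a b.
Proof.
  intros Hab H. apply (RInt_ext (V := C_R_CompleteNormedModule)).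
  rewrite Rmin_left, Rmax_right by lra. intros; apply H; lra.
Qed.
Lemma exCI_ext (f g : R -> C) (a b : R) :
  a <= b -> (forall t, a <= t <= b -> f t = g t) -> exCI f a b -> exCI g a b.
Proof.
  intros Hab H. apply (ex_RInt_ext (V := C_R_NormedModule)).
  rewrite Rmin_left, Rmax_right by lra. intros; apply H; lra.
Qed.

Lemma CI_isCI (f : R -> C) (a b : R) :
  exCI f a b -> is_RInt (V := C_R_NormedModule) f a b (CI f a b).
Proof. intros; now apply (RInt_correct (V := C_R_CompleteNormedModule)). Qed.

Lemma CI_cRInt (f : R -> C) (a b : R) : exCI f a b -> cRInt f a b = CI f a b.
Proof.
  intros H. pose proof (CI_isCI _ _ _ H) as H1.
  unfold cRInt. rewrite (surjective_pairing (CI f a b)). f_equal.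
  - apply is_RInt_unique. now apply (is_RInt_fct_extend_fst (U:=R_NormedModule) (V:=R_NormedModule)).
  - apply is_RInt_unique. now apply (is_RInt_fct_extend_snd (U:=R_NormedModule) (V:=R_NormedModule)).
Qed.

(** Multiplication by a complex number is not scalar multiplication of the real module, so it is
    split into real and imaginary parts. *)
Lemma isCI_scal (f : R -> C) (a b : R) (c : C) :
  exCI f a b -> is_RInt (V := C_R_NormedModule) (fun t => c * f t)%C a b (c * CI f a b)%C.
Proof.
  intros H. pose proof (CI_isCI _ _ _ H) as H1.
  pose proof (is_RInt_fct_extend_fst (U:=R_NormedModule) (V:=R_NormedModule) _ _ _ _ H1) as Hf.
  pose proof (is_RInt_fct_extend_snd (U:=R_NormedModule) (V:=R_NormedModule) _ _ _ _ H1) as Hs.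
  destruct c as [c1 c2].
  apply (is_RInt_fct_extend_pair (U:=R_NormedModule) (V:=R_NormedModule)); simpl.
  - apply (is_RInt_minus (V := R_NormedModule)); now apply (is_RInt_scal (V:=R_NormedModule)).
  - apply (is_RInt_plus (V := R_NormedModule)); now apply (is_RInt_scal (V:=R_NormedModule)).
Qed.
Lemma CI_scal (f : R -> C) (a b : R) (c : C) :
  exCI f a b -> CI (fun t => c * f t)%C a b = (c * CI f a b)%C.
Proof. intros H. apply (is_RInt_unique (V := C_R_CompleteNormedModule)). now apply isCI_scal. Qed.
Lemma exCI_scal (f : R -> C) (a b : R) (c : C) : exCI f a b -> exCI (fun t => c * f t)%C a b.
Proof. intros H. eexists. now apply isCI_scal. Qed.

Lemma CI_Chasles (f : R -> C) (a b c : R) :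
  a <= b <= c -> exCI f a c -> CI f a c = (CI f a b + CI f b c)%C.
Proof.
  intros H He. symmetry. apply (RInt_Chasles (V := C_R_CompleteNormedModule)).
  - now apply (ex_RInt_Chasles_1 (V := C_R_CompleteNormedModule)) with c.
  - now apply (ex_RInt_Chasles_2 (V := C_R_CompleteNormedModule)) with a.
Qed.
Lemma exCI_sub (f : R -> C) (a b c d : R) :
  a <= c <= d -> d <= b -> exCI f a b -> exCI f c d.
Proof.
  intros H H1 He. apply (ex_RInt_Chasles_2 (V := C_R_CompleteNormedModule)) with a; [lra|].
  apply (ex_RInt_Chasles_1 (V := C_R_CompleteNormedModule)) with b; [lra|auto].
Qed.

(* Coquelicot's product and chain rules speak about [AbsRing_NormedModule C_AbsRing], whose
   topology is not convertible to that of [C_NormedModule]. *)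
Lemma is_derive_C_AbsRing (f : C -> C) (z l : C) :
  @is_derive C_AbsRing (AbsRing_NormedModule C_AbsRing) f z l <-> is_derive f z l.
Proof.
  split; intros [_ H]; (split; [apply @is_linear_scal_l|exact H]).
Qed.

Lemma is_derive_C_const (c z : C) : is_derive (fun _ : C => c) z (RtoC 0).
Proof. apply (is_derive_const (V := C_NormedModule)). Qed.
Lemma is_derive_C_id (z : C) : is_derive (fun x : C => x) z (RtoC 1).
Proof. apply is_derive_C_iff. intros eps He. exists 1. split; [lra|]. intros y _.
  replace (y - z - 1 * (y - z))%C with (RtoC 0) by ring.
  rewrite Cmod_0. pose proof (Cmod_ge_0 (y - z)). nra. Qed.
Lemma is_derive_C_plus (f g : C -> C) (z a b : C) : is_derive f z a -> is_derive g z b ->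
  is_derive (fun x => f x + g x)%C z (a + b)%C.
Proof. intros. now apply (is_derive_plus (V := C_NormedModule)). Qed.
Lemma is_derive_C_minus (f g : C -> C) (z a b : C) : is_derive f z a -> is_derive g z b ->
  is_derive (fun x => f x - g x)%C z (a - b)%C.
Proof. intros. now apply (is_derive_minus (V := C_NormedModule)). Qed.
Lemma is_derive_C_eq (f : C -> C) (z a b : C) : is_derive f z a -> a = b -> is_derive f z b.
Proof. now intros H <-. Qed.
Lemma is_derive_C_comp (f g : C -> C) (z a b : C) : is_derive f (g z) a -> is_derive g z b ->
  is_derive (fun x => f (g x)) z (a * b)%C.
Proof. intros Hf Hg. rewrite Cmult_comm. apply (is_derive_comp (V := C_NormedModule) f g z a b); auto.
  now apply is_derive_C_AbsRing. Qed.
Lemma is_derive_C_mult (f g : C -> C) (z a b : C) : is_derive f z a -> is_derive g z b ->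
  is_derive (fun x => f x * g x)%C z (a * g z + f z * b)%C.
Proof.
 intros Hf Hg. apply is_derive_C_AbsRing. apply (is_derive_mult (K := C_AbsRing)).
  - now apply is_derive_C_AbsRing.
  - now apply is_derive_C_AbsRing.
  - exact Cmult_comm.
Qed.
Lemma is_derive_C_inv_id (z : C) : z <> 0%C -> is_derive Cinv z (- / (z * z))%C.
Proof.
  intros Hz. apply is_derive_C_iff. intros eps He.
  pose proof (proj1 (Cmod_gt_0 z) Hz) as Hm.
  set (m := Cmod z) in *.
  exists (Rmin (m / 2) (eps * (m * m * m) / 2)).
  assert (Hm3 : 0 < m * m * m) by (repeat apply Rmult_lt_0_compat; auto).
  split. { apply Rmin_pos; nra. }
  intros y Hy.
  assert (H1 : Cmod (y - z) < m / 2) by (eapply Rlt_le_trans; [exact Hy|apply Rmin_l]).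
  assert (H2 : Cmod (y - z) < eps * (m * m * m) / 2) by (eapply Rlt_le_trans; [exact Hy|apply Rmin_r]).
  assert (H3 : m / 2 < Cmod y).
  { pose proof (Cmod_triangle y (z - y)). replace (y + (z - y))%C with z in H by ring.
    rewrite Cmod_minus_sym in H. fold m in H. lra. }
  assert (Hy0 : y <> 0%C). { intros ->. rewrite Cmod_0 in H3. lra. }
  replace (/ y - / z - - / (z * z) * (y - z))%C with ((y - z) * (y - z) / (y * (z * z)))%C
    by (field; auto).
  assert (Hn : (y * (z * z))%C <> 0%C) by (repeat apply Cmult_neq_0; auto).
  rewrite Cmod_div by auto. rewrite !Cmod_mult. fold m.
  pose proof (Cmod_ge_0 (y - z)) as H0.
  apply Rmult_le_reg_r with (Cmod y * (m * m)); [apply Rmult_lt_0_compat; nra|].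
  replace (Cmod (y - z) * Cmod (y - z) / (Cmod y * (m * m)) * (Cmod y * (m * m)))
    with (Cmod (y - z) * Cmod (y - z)) by (field; split; lra).
  rewrite (Rmult_comm eps), Rmult_assoc. apply Rmult_le_compat_l; auto.
  assert (eps * (m * m * m) / 2 <= eps * (Cmod y * (m * m))); [|lra].
  replace (eps * (m * m * m) / 2) with (eps * (m / 2 * (m * m))) by field.
  apply Rmult_le_compat_l; [lra|]. apply Rmult_le_compat_r; nra.
Qed.
Lemma is_derive_C_inv (f : C -> C) (z a : C) : f z <> 0%C -> is_derive f z a ->
  is_derive (fun x => / f x)%C z (- a / (f z * f z))%C.
Proof.
  intros Hz Hf. eapply is_derive_C_eq. apply (is_derive_C_comp Cinv f); eauto. apply is_derive_C_inv_id; auto. field; auto.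
Qed.
Lemma is_derive_C_div (f g : C -> C) (z a b : C) : g z <> 0%C -> is_derive f z a -> is_derive g z b ->
  is_derive (fun x => f x / g x)%C z ((a * g z - f z * b) / (g z * g z))%C.
Proof.
  intros Hz Hf Hg. eapply is_derive_C_eq.
  apply (is_derive_C_mult f (fun x => / g x)%C); eauto. apply is_derive_C_inv; eauto. field; auto.
Qed.
Lemma is_derive_C_loc (f g : C -> C) (z a : C) (d : R) : 0 < d -> (forall y, Cmod (y - z) < d -> f y = g y) ->
  is_derive f z a -> is_derive g z a.
Proof.
  intros Hd H Hf. apply is_derive_C_iff. intros eps He.
  destruct (proj1 (is_derive_C_iff _ _ _) Hf eps He) as [d1 [Hd1 H1]].
  exists (Rmin d d1). split; [now apply Rmin_pos|]. intros y Hy.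
  rewrite <- !H. apply H1. eapply Rlt_le_trans; [exact Hy|apply Rmin_r].
  replace (z - z)%C with (RtoC 0) by ring. now rewrite Cmod_0.
  eapply Rlt_le_trans; [exact Hy|apply Rmin_l].
Qed.
Lemma is_derive_C_ext (f g : C -> C) (z a : C) : (forall y, f y = g y) -> is_derive f z a -> is_derive g z a.
Proof. intros H. apply (is_derive_C_loc f g z a 1); auto. lra. Qed.
Lemma is_derive_C_correct (f : C -> C) (z : C) : ex_derive f z -> is_derive f z (C_derive f z).
Proof. intros H. apply C_derive_correct; auto. Qed.

(** * Rectangle integrals and Goursat's theorem *)

Lemma ex_derive_C_eps (f : C -> C) (z : C) : ex_derive f z -> exists l,
  forall eps, 0 < eps -> exists d, 0 < d /\ forall y, Cmod (y - z) < d ->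
    Cmod (f y - f z - l * (y - z)) <= eps * Cmod (y - z).
Proof. intros [l H]. exists l. now apply is_derive_C_iff. Qed.

Lemma ex_derive_C_cont (f : C -> C) (z : C) : ex_derive f z ->
  forall eps, 0 < eps -> exists d, 0 < d /\ forall y, Cmod (y - z) < d -> Cmod (f y - f z) < eps.
Proof.
  intros Hf eps He. destruct (ex_derive_C_eps f z Hf) as [l Hl].
  destruct (Hl 1 ltac:(lra)) as [d [Hd0 Hd]].
  pose proof (Cmod_ge_0 l) as Hl0.
  exists (Rmin d (eps / (Cmod l + 2))). split.
  - apply Rmin_pos; auto. apply Rdiv_lt_0_compat; lra.
  - intros y Hy.
    assert (H1 : Cmod (y - z) < d) by (eapply Rlt_le_trans; [exact Hy|apply Rmin_l]).
    assert (H2 : Cmod (y - z) < eps / (Cmod l + 2)) by (eapply Rlt_le_trans; [exact Hy|apply Rmin_r]).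
    specialize (Hd y H1).
    replace (f y - f z)%C with ((f y - f z - l * (y - z)) + l * (y - z))%C by ring.
    eapply Rle_lt_trans; [apply Cmod_triangle|]. rewrite Cmod_mult.
    assert (H3 : (Cmod l + 2) * Cmod (y - z) < eps).
    { apply (Rmult_lt_compat_l (Cmod l + 2)) in H2; [|lra].
      replace ((Cmod l + 2) * (eps / (Cmod l + 2))) with eps in H2 by (field; lra). exact H2. }
    pose proof (Cmod_ge_0 (y - z)). nra.
Qed.

Lemma ccont_comp (f : C -> C) (g : R -> C) (t k : R) :
  (forall s, Cmod (g s - g t) <= k * Rabs (s - t)) ->
  ex_derive f (g t) -> ccont (fun s => f (g s)) t.
Proof.
  intros Hg Hf eps He. destruct (ex_derive_C_cont f _ Hf eps He) as [d [Hd0 Hd]].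
  exists (d / (Rabs k + 1)). pose proof (Rabs_pos k). split.
  - apply Rdiv_lt_0_compat; lra.
  - intros s Hs. apply Hd. eapply Rle_lt_trans; [apply Hg|].
    apply (Rmult_lt_compat_l (Rabs k + 1)) in Hs; [|lra].
    replace ((Rabs k + 1) * (d / (Rabs k + 1))) with d in Hs by (field; lra).
    eapply Rle_lt_trans; [|exact Hs]. apply Rmult_le_compat_r; [apply Rabs_pos|].
    pose proof (Rle_abs k). lra.
Qed.

Lemma Cmod_real (x : R) : Cmod (x, 0) = Rabs x.
Proof. exact (Cmod_R x). Qed.
Lemma Cmod_imag (x : R) : Cmod (0, x) = Rabs x.
Proof.
  replace ((0, x) : C) with (Ci * RtoC x)%C by (unfold Ci, RtoC, Cmult; simpl; f_equal; ring).
  rewrite Cmod_mult, Cmod_Ci, Cmod_R; ring.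
Qed.
Lemma Cmod_pair_le (x y : R) : Cmod (x, y) <= Rabs x + Rabs y.
Proof.
  replace ((x, y) : C) with (((x, 0) : C) + ((0, y) : C))%C by (unfold Cplus; simpl; f_equal; ring).
  eapply Rle_trans; [apply Cmod_triangle|]. rewrite Cmod_real, Cmod_imag. lra.
Qed.

Lemma ccont_horiz (f : C -> C) (x y : R) : ex_derive f (x, y) -> ccont (fun t => f (t, y)) x.
Proof.
  intros H. apply (ccont_comp f (fun t => (t, y)) x 1); auto. intros s.
  replace (((s, y) : C) - ((x, y) : C))%C with ((s - x, 0) : C) by (unfold Cminus, Cplus, Copp; simpl; f_equal; ring).
  rewrite Cmod_real. lra.
Qed.
Lemma ccont_vert (f : C -> C) (x y : R) : ex_derive f (x, y) -> ccont (fun t => f (x, t)) y.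
Proof.
  intros H. apply (ccont_comp f (fun t => (x, t)) y 1); auto. intros s.
  replace (((x, s) : C) - ((x, y) : C))%C with ((0, s - y) : C) by (unfold Cminus, Cplus, Copp; simpl; f_equal; ring).
  rewrite Cmod_imag. lra.
Qed.

Definition rect_int (f : C -> C) (a b c d : R) : C :=
  (CI (fun x => f (x, c)) a b + Ci * CI (fun y => f (b, y)) c d
   - CI (fun x => f (x, d)) a b - Ci * CI (fun y => f (a, y)) c d)%C.

Definition ex_horiz (f : C -> C) (a b y : R) := exCI (fun x => f (x, y)) a b.
Definition ex_vert (f : C -> C) (c d x : R) := exCI (fun y => f (x, y)) c d.

Lemma rect_int_split_x f a e b c d : a <= e <= b -> ex_horiz f a b c -> ex_horiz f a b d ->
  rect_int f a b c d = (rect_int f a e c d + rect_int f e b c d)%C.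
Proof.
  intros He Hc Hd. unfold rect_int.
  rewrite (CI_Chasles _ a e b He Hc), (CI_Chasles _ a e b He Hd). ring.
Qed.
Lemma rect_int_split_y f a b c e d : c <= e <= d -> ex_vert f c d a -> ex_vert f c d b ->
  rect_int f a b c d = (rect_int f a b c e + rect_int f a b e d)%C.
Proof.
  intros He Hc Hd. unfold rect_int.
  rewrite (CI_Chasles _ c e d He Hc), (CI_Chasles _ c e d He Hd). ring.
Qed.

Lemma rect_int_ext f g a b c d : a <= b -> c <= d -> (forall z, f z = g z) ->
  rect_int f a b c d = rect_int g a b c d.
Proof.
  intros Hab Hcd H. unfold rect_int.
  rewrite (CI_ext (fun x => f (x, c)) (fun x => g (x, c)) a b Hab (fun t _ => H (t, c))).
  rewrite (CI_ext (fun x => f (x, d)) (fun x => g (x, d)) a b Hab (fun t _ => H (t, d))).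
  rewrite (CI_ext (fun y => f (a, y)) (fun y => g (a, y)) c d Hcd (fun t _ => H (a, t))).
  rewrite (CI_ext (fun y => f (b, y)) (fun y => g (b, y)) c d Hcd (fun t _ => H (b, t))).
  reflexivity.
Qed.

Lemma rect_int_bound f a b c d M : a <= b -> c <= d ->
  ex_horiz f a b c -> ex_horiz f a b d -> ex_vert f c d a -> ex_vert f c d b ->
  (forall x y, a <= x <= b -> c <= y <= d -> (x = a \/ x = b \/ y = c \/ y = d) ->
     Cmod (f (x, y)) <= M) ->
  Cmod (rect_int f a b c d) <= 2 * (b - a + (d - c)) * M.
Proof.
  intros Hab Hcd H1 H2 H3 H4 HM. unfold rect_int.
  pose proof (CI_bound _ a b M Hab H1 ltac:(intros; apply HM; lra)).
  pose proof (CI_bound _ a b M Hab H2 ltac:(intros; apply HM; lra)).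
  pose proof (CI_bound _ c d M Hcd H3 ltac:(intros; apply HM; lra)).
  pose proof (CI_bound _ c d M Hcd H4 ltac:(intros; apply HM; lra)).
  unfold Cminus.
  eapply Rle_trans; [apply Cmod_triangle|]. rewrite Cmod_opp, Cmod_mult, Cmod_Ci.
  eapply Rle_trans; [apply Rplus_le_compat_r, Cmod_triangle|]. rewrite Cmod_opp.
  eapply Rle_trans; [apply Rplus_le_compat_r, Rplus_le_compat_r, Cmod_triangle|].
  rewrite Cmod_mult, Cmod_Ci. lra.
Qed.

Lemma rect_int_minus f g a b c d :
  ex_horiz f a b c -> ex_horiz f a b d -> ex_vert f c d a -> ex_vert f c d b ->
  ex_horiz g a b c -> ex_horiz g a b d -> ex_vert g c d a -> ex_vert g c d b ->
  rect_int (fun z => f z - g z)%C a b c d = (rect_int f a b c d - rect_int g a b c d)%C.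
Proof.
  intros. unfold rect_int. rewrite !CI_minus; auto. ring.
Qed.

Lemma ex_derive_affine (k l p : C) (z : C) : ex_derive (fun z => k + l * (z - p))%C z.
Proof.
  exists l. apply is_derive_C_iff. intros eps He. exists 1. split; [lra|]. intros y _.
  replace (k + l * (y - p) - (k + l * (z - p)) - l * (y - z))%C with (RtoC 0) by ring.
  rewrite Cmod_0. pose proof (Cmod_ge_0 (y - z)). nra.
Qed.

Definition dif_on (f : C -> C) (a b c d : R) :=
  forall x y, a <= x <= b -> c <= y <= d -> ex_derive f (x, y).

Lemma dif_on_exH f a b c d y : a <= b -> dif_on f a b c d -> c <= y <= d -> ex_horiz f a b y.
Proof. intros Hab H Hy. apply exCI_cont; auto. intros; apply ccont_horiz, H; auto. Qed.
Lemma dif_on_exV f a b c d x : c <= d -> dif_on f a b c d -> a <= x <= b -> ex_vert f c d x.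
Proof. intros Hab H Hy. apply exCI_cont; auto. intros; apply ccont_vert, H; auto. Qed.

(** Chain rule for a path of constant velocity [v]; sides of rectangles, loops around the puncture
    and radial segments are all of this kind. *)
Lemma is_derive_R_along_line (f : C -> C) (g : R -> C) (v l : C) (t : R) :
  (forall s, (g s - g t)%C = (v * RtoC (s - t))%C) -> is_derive f (g t) l ->
  is_derive (V := C_R_NormedModule) (fun s => f (g s)) t (v * l)%C.
Proof.
  intros Hg Hf. split; [apply @is_linear_scal_l|].
  intros x Hx eps.
  assert (Ex : x = t). { symmetry. apply (is_filter_lim_locally_unique (V := R_NormedModule)). exact Hx. }
  subst x. pose proof (Cmod_ge_0 v) as Hv.
  (* Dividing by [Cmod v + 1] instead of [Cmod v] admits [v = 0]. *)
  destruct (proj1 (is_derive_C_iff _ _ _) Hf (eps / (Cmod v + 1))) as [d [Hd0 Hd]].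
  { apply Rdiv_lt_0_compat; [apply cond_pos|lra]. }
  assert (Hd1 : 0 < d / (Cmod v + 1)) by (apply Rdiv_lt_0_compat; lra).
  exists (mkposreal _ Hd1). intros s Hs.
  change (Rabs (s - t) < d / (Cmod v + 1)) in Hs.
  apply (Rmult_lt_compat_l (Cmod v + 1)) in Hs; [|lra].
  replace ((Cmod v + 1) * (d / (Cmod v + 1))) with d in Hs by (field; lra).
  assert (Hn : Cmod (g s - g t) = Cmod v * Rabs (s - t)) by now rewrite Hg, Cmod_mult, Cmod_R.
  pose proof (Rabs_pos (s - t)) as Hp.
  specialize (Hd (g s)). rewrite Hn in Hd. specialize (Hd ltac:(nra)).
  change (@norm R_AbsRing C_R_NormedModule (f (g s) - f (g t) - scal (s - t)%R (v * l)%C)%C <= eps * Rabs (s - t)).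
  rewrite <- Cmod_norm, scal_R_Cmult.
  replace (RtoC (s - t) * (v * l))%C with (l * (g s - g t))%C by (rewrite Hg; ring).
  eapply Rle_trans; [exact Hd|].
  rewrite <- Rmult_assoc. apply Rmult_le_compat_r; auto.
  apply Rmult_le_reg_r with (Cmod v + 1); [lra|].
  replace (eps / (Cmod v + 1) * Cmod v * (Cmod v + 1)) with (eps * Cmod v) by (field; lra).
  pose proof (cond_pos eps). nra.
Qed.

Lemma CI_derive_along_line (T f : C -> C) (g : R -> C) (v : C) (a b : R) : a <= b ->
  (forall t s, (g s - g t)%C = (v * RtoC (s - t))%C) ->
  (forall t, a <= t <= b -> is_derive T (g t) (f (g t))) ->
  (forall t, a <= t <= b -> ex_derive f (g t)) ->
  (v * CI (fun t => f (g t)) a b)%C = (T (g b) - T (g a))%C.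
Proof.
  intros Hab Hg HT Hf.
  assert (Hc : forall h, (forall t, a <= t <= b -> ex_derive h (g t)) ->
     forall t, a <= t <= b -> ccont (fun t => h (g t)) t).
  { intros h Hh t Ht. apply (ccont_comp h g t (Cmod v)); auto.
    intros s. rewrite Hg, Cmod_mult, Cmod_R. lra. }
  rewrite <- CI_scal by (apply exCI_cont; auto).
  apply (is_RInt_unique (V := C_R_CompleteNormedModule)).
  apply (is_RInt_derive (V := C_R_CompleteNormedModule) (fun t => T (g t)));
    rewrite Rmin_left, Rmax_right by lra; intros t Ht.
  - apply is_derive_R_along_line; auto.
  - apply ccont_continuous. apply (Hc (fun z => v * f z)%C); auto.
    intros s Hs. destruct (Hf s Hs) as [l Hl]. eexists.
    apply is_derive_C_mult; [apply is_derive_C_const|exact Hl].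
Qed.

(** The quadratic primitive [T] turns each side into a difference of values at two corners, and the
    sum around the rectangle telescopes. Goursat's theorem subtracts such an affine part. *)
Lemma rect_int_affine (k l p : C) a b c d : a <= b -> c <= d ->
  rect_int (fun z => k + l * (z - p))%C a b c d = 0%C.
Proof.
  intros Hab Hcd.
  set (T := fun z : C => (k * z + l * (z * z / 2 - p * z))%C).
  assert (HT : forall z, is_derive T z (k + l * (z - p))%C).
  { intros z. apply is_derive_C_iff. intros eps He.
    pose proof (Cmod_ge_0 (l / 2)) as Hl.
    exists (eps / (Cmod (l / 2) + 1)). split; [apply Rdiv_lt_0_compat; lra|].
    intros y Hy. apply (Rmult_lt_compat_l (Cmod (l / 2) + 1)) in Hy; [|lra].
    replace ((Cmod (l / 2) + 1) * (eps / (Cmod (l / 2) + 1))) with eps in Hy by (field; lra).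
    replace (T y - T z - (k + l * (z - p)) * (y - z))%C with (l / 2 * (y - z) * (y - z))%C.
    - rewrite !Cmod_mult. apply Rmult_le_compat_r; [apply Cmod_ge_0|].
      pose proof (Cmod_ge_0 (y - z)). nra.
    - unfold T. field. }
  unfold rect_int.
  assert (HH : forall y, (CI (fun x => k + l * ((x, y) - p)) a b = T (b, y) - T (a, y))%C).
  { intros y. rewrite <- (CI_derive_along_line T (fun z => k + l * (z - p))%C (fun x => (x, y)) 1%C); auto.
    - ring.
    - intros. apply injective_projections; simpl; ring.
    - intros; apply ex_derive_affine. }
  assert (HV : forall x, (Ci * CI (fun y => k + l * ((x, y) - p)) c d = T (x, d) - T (x, c))%C).
  { intros x. rewrite <- (CI_derive_along_line T (fun z => k + l * (z - p))%C (fun y => (x, y)) Ci); auto.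
    - intros. apply injective_projections; simpl; ring.
    - intros; apply ex_derive_affine. }
  rewrite !HH, !HV. ring.
Qed.

(** Produces the sequence of nested rectangles: each choice depends on the previous rectangle, and
    the invariant [P] travels along inside a sigma type. *)
Lemma dependent_choice_nat (X : Type) (P : nat -> X -> Prop) (R : nat -> X -> X -> Prop) (x0 : X) :
  P O x0 -> (forall n x, P n x -> exists y, P (S n) y /\ R n x y) ->
  exists u : nat -> X, u O = x0 /\ forall n, P n (u n) /\ R n (u n) (u (S n)).
Proof.
  intros H0 HS.
  set (step := fun n (x : {x : X | P n x}) =>
    constructive_indefinite_description _ (HS n (proj1_sig x) (proj2_sig x))).
  set (v := nat_rect (fun n => {x : X | P n x}) (exist _ x0 H0)
     (fun n x => exist (P (S n)) (proj1_sig (step n x)) (proj1 (proj2_sig (step n x))))).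
  exists (fun n => proj1_sig (v n)). split; [reflexivity|]. intros n. split.
  - exact (proj2_sig (v n)).
  - exact (proj2 (proj2_sig (step n (v n)))).
Qed.

Lemma nested_intervals (a b : nat -> R) :
  (forall n, a n <= a (S n)) -> (forall n, b (S n) <= b n) -> (forall n, a n <= b n) ->
  exists p, forall n, a n <= p <= b n.
Proof.
  intros Ha Hb Hab.
  assert (Ha' : forall n k, a n <= a (n + k)%nat).
  { intros n; induction k; [rewrite Nat.add_0_r; lra|]. rewrite Nat.add_succ_r. specialize (Ha (n + k)%nat). lra. }
  assert (Hb' : forall n k, b (n + k)%nat <= b n).
  { intros n; induction k; [rewrite Nat.add_0_r; lra|]. rewrite Nat.add_succ_r. specialize (Hb (n + k)%nat). lra. }
  assert (Hc : forall n k, a n <= b k).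
  { intros n k. specialize (Ha' n k). specialize (Hb' k n). rewrite Nat.add_comm in Hb'. specialize (Hab (n + k)%nat). lra. }
  destruct (completeness (fun x => exists n, x = a n)) as [p [Hp1 Hp2]].
  - exists (b O). intros x [n ->]. apply Hc.
  - exists (a O). now exists O.
  - exists p. intros n. split.
    + apply Hp1. now exists n.
    + apply Hp2. intros x [k ->]. apply Hc.
Qed.

Lemma dif_on_sub f a b c d a' b' c' d' : dif_on f a b c d ->
  a <= a' -> b' <= b -> c <= c' -> d' <= d -> dif_on f a' b' c' d'.
Proof. intros H ? ? ? ? x y ? ?. apply H; lra. Qed.

Lemma dif_on_ex f a b c d : a <= b -> c <= d -> dif_on f a b c d ->
  ex_horiz f a b c /\ ex_horiz f a b d /\ ex_vert f c d a /\ ex_vert f c d b.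
Proof.
  intros Hab Hcd H. repeat split.
  1,2: apply (dif_on_exH f a b c d); auto; lra.
  1,2: apply (dif_on_exV f a b c d); auto; lra.
Qed.

Lemma rect_int_quarters f a c l m : 0 <= l -> 0 <= m -> dif_on f a (a + 2 * l) c (c + 2 * m) ->
  rect_int f a (a + 2 * l) c (c + 2 * m) =
  (rect_int f a (a + l) c (c + m) + rect_int f (a + l) (a + l + l) c (c + m)
   + rect_int f a (a + l) (c + m) (c + m + m) + rect_int f (a + l) (a + l + l) (c + m) (c + m + m))%C.
Proof.
  intros Hl Hm H.
  rewrite (rect_int_split_x f a (a + l)) by (try lra; apply (dif_on_exH f a (a + 2 * l) c (c + 2 * m)); auto; lra).
  rewrite (rect_int_split_y f a (a + l) c (c + m)) by (try lra; apply (dif_on_exV f a (a + 2 * l) c (c + 2 * m)); auto; lra).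
  rewrite (rect_int_split_y f (a + l) (a + 2 * l) c (c + m)) by (try lra; apply (dif_on_exV f a (a + 2 * l) c (c + 2 * m)); auto; lra).
  replace (a + 2 * l) with (a + l + l) by ring. replace (c + 2 * m) with (c + m + m) by ring. ring.
Qed.

(** Bisection: if the integral were nonzero, some quarter would always keep at least a quarter of
    its size, whereas near the common point of the nested rectangles the linear approximation makes
    the integral small compared with the square of the side lengths. *)
Lemma goursat f a b c d : a <= b -> c <= d -> dif_on f a b c d -> rect_int f a b c d = 0%C.
Proof.
  intros Hab Hcd Hf.
  destruct (Req_dec (Cmod (rect_int f a b c d)) 0) as [H0|H0]; [now apply Cmod_eq_0|exfalso].
  assert (Hpos : 0 < Cmod (rect_int f a b c d)) by (pose proof (Cmod_ge_0 (rect_int f a b c d)); lra).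
  set (L := b - a). set (M := d - c).
  assert (HL : 0 <= L) by (unfold L; lra). assert (HM : 0 <= M) by (unfold M; lra).
  (* Chosen so that [eps * (L + M)^2] is strictly below the modulus of the integral, even for a
     degenerate rectangle; this starts the induction. *)
  pose (eps := Cmod (rect_int f a b c d) / (2 * ((L + M)^2 + 1))).
  assert (Heps : 0 < eps) by (apply Rdiv_lt_0_compat; nra).
  set (l := fun n : nat => L / 2 ^ n). set (m := fun n : nat => M / 2 ^ n).
  assert (H2n : forall n, 0 < 2 ^ n) by (intros; apply pow_lt; lra).
  assert (Hln : forall n, 0 <= l n) by (intros; unfold l; apply Rdiv_le_0_compat; auto).
  assert (Hmn : forall n, 0 <= m n) by (intros; unfold m; apply Rdiv_le_0_compat; auto).
  assert (HlS : forall n, l n = 2 * l (S n)) by (intros n; unfold l; simpl; specialize (H2n n); field; lra).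
  assert (HmS : forall n, m n = 2 * m (S n)) by (intros n; unfold m; simpl; specialize (H2n n); field; lra).
  (* Halving both sides divides [(l n + m n)^2] by four, so a lower bound of this quadratic form is
     inherited by at least one quarter. *)
  set (P := fun n (p : R * R) => a <= fst p /\ fst p + l n <= b /\ c <= snd p /\ snd p + m n <= d /\
     eps * (l n + m n) ^ 2 < Cmod (rect_int f (fst p) (fst p + l n) (snd p) (snd p + m n))).
  set (Q := fun n (p q : R * R) => fst p <= fst q /\ fst q + l (S n) <= fst p + l n /\
         snd p <= snd q /\ snd q + m (S n) <= snd p + m n).
  destruct (dependent_choice_nat _ P Q (a, c)) as [u [_ Hu]].
  - unfold P, l, m; simpl. rewrite !Rdiv_1_r. unfold L, M.
    replace (a + (b - a)) with b by ring. replace (c + (d - c)) with d by ring.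
    repeat split; try lra. fold L M. unfold eps.
    apply Rmult_lt_reg_r with (2 * ((L + M) ^ 2 + 1)); [nra|].
    replace (Cmod (rect_int f a b c d) / (2 * ((L + M) ^ 2 + 1)) * ((L + M) * ((L + M) * 1)) * (2 * ((L + M) ^ 2 + 1)))
      with (Cmod (rect_int f a b c d) * (L + M)^2) by (field; nra).
    apply Rmult_lt_compat_l; [exact Hpos|]. nra.
  - intros n [x y] (H1 & H2 & H3 & H4 & H5). unfold P, Q. simpl fst in *; simpl snd in *.
    pose proof (Hln (S n)) as G1. pose proof (Hmn (S n)) as G2.
    pose proof (HlS n) as E1. pose proof (HmS n) as E2.
    rewrite E1 in H2, H5 |- *. rewrite E2 in H4, H5 |- *.
    rewrite rect_int_quarters in H5; auto; [|apply (dif_on_sub f a b c d); auto].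
    set (l' := l (S n)) in *. set (m' := m (S n)) in *.
    set (I1 := rect_int f x (x + l') y (y + m')) in *.
    set (I2 := rect_int f (x + l') (x + l' + l') y (y + m')) in *.
    set (I3 := rect_int f x (x + l') (y + m') (y + m' + m')) in *.
    set (I4 := rect_int f (x + l') (x + l' + l') (y + m') (y + m' + m')) in *.
    pose proof (Cmod_triangle (I1 + I2 + I3) I4). pose proof (Cmod_triangle (I1 + I2) I3).
    pose proof (Cmod_triangle I1 I2).
    destruct (Rlt_le_dec (eps * (l' + m') ^ 2) (Cmod I1)) as [K|K1].
    { exists (x, y); simpl; repeat split; auto; lra. }
    destruct (Rlt_le_dec (eps * (l' + m') ^ 2) (Cmod I2)) as [K|K2].
    { exists (x + l', y); simpl; repeat split; auto; lra. }
    destruct (Rlt_le_dec (eps * (l' + m') ^ 2) (Cmod I3)) as [K|K3].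
    { exists (x, y + m'); simpl; repeat split; auto; lra. }
    destruct (Rlt_le_dec (eps * (l' + m') ^ 2) (Cmod I4)) as [K|K4].
    { exists (x + l', y + m'); simpl; repeat split; auto; lra. }
    exfalso. replace (eps * (2 * l' + 2 * m') ^ 2) with (4 * (eps * (l' + m') ^ 2)) in H5 by ring. lra.
  - destruct (nested_intervals (fun n => fst (u n)) (fun n => fst (u n) + l n)) as [p Hp].
    1,2: intros n; apply (proj2 (Hu n)).
    { intros n. specialize (Hln n). lra. }
    destruct (nested_intervals (fun n => snd (u n)) (fun n => snd (u n) + m n)) as [q Hq].
    1,2: intros n; apply (proj2 (Hu n)).
    { intros n. specialize (Hmn n). lra. }
    destruct (ex_derive_C_eps f (p, q)) as [k Hk].
    { destruct (Hu O) as [(H1 & H2 & H3 & H4 & _) _]. specialize (Hp O). specialize (Hq O). apply Hf; lra. }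
    (* The perimeter is [2 * (l n + m n)] and the deviation from the affine part at most
       [eps / 4 * (l n + m n)], so the integral is at most half of what [P] demands. *)
    destruct (Hk (eps / 4)) as [dl [Hdl0 Hdl]]; [lra|].
    destruct (pow_lt_1_zero (/ 2) ltac:(rewrite Rabs_right; lra) (dl / (L + M + 1))) as [n Hn].
    { apply Rdiv_lt_0_compat; lra. }
    specialize (Hn n (Nat.le_refl n)).
    destruct (Hu n) as [(H1 & H2 & H3 & H4 & H5) _]. specialize (Hp n). specialize (Hq n).
    set (x := fst (u n)) in *. set (y := snd (u n)) in *.
    assert (Hs : l n + m n < dl).
    { unfold l, m. rewrite Rabs_right in Hn by (apply Rle_ge, pow_le; lra). rewrite pow_inv in Hn.
      unfold Rdiv. rewrite <- Rmult_plus_distr_r.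
      apply Rle_lt_trans with ((L + M + 1) * / 2 ^ n).
      - apply Rmult_le_compat_r; [left; apply Rinv_0_lt_compat; auto|lra].
      - apply (Rmult_lt_compat_l (L + M + 1)) in Hn; [|lra].
        replace ((L + M + 1) * (dl / (L + M + 1))) with dl in Hn by (field; lra). exact Hn. }
    specialize (Hln n). specialize (Hmn n).
    assert (Hd1 : dif_on f x (x + l n) y (y + m n)) by (apply (dif_on_sub f a b c d); auto).
    assert (Hx1 : x <= x + l n) by lra. assert (Hy1 : y <= y + m n) by lra.
    set (A := fun z => (f (p, q) + k * (z - (p, q)))%C).
    assert (Hd2 : dif_on A x (x + l n) y (y + m n)) by (intros ? ? _ _; apply ex_derive_affine).
    assert (Hd3 : dif_on (fun z => f z - A z)%C x (x + l n) y (y + m n)).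
    { intros x0 y0 Hx Hy. destruct (Hd1 x0 y0 Hx Hy). destruct (Hd2 x0 y0 Hx Hy).
      eexists. apply is_derive_C_minus; eauto. }
    assert (E : rect_int (fun z => f z - A z)%C x (x + l n) y (y + m n) = rect_int f x (x + l n) y (y + m n)).
    { destruct (dif_on_ex f _ _ _ _ Hx1 Hy1 Hd1) as (? & ? & ? & ?).
      destruct (dif_on_ex A _ _ _ _ Hx1 Hy1 Hd2) as (? & ? & ? & ?).
      rewrite rect_int_minus by assumption. unfold A. rewrite rect_int_affine by lra. ring. }
    rewrite <- E in H5.
    assert (B : Cmod (rect_int (fun z => f z - A z)%C x (x + l n) y (y + m n)) <=
       2 * (x + l n - x + (y + m n - y)) * (eps / 4 * (l n + m n))).
    { destruct (dif_on_ex _ _ _ _ _ Hx1 Hy1 Hd3) as (? & ? & ? & ?).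
      apply rect_int_bound; try assumption.
      intros x0 y0 Hx Hy _.
      assert (Hz : Cmod ((x0, y0) - (p, q)) <= l n + m n).
      { unfold Cminus, Cplus, Copp; simpl. eapply Rle_trans; [apply Cmod_pair_le|].
        apply Rplus_le_compat; apply Rabs_le; lra. }
      unfold A. replace (f (x0, y0) - (f (p, q) + k * ((x0, y0) - (p, q))))%C with
        (f (x0, y0) - f (p, q) - k * ((x0, y0) - (p, q)))%C by ring.
      eapply Rle_trans; [apply Hdl; lra|]. apply Rmult_le_compat_l; lra. }
    replace (2 * (x + l n - x + (y + m n - y)) * (eps / 4 * (l n + m n))) with (eps * (l n + m n) ^ 2 / 2) in B by field.
    assert (0 <= eps * (l n + m n) ^ 2) by (apply Rmult_le_pos; [lra|apply pow2_ge_0]). lra.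
Qed.

(** * Cauchy's formula: derivatives of holomorphic functions are holomorphic *)

Lemma Cminus_neq_0 (x y : C) : x <> y -> (x - y)%C <> 0%C.
Proof. intros H E. apply H. replace x with ((x - y) + y)%C by ring. rewrite E. ring. Qed.

(** Goursat's theorem across a bounded singularity: only a small square around [b] contributes, and
    its perimeter times [M] can be made arbitrarily small. *)
Lemma rect_int_exceptional (g : C -> C) (b : C) (p q c d M dl : R) :
  p < fst b < q -> c < snd b < d -> 0 < dl ->
  (forall x y, p <= x <= q -> c <= y <= d -> (x, y) <> b -> ex_derive g (x, y)) ->
  (forall z, z <> b -> Cmod (z - b) < dl -> Cmod (g z) <= M) ->
  rect_int g p q c d = 0%C.
Proof.
  destruct b as [b1 b2]; simpl. intros Hp Hc Hdl Hg HM.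
  destruct (Req_dec (Cmod (rect_int g p q c d)) 0) as [H0|H0]; [now apply Cmod_eq_0|exfalso].
  assert (Hpos : 0 < Cmod (rect_int g p q c d)) by (pose proof (Cmod_ge_0 (rect_int g p q c d)); lra).
  set (I := Cmod (rect_int g p q c d)) in *.
  pose proof (Rabs_pos M) as HM0. pose proof (Rle_abs M) as HM1.
  set (s0 := Rmin (Rmin (b1 - p) (q - b1)) (Rmin (b2 - c) (d - b2))).
  assert (Hs0 : 0 < s0) by (unfold s0; repeat apply Rmin_pos; lra).
  assert (Hs0b : s0 <= b1 - p /\ s0 <= q - b1 /\ s0 <= b2 - c /\ s0 <= d - b2).
  { unfold s0, Rmin. repeat destruct (Rle_dec _ _); lra. }
  (* The three bounds keep the square inside the rectangle, inside the disc where [g] is bounded,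
     and so small that [8 * s * Rabs M] stays below [I]. *)
  set (s := Rmin (s0 / 2) (Rmin (dl / 3) (I / (8 * Rabs M + 1) / 2))).
  assert (Hs : 0 < s).
  { unfold s; repeat apply Rmin_pos; try lra. apply Rdiv_lt_0_compat; [|lra]. apply Rdiv_lt_0_compat; lra. }
  assert (Hsb : s <= s0 / 2 /\ s <= dl / 3 /\ s <= I / (8 * Rabs M + 1) / 2).
  { unfold s. split; [apply Rmin_l|]. split; (eapply Rle_trans; [apply Rmin_r|]); [apply Rmin_l|apply Rmin_r]. }
  destruct Hsb as (Hsb1 & Hsb2 & Hsb3).
  assert (HsI : s * (8 * Rabs M + 1) < I).
  { apply Rle_lt_trans with (I / (8 * Rabs M + 1) / 2 * (8 * Rabs M + 1)).
    - apply Rmult_le_compat_r; lra.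
    - replace (I / (8 * Rabs M + 1) / 2 * (8 * Rabs M + 1)) with (I / 2) by (field; lra). lra. }
  assert (EH : forall y, c <= y <= d -> y <> b2 -> ex_horiz g p q y).
  { intros y Hy Hy2. apply exCI_cont; [lra|]. intros t Ht. apply ccont_horiz, Hg; auto.
    intros E; injection E; auto. }
  assert (EV : forall x, p <= x <= q -> x <> b1 -> ex_vert g c d x).
  { intros x Hx Hx2. apply exCI_cont; [lra|]. intros t Ht. apply ccont_vert, Hg; auto.
    intros E; injection E; auto. }
  assert (EH' : forall x y y', p <= x <= y -> y <= q -> c <= y' <= d -> y' <> b2 -> ex_horiz g x y y').
  { intros. apply exCI_sub with p q; auto. apply EH; auto. }
  assert (EV' : forall x y x', c <= x <= y -> y <= d -> p <= x' <= q -> x' <> b1 -> ex_vert g x y x').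
  { intros. apply exCI_sub with c d; auto. apply EV; auto. }
  assert (G : forall x x' y y', p <= x <= x' -> x' <= q -> c <= y <= y' -> y' <= d ->
     (x' < b1 \/ b1 < x \/ y' < b2 \/ b2 < y) -> rect_int g x x' y y' = 0%C).
  { intros x x' y y' H1 H2 H3 H4 H5. apply goursat; try lra.
    intros x1 y1 Hx1 Hy1. apply Hg; try lra. intros E; injection E; intros; lra. }
  (* Cutting off the left, right, lower and upper strips, on which Goursat's theorem applies, leaves
     the square around [b]. *)
  assert (E : rect_int g p q c d = rect_int g (b1 - s) (b1 + s) (b2 - s) (b2 + s)).
  { rewrite (rect_int_split_x g p (b1 - s) q c d) by (try lra; apply EH; lra).
    rewrite (rect_int_split_x g (b1 - s) (b1 + s) q c d) by (try lra; apply EH'; lra).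
    rewrite (rect_int_split_y g (b1 - s) (b1 + s) c (b2 - s) d) by (try lra; apply EV; lra).
    rewrite (rect_int_split_y g (b1 - s) (b1 + s) (b2 - s) (b2 + s) d) by (try lra; apply EV'; lra).
    rewrite (G p (b1 - s) c d), (G (b1 + s) q c d), (G (b1 - s) (b1 + s) c (b2 - s)),
      (G (b1 - s) (b1 + s) (b2 + s) d) by lra. ring. }
  assert (B : I <= 2 * (b1 + s - (b1 - s) + (b2 + s - (b2 - s))) * Rabs M).
  { unfold I. rewrite E. apply rect_int_bound;
      [lra|lra|apply EH'; lra|apply EH'; lra|apply EV'; lra|apply EV'; lra|].
    intros x y Hx Hy Hb. eapply Rle_trans; [apply HM|lra].
    - intros E'; injection E'; intros; lra.
    - unfold Cminus, Cplus, Copp; simpl. eapply Rle_lt_trans; [apply Cmod_pair_le|].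
      assert (Rabs (x + - b1) <= s) by (apply Rabs_le; lra).
      assert (Rabs (y + - b2) <= s) by (apply Rabs_le; lra). lra. }
  nra.
Qed.

Lemma ccont_bounded (f : R -> C) (a b : R) : a <= b -> (forall t, a <= t <= b -> ccont f t) ->
  exists M, 0 <= M /\ forall t, a <= t <= b -> Cmod (f t) <= M.
Proof.
  intros Hab H.
  destruct (continuity_ab_maj (fun t => Cmod (f t)) a b Hab) as [x [Hx _]].
  - intros t Ht. intros eps He. destruct (H t Ht eps He) as [d [Hd0 Hd]].
    exists d. split; [exact Hd0|]. intros s [_ Hs]. simpl in *. unfold Rdist in *.
    specialize (Hd s Hs). eapply Rle_lt_trans; [|exact Hd].
    pose proof (Cmod_triangle (f s - f t) (f t)) as H1.
    pose proof (Cmod_triangle (f t - f s) (f s)) as H2. rewrite (Cmod_minus_sym (f t)) in H2.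
    replace (f s - f t + f t)%C with (f s) in H1 by ring.
    replace (f t - f s + f s)%C with (f t) in H2 by ring. apply Rabs_le. lra.
  - exists (Cmod (f x)). split; [apply Cmod_ge_0|]. exact Hx.
Qed.

(** [k1] is minus the derivative of [k], because the parameter enters as [k (z - b)]. The quadratic
    remainder is uniform for [eta <= Cmod p], which is what differentiation under the integral sign
    requires. *)
Definition kernel_deriv (k k1 : C -> C) : Prop :=
  (forall p : C, p <> 0%C -> ex_derive k p /\ ex_derive k1 p) /\
  forall eta, 0 < eta -> exists N, 0 <= N /\ forall p e : C, eta <= Cmod p -> Cmod e < eta / 2 ->
    Cmod (k (p - e)%C - k p - e * k1 p) <= N * (Cmod e * Cmod e).

(** Integrating the uniform remainder leaves a multiple of [Cmod (y - b)^2], which is small compared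
    with [Cmod (y - b)]. *)
Lemma CI_kernel_derive (phi k k1 : C -> C) (g : R -> C) (al be eta : R) (b : C) :
  kernel_deriv k k1 -> al <= be -> 0 < eta ->
  (forall s t, Cmod (g s - g t) <= 1 * Rabs (s - t)) ->
  (forall t, al <= t <= be -> ex_derive phi (g t)) ->
  (forall t, al <= t <= be -> eta <= Cmod (g t - b)) ->
  is_derive (fun b' => CI (fun t => phi (g t) * k (g t - b')%C)%C al be) b
    (CI (fun t => phi (g t) * k1 (g t - b)%C)%C al be).
Proof.
  intros [Hk Hb] Hab Heta Hg Hphi Hd.
  destruct (Hb eta Heta) as [N [HN0 HN]].
  destruct (ccont_bounded (fun t => phi (g t)) al be Hab) as [M [HM0 HM]].
  { intros t Ht. apply (ccont_comp phi g t 1); auto. }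
  assert (Hfar : forall b' t, Cmod (b' - b) < eta / 2 -> al <= t <= be -> (g t - b')%C <> 0%C).
  { intros b' t Hb' Ht E. specialize (Hd t Ht).
    replace (g t - b)%C with ((g t - b') + (b' - b))%C in Hd by ring. rewrite E, Cplus_0_l in Hd. lra. }
  assert (Hex : forall h : C -> C, (forall p : C, p <> 0%C -> ex_derive h p) -> forall b', Cmod (b' - b) < eta / 2 ->
     exCI (fun t => phi (g t) * h (g t - b')%C)%C al be).
  { intros h Hh b' Hb'. apply exCI_cont; auto. intros t Ht.
    apply (ccont_comp (fun z => phi z * h (z - b')%C)%C g t 1); auto.
    destruct (Hphi t Ht) as [l1 H1]. destruct (Hh _ (Hfar b' t Hb' Ht)) as [l2 H2].
    eexists. apply is_derive_C_mult; [exact H1|]. apply (is_derive_C_comp h (fun z => z - b')%C); [exact H2|].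
    apply is_derive_C_minus; [apply is_derive_C_id|apply is_derive_C_const]. }
  assert (Hbb : Cmod (b - b) < eta / 2) by (replace (b - b)%C with (RtoC 0) by ring; rewrite Cmod_0; lra).
  apply is_derive_C_iff. intros eps He.
  set (T := (be - al) * (M * N) + 1). assert (HT : 0 < T) by (unfold T; assert (0 <= M * N) by nra; nra).
  exists (Rmin (eta / 2) (eps / T)). split; [apply Rmin_pos; [lra|now apply Rdiv_lt_0_compat]|].
  intros y Hy.
  assert (H1 : Cmod (y - b) < eta / 2) by (eapply Rlt_le_trans; [exact Hy|apply Rmin_l]).
  assert (H2 : Cmod (y - b) < eps / T) by (eapply Rlt_le_trans; [exact Hy|apply Rmin_r]).
  assert (X1 := Hex k (fun p Hp => proj1 (Hk p Hp)) y H1).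
  assert (X2 := Hex k (fun p Hp => proj1 (Hk p Hp)) b Hbb).
  assert (X3 := Hex k1 (fun p Hp => proj2 (Hk p Hp)) b Hbb).
  rewrite (Cmult_comm _ (y - b)), <- CI_scal by exact X3.
  rewrite <- CI_minus by assumption. rewrite <- CI_minus; [|now apply exCI_minus|now apply exCI_scal].
  pose proof (Cmod_ge_0 (y - b)) as Hy0.
  eapply Rle_trans; [apply (CI_bound _ al be (M * N * (Cmod (y - b) * Cmod (y - b)))); auto|].
  - apply exCI_minus; [now apply exCI_minus|now apply exCI_scal].
  - intros t Ht.
    replace (phi (g t) * k (g t - y)%C - phi (g t) * k (g t - b)%C - (y - b) * (phi (g t) * k1 (g t - b)%C))%C
      with (phi (g t) * (k ((g t - b) - (y - b))%C - k (g t - b)%C - (y - b) * k1 (g t - b)%C))%C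
      by (replace ((g t - b) - (y - b))%C with (g t - y)%C by ring; ring).
    rewrite Cmod_mult, Rmult_assoc. apply Rmult_le_compat; auto using Cmod_ge_0.
  - apply (Rmult_lt_compat_l T) in H2; [|exact HT].
    replace (T * (eps / T)) with eps in H2 by (field; lra). unfold T in H2.
    replace ((be - al) * (M * N * (Cmod (y - b) * Cmod (y - b))))
      with (((be - al) * (M * N) * Cmod (y - b)) * Cmod (y - b)) by ring.
    apply Rmult_le_compat_r; auto. lra.
Qed.

Lemma rect_int_kernel_derive (phi k k1 : C -> C) (p q c d eta : R) (b : C) :
  kernel_deriv k k1 -> p <= q -> c <= d -> 0 < eta ->
  (forall x y, p <= x <= q -> c <= y <= d -> (x = p \/ x = q \/ y = c \/ y = d) ->
     ex_derive phi (x, y) /\ eta <= Cmod ((x, y) - b)) ->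
  is_derive (fun b' => rect_int (fun z => phi z * k (z - b')%C) p q c d)%C b
    (rect_int (fun z => phi z * k1 (z - b)%C) p q c d)%C.
Proof.
  intros Hk Hpq Hcd Heta H. unfold rect_int.
  assert (HH : forall y, c <= y <= d -> y = c \/ y = d ->
    is_derive (fun b' => CI (fun x => phi (x, y) * k ((x, y) - b')%C)%C p q) b
    (CI (fun x => phi (x, y) * k1 ((x, y) - b)%C)%C p q)).
  { intros y Hy Hy'. apply (CI_kernel_derive phi k k1 (fun x => (x, y)) p q eta b); auto.
    - intros s t. replace (((s, y) : C) - ((t, y) : C))%C with ((s - t, 0) : C)
        by (apply injective_projections; simpl; ring). rewrite Cmod_real; lra.
    - intros t Ht. apply H; tauto.
    - intros t Ht. apply H; tauto. }
  assert (HV : forall x, p <= x <= q -> x = p \/ x = q ->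
    is_derive (fun b' => CI (fun y => phi (x, y) * k ((x, y) - b')%C)%C c d) b
    (CI (fun y => phi (x, y) * k1 ((x, y) - b)%C)%C c d)).
  { intros x Hx Hx'. apply (CI_kernel_derive phi k k1 (fun y => (x, y)) c d eta b); auto.
    - intros s t. replace (((x, s) : C) - ((x, t) : C))%C with ((0, s - t) : C)
        by (apply injective_projections; simpl; ring). rewrite Cmod_imag; lra.
    - intros t Ht. apply H; tauto.
    - intros t Ht. apply H; tauto. }
  assert (S : forall (F : C -> C) (l : C), is_derive F b l -> is_derive (fun b' => Ci * F b')%C b (Ci * l)%C).
  { intros F l HF. eapply is_derive_C_eq; [apply is_derive_C_mult; [apply is_derive_C_const|exact HF]|cbv beta; ring]. }
  assert (Hc : c <= c <= d) by lra. assert (Hd : c <= d <= d) by lra.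
  assert (Hp : p <= p <= q) by lra. assert (Hq : p <= q <= q) by lra.
  apply is_derive_C_minus; [apply is_derive_C_minus; [apply is_derive_C_plus|]|].
  - exact (HH c Hc (or_introl eq_refl)).
  - exact (S _ _ (HV q Hq (or_intror eq_refl))).
  - exact (HH d Hd (or_intror eq_refl)).
  - exact (S _ _ (HV p Hp (or_introl eq_refl))).
Qed.

Lemma kernel_deriv_inv : kernel_deriv (fun p => / p)%C (fun p => / (p * p))%C.
Proof.
  split.
  - intros p Hp. split; eexists.
    + apply is_derive_C_inv_id; auto.
    + apply (is_derive_C_inv (fun p => p * p)%C); [now apply Cmult_neq_0|]. apply is_derive_C_mult; apply is_derive_C_id.
  (* The remainder is [e^2 / ((p - e) p^2)], where [Cmod (p - e) > eta / 2]. *)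
  - intros eta Heta. exists (/ (eta / 2 * (eta * eta))).
    assert (He3 : 0 < eta / 2 * (eta * eta)) by (repeat apply Rmult_lt_0_compat; lra).
    split; [left; now apply Rinv_0_lt_compat|]. intros p e Hp He.
    assert (Hp0 : p <> 0%C) by (intros ->; rewrite Cmod_0 in Hp; lra).
    assert (Hpe : eta / 2 < Cmod (p - e)).
    { pose proof (Cmod_triangle (p - e) e). replace (p - e + e)%C with p in H by ring. lra. }
    assert (Hpe0 : (p - e)%C <> 0%C) by (intros E; rewrite E, Cmod_0 in Hpe; lra).
    replace (/ (p - e) - / p - e * / (p * p))%C with (e * e / ((p - e) * (p * p)))%C by (field; auto).
    rewrite Cmod_div by (repeat apply Cmult_neq_0; auto). rewrite !Cmod_mult.
    unfold Rdiv. rewrite Rmult_comm. apply Rmult_le_compat_r; [apply Rmult_le_pos; apply Cmod_ge_0|].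
    apply Rinv_le_contravar; auto. apply Rmult_le_compat; nra.
Qed.

Lemma kernel_deriv_inv2 : kernel_deriv (fun p => / (p * p))%C (fun p => 2 / (p * p * p))%C.
Proof.
  split.
  - intros p Hp. split; eexists.
    + apply (is_derive_C_inv (fun p => p * p)%C); [now apply Cmult_neq_0|]. apply is_derive_C_mult; apply is_derive_C_id.
    + apply (is_derive_C_div (fun p => 2)%C (fun p => p * p * p)%C); [repeat apply Cmult_neq_0; auto|apply is_derive_C_const|].
      apply is_derive_C_mult; [apply is_derive_C_mult|]; apply is_derive_C_id.
  (* The remainder is [e^2 (3 p - 2 e) / (p (p - e)^2 p^2)]; the 4 bounds the modulus of
     [(3 p - 2 e) / p], because [2 * Cmod e < eta <= Cmod p]. *)
  - intros eta Heta. exists (4 / (eta / 2 * (eta / 2) * (eta * eta))).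
    assert (He2 : 0 < eta * eta) by nra.
    assert (He3 : 0 < eta / 2 * (eta / 2) * (eta * eta)) by (repeat apply Rmult_lt_0_compat; lra).
    split; [left; apply Rdiv_lt_0_compat; lra|]. intros p e Hp He.
    assert (Hp0 : p <> 0%C) by (intros ->; rewrite Cmod_0 in Hp; lra).
    assert (Hpe : eta / 2 < Cmod (p - e)).
    { pose proof (Cmod_triangle (p - e) e). replace (p - e + e)%C with p in H by ring. lra. }
    assert (Hpe0 : (p - e)%C <> 0%C) by (intros E; rewrite E, Cmod_0 in Hpe; lra).
    set (P := Cmod p) in *.
    replace (/ ((p - e) * (p - e)) - / (p * p) - e * (2 / (p * p * p)))%C
      with ((3 * p - 2 * e) / p / ((p - e) * (p - e) * (p * p)) * (e * e))%C by (field; auto).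
    rewrite !Cmod_mult. apply Rmult_le_compat_r; [apply Rmult_le_pos; apply Cmod_ge_0|].
    rewrite !Cmod_div by (repeat apply Cmult_neq_0; auto). rewrite !Cmod_mult. fold P.
    apply Rmult_le_compat.
    + apply Rdiv_le_0_compat; [apply Cmod_ge_0|lra].
    + left. apply Rinv_0_lt_compat. repeat apply Rmult_lt_0_compat; lra.
    + apply Rmult_le_reg_r with P; [lra|].
      replace (Cmod (3 * p - 2 * e) / P * P) with (Cmod (3 * p - 2 * e)) by (field; lra).
      eapply Rle_trans; [apply Cmod_triangle|]. rewrite Cmod_opp, !Cmod_mult, !Cmod_R. fold P.
      rewrite !Rabs_right by lra. lra.
    + apply Rinv_le_contravar; auto. apply Rmult_le_compat; nra.
Qed.

Lemma CI_im_ge (h : R -> C) (a b m : R) : a <= b -> exCI h a b ->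
  (forall t, a <= t <= b -> m <= snd (h t)) -> (b - a) * m <= snd (CI h a b).
Proof.
  intros Hab Hex H. pose proof (CI_isCI _ _ _ Hex) as H1.
  pose proof (is_RInt_fct_extend_snd (U:=R_NormedModule) (V:=R_NormedModule) _ _ _ _ H1) as Hs.
  apply (is_RInt_le (fun _ => m) (fun t => snd (h t)) a b); auto.
  - apply (is_RInt_const (V := R_NormedModule)).
  - intros; apply H; lra.
Qed.

Lemma C_neq_of_snd (z : C) : snd z <> 0 -> z <> 0%C.
Proof. intros H E; apply H; now rewrite E. Qed.
Lemma C_neq_of_fst (z : C) : fst z <> 0 -> z <> 0%C.
Proof. intros H E; apply H; now rewrite E. Qed.

(** Cauchy's formula divides by this integral, so nonvanishing is enough and the value is not
    computed: on each side, with [dz] included, the imaginary part of the integrand is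
    [rho / (t^2 + rho^2) >= 1 / (2 rho)], which gives at least 1 per side. *)
Lemma winding_square_neq_0 (rho : R) : 0 < rho ->
  rect_int (fun z => / z)%C (- rho) rho (- rho) rho <> 0%C.
Proof.
  intros Hr. unfold rect_int.
  assert (Hex : forall f : R -> C, (forall t, ccont f t) -> exCI f (- rho) rho)
    by (intros; apply exCI_cont; [lra|auto]).
  assert (cH : forall y, y <> 0 -> forall x, ccont (fun x => / (x, y))%C x).
  { intros y Hy x. apply (ccont_horiz (fun z => / z)%C). eexists. apply is_derive_C_inv_id. now apply C_neq_of_snd. }
  assert (cV : forall x, x <> 0 -> forall y, ccont (fun y => / (x, y))%C y).
  { intros x Hx y. apply (ccont_vert (fun z => / z)%C). eexists. apply is_derive_C_inv_id. now apply C_neq_of_fst. }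
  replace (CI (fun x => / (x, (- rho)%R)) (- rho)%R rho + Ci * CI (fun y => / (rho, y)) (- rho)%R rho
    - CI (fun x => / (x, rho)) (- rho)%R rho - Ci * CI (fun y => / ((- rho)%R, y)) (- rho)%R rho)%C
    with (CI (fun x => / (x, (- rho)%R)) (- rho)%R rho + CI (fun y => Ci * / (rho, y)) (- rho)%R rho
    + (CI (fun x => (-1) * / (x, rho)) (- rho)%R rho + CI (fun y => (- Ci) * / ((- rho)%R, y)) (- rho)%R rho))%C.
  2:{ rewrite !CI_scal by (apply Hex; first [apply cH; lra|apply cV; lra]). ring. }
  apply C_neq_of_snd. cbn [snd Cplus].
  assert (B : forall h : R -> C, exCI h (- rho) rho ->
     (forall t, snd (h t) = rho / (t * t + rho * rho)) -> 1 <= snd (CI h (- rho) rho)).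
  { intros h Hh Ht. replace 1 with ((rho - - rho) * (/ (2 * rho))) by (field; lra).
    apply CI_im_ge; auto; [lra|]. intros t Hb. rewrite Ht.
    replace (/ (2 * rho)) with (rho / (rho * rho + rho * rho)) by (assert (0 < rho * rho) by (apply Rmult_lt_0_compat; lra); field; repeat split; nra).
    apply Rmult_le_compat_l; [lra|]. apply Rinv_le_contravar; [assert (0 <= t * t) by apply Rle_0_sqr; nra|]. assert ((rho - t) * (rho + t) >= 0) by (apply Rle_ge, Rmult_le_pos; lra). lra. }
  pose proof (B (fun x => / (x, (- rho)%R))%C) as B1.
  pose proof (B (fun y => Ci * / (rho, y))%C) as B2.
  pose proof (B (fun x => (-1) * / (x, rho))%C) as B3.
  pose proof (B (fun y => (- Ci) * / ((- rho)%R, y))%C) as B4.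
  enough (1 <= snd (CI (fun x => / (x, (- rho)%R))%C (- rho) rho) /\
   1 <= snd (CI (fun y => Ci * / (rho, y))%C (- rho) rho) /\
   1 <= snd (CI (fun x => (-1) * / (x, rho))%C (- rho) rho) /\
   1 <= snd (CI (fun y => (- Ci) * / ((- rho)%R, y))%C (- rho) rho)) by (simpl in *; lra).
  repeat split.
  - apply B1; [apply Hex, cH; lra|]. intros t; simpl. field; nra.
  - apply B2; [apply exCI_scal, Hex, cV; lra|]. intros t; simpl. field; nra.
  - apply B3; [apply exCI_scal, Hex, cH; lra|]. intros t; simpl. field; nra.
  - apply B4; [apply exCI_scal, Hex, cV; lra|]. intros t; simpl. field; nra.
Qed.

(** The difference quotient of [f] at [b] is bounded near [b], so its integral vanishes by
    [rect_int_exceptional]. The winding integral remains as an unevaluated factor. *)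
Lemma cauchy_formula_square (f : C -> C) (rho : R) (b : C) : 0 < rho ->
  (forall x y, - rho <= x <= rho -> - rho <= y <= rho -> ex_derive f (x, y)) -> Cmod b < rho ->
  (f b * rect_int (fun z => / (z - b)) (- rho) rho (- rho) rho
   = rect_int (fun z => f z * / (z - b)) (- rho) rho (- rho) rho)%C.
Proof.
  intros Hr Hf Hb. pose proof (Rmax_Cmod b) as Hm.
  assert (Hb1 : Rabs (fst b) < rho) by (eapply Rle_lt_trans; [apply Rmax_l|]; eapply Rle_lt_trans; eauto).
  assert (Hb2 : Rabs (snd b) < rho) by (eapply Rle_lt_trans; [apply Rmax_r|]; eapply Rle_lt_trans; eauto).
  apply Rabs_def2 in Hb1. apply Rabs_def2 in Hb2.
  set (g := fun z => ((f z - f b) * / (z - b))%C).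
  assert (Hg : rect_int g (- rho) rho (- rho) rho = 0%C).
  { destruct (ex_derive_C_eps f b) as [l Hl]. { rewrite (surjective_pairing b). apply Hf; lra. }
    destruct (Hl 1 ltac:(lra)) as [dl [Hdl0 Hdl]].
    apply (rect_int_exceptional g b _ _ _ _ (Cmod l + 1) dl); try lra.
    - intros x y Hx Hy Hne. destruct (Hf x y Hx Hy) as [l' Hl']. eexists.
      apply is_derive_C_mult; [apply is_derive_C_minus; [exact Hl'|apply is_derive_C_const]|].
      apply (is_derive_C_inv (fun z => z - b)%C); [now apply Cminus_neq_0|].
      apply is_derive_C_minus; [apply is_derive_C_id|apply is_derive_C_const].
    - intros z Hz Hzd. specialize (Hdl z Hzd). unfold g.
      assert (Hz0 : (z - b)%C <> 0%C) by now apply Cminus_neq_0.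
      replace ((f z - f b) * / (z - b))%C with (l + (f z - f b - l * (z - b)) / (z - b))%C by (field; auto).
      eapply Rle_trans; [apply Cmod_triangle|]. apply Rplus_le_compat_l.
      rewrite Cmod_div by auto. pose proof (proj1 (Cmod_gt_0 _) Hz0).
      apply Rmult_le_reg_r with (Cmod (z - b)); auto.
      replace (Cmod (f z - f b - l * (z - b)) / Cmod (z - b) * Cmod (z - b))
        with (Cmod (f z - f b - l * (z - b))) by (field; lra). exact Hdl. }
  assert (I : forall h : C -> C, (forall z, Rabs (fst z) <= rho -> Rabs (snd z) <= rho -> z <> b -> ex_derive h z) ->
    ex_horiz h (- rho) rho (- rho) /\ ex_horiz h (- rho) rho rho /\ ex_vert h (- rho) rho (- rho) /\ ex_vert h (- rho) rho rho).
  { intros h Hh. repeat split; (apply exCI_cont; [lra|]); intros t Ht;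
     first [apply ccont_horiz|apply ccont_vert]; (apply Hh; simpl; [apply Rabs_le; lra|apply Rabs_le; lra|]);
     intros <-; simpl in *; lra. }
  assert (D0 : forall z, z <> b -> ex_derive (fun z => / (z - b))%C z).
  { intros z Hz. eexists. apply (is_derive_C_inv (fun z => z - b)%C); [now apply Cminus_neq_0|].
    apply is_derive_C_minus; [apply is_derive_C_id|apply is_derive_C_const]. }
  assert (D1 : forall z, Rabs (fst z) <= rho -> Rabs (snd z) <= rho -> z <> b -> ex_derive (fun z => f z * / (z - b))%C z).
  { intros z Hz1 Hz2 Hz. destruct (D0 z Hz) as [l1 H1].
    destruct (Hf (fst z) (snd z)) as [l2 H2].
    { now apply Rabs_le_between. }
    { now apply Rabs_le_between. }
    rewrite <- surjective_pairing in H2. eexists. exact (is_derive_C_mult f (fun z => / (z - b))%C z _ _ H2 H1). }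
  assert (D2 : forall z, Rabs (fst z) <= rho -> Rabs (snd z) <= rho -> z <> b -> ex_derive (fun z => f b * / (z - b))%C z).
  { intros z Hz1 Hz2 Hz. destruct (D0 z Hz) as [l1 H1]. eexists. apply is_derive_C_mult; [apply is_derive_C_const|exact H1]. }
  assert (E : rect_int g (- rho) rho (- rho) rho =
    (rect_int (fun z => f z * / (z - b)) (- rho) rho (- rho) rho -
     rect_int (fun z => f b * / (z - b)) (- rho) rho (- rho) rho)%C).
  { destruct (I _ D1) as (? & ? & ? & ?). destruct (I _ D2) as (? & ? & ? & ?).
    rewrite <- rect_int_minus by assumption.
    apply rect_int_ext; [lra|lra|]. intros z. unfold g. ring. }
  rewrite Hg in E.
  assert (E2 : rect_int (fun z => f b * / (z - b))%C (- rho) rho (- rho) rho =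
     (f b * rect_int (fun z => / (z - b))%C (- rho) rho (- rho) rho)%C).
  { destruct (I _ (fun z _ _ Hz => D0 z Hz)) as (? & ? & ? & ?).
    unfold rect_int. rewrite !CI_scal by assumption. ring. }
  rewrite <- E2.
  replace (rect_int (fun z => f z * / (z - b)) (- rho) rho (- rho) rho)%C with
   ((rect_int (fun z => f z * / (z - b)) (- rho) rho (- rho) rho -
     rect_int (fun z => f b * / (z - b)) (- rho) rho (- rho) rho) +
     rect_int (fun z => f b * / (z - b)) (- rho) rho (- rho) rho)%C by ring.
  rewrite <- E. ring.
Qed.

(** Near 0, [f] is the quotient [F / W] of the Cauchy integral by the winding integral, and both can
    be differentiated twice in the parameter [b] under the integral sign. *)
Lemma ex_derive_C_derive_0 (f : C -> C) (r : R) : 0 < r ->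
  (forall z, Cmod z < r -> ex_derive f z) -> ex_derive (C_derive f) (RtoC 0).
Proof.
  (* Points of the square with half side [r / 3] have modulus at most [2 * r / 3], so the square
     lies in the disc. *)
  intros Hr Hf. set (rho := r / 3). assert (Hrho : 0 < rho) by (unfold rho; lra).
  assert (Hsq : forall x y, - rho <= x <= rho -> - rho <= y <= rho -> ex_derive f (x, y)).
  { intros x y Hx Hy. apply Hf. eapply Rle_lt_trans; [apply Cmod_pair_le|].
    assert (Rabs x <= rho) by (apply Rabs_le; lra). assert (Rabs y <= rho) by (apply Rabs_le; lra).
    unfold rho in *; lra. }
  set (K := fun (phi k : C -> C) (b : C) => rect_int (fun z => phi z * k (z - b)%C)%C (- rho) rho (- rho) rho).
  assert (DK : forall (phi k k1 : C -> C) (b : C), kernel_deriv k k1 ->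
     (forall x y, - rho <= x <= rho -> - rho <= y <= rho -> ex_derive phi (x, y)) -> Cmod b < rho ->
     is_derive (K phi k) b (K phi k1 b)).
  { intros phi k k1 b Hk Hphi Hb. apply (rect_int_kernel_derive phi k k1 _ _ _ _ (rho - Cmod b)); auto; try lra.
    intros x y Hx Hy Hbd. split; [auto|].
    pose proof (Cmod_triangle ((x, y) - b) b) as T. replace ((x, y) - b + b)%C with ((x, y) : C) in T by (apply injective_projections; simpl; ring).
    pose proof (Rmax_Cmod (x, y)) as M. simpl in M.
    assert (rho <= Rmax (Rabs x) (Rabs y)); [|lra].
    destruct Hbd as [->|[->|[->| ->]]].
    - eapply Rle_trans; [|apply Rmax_l]. rewrite Rabs_Ropp. apply Rle_abs.
    - eapply Rle_trans; [|apply Rmax_l]. apply Rle_abs.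
    - eapply Rle_trans; [|apply Rmax_r]. rewrite Rabs_Ropp. apply Rle_abs.
    - eapply Rle_trans; [|apply Rmax_r]. apply Rle_abs. }
  set (one := fun _ : C => RtoC 1).
  assert (Hone : forall x y, - rho <= x <= rho -> - rho <= y <= rho -> ex_derive one (x, y))
    by (intros; eexists; apply is_derive_C_const).
  set (W := K one (fun p => / p)%C). set (W2 := K one (fun p => / (p * p))%C).
  set (F := K f (fun p => / p)%C). set (F2 := K f (fun p => / (p * p))%C).
  assert (HW : forall b : C, W b = rect_int (fun z => / (z - b))%C (- rho) rho (- rho) rho).
  { intros b. unfold W, K. apply rect_int_ext; [lra|lra|]. intros z. unfold one. ring. }
  assert (HW0 : W 0%C <> 0%C).
  { rewrite HW. intros E. apply (winding_square_neq_0 rho Hrho). rewrite <- E.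
    apply rect_int_ext; [lra|lra|]. intros z. f_equal. ring. }
  assert (C0 : Cmod 0%C < rho) by (rewrite Cmod_0; lra).
  (* By continuity [W] stays nonzero on a smaller disc, where division by it is legitimate. *)
  destruct (ex_derive_C_cont W 0%C) with (eps := Cmod (W 0%C)) as [d [Hd0 Hd]].
  { eexists. apply DK; auto. exact kernel_deriv_inv. }
  { now apply Cmod_gt_0. }
  set (d' := Rmin d rho). assert (Hd' : 0 < d') by now apply Rmin_pos.
  assert (Hlt : forall b, Cmod b < d' -> Cmod b < rho /\ W b <> 0%C).
  { intros b Hb. split; [eapply Rlt_le_trans; [exact Hb|apply Rmin_r]|].
    intros E. assert (H : Cmod (b - 0) < d).
    { replace (b - 0)%C with b by ring. eapply Rlt_le_trans; [exact Hb|apply Rmin_l]. }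
    specialize (Hd b H). rewrite E in Hd. replace (0 - W 0)%C with (- W 0)%C in Hd by ring.
    rewrite Cmod_opp in Hd. lra. }
  assert (Hfe : forall b, Cmod b < d' -> (F b / W b)%C = f b).
  { intros b Hb. destruct (Hlt b Hb) as [H1 H2]. unfold F, K.
    rewrite <- (cauchy_formula_square f rho b Hrho Hsq H1), <- HW. field; auto. }
  assert (DW : forall b, Cmod b < d' -> is_derive W b (W2 b)).
  { intros b Hb. apply DK; auto; [exact kernel_deriv_inv|apply Hlt; auto]. }
  assert (DF : forall b, Cmod b < d' -> is_derive F b (F2 b)).
  { intros b Hb. apply DK; auto; [exact kernel_deriv_inv|apply Hlt; auto]. }
  assert (Hfd : forall b, Cmod b < d' -> C_derive f b = ((F2 b * W b - F b * W2 b) / (W b * W b))%C).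
  { intros b Hb. apply is_C_derive_unique. apply (is_derive_C_loc (fun b => F b / W b)%C f b _ (d' - Cmod b)); [lra| |].
    - intros y Hy. apply Hfe. pose proof (Cmod_triangle (y - b) b).
      replace (y - b + b)%C with y in H by ring. lra.
    - apply is_derive_C_div; auto. apply Hlt; auto. }
  assert (C0' : Cmod 0%C < d') by (rewrite Cmod_0; lra).
  eexists. apply (is_derive_C_loc (fun b => (F2 b * W b - F b * W2 b) / (W b * W b))%C _ 0%C _ d'); auto.
  - intros y Hy. symmetry. apply Hfd. now replace (y - 0)%C with y in Hy by ring.
  - apply is_derive_C_div.
    + now apply Cmult_neq_0.
    + apply is_derive_C_minus; apply is_derive_C_mult; auto; apply DK; auto; exact kernel_deriv_inv2.
    + apply is_derive_C_mult; auto.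
Qed.

Lemma ex_derive_C_derive (f : C -> C) (a : C) (r : R) : 0 < r ->
  (forall z, Cmod (z - a) < r -> ex_derive f z) -> ex_derive (C_derive f) a.
Proof.
  intros Hr Hf.
  set (g := fun z => f (a + z)%C).
  assert (Hg : forall z, Cmod z < r -> is_derive g z (C_derive f (a + z)%C)).
  { intros z Hz. eapply is_derive_C_eq.
    - apply (is_derive_C_comp f (fun z => a + z)%C); [apply is_derive_C_correct, Hf|apply is_derive_C_plus; [apply is_derive_C_const|apply is_derive_C_id]].
      now replace (a + z - a)%C with z by ring.
    - ring. }
  destruct (ex_derive_C_derive_0 g r Hr) as [l Hl]. { intros z Hz. eexists. now apply Hg. }
  exists l. eapply is_derive_C_eq.
  - apply (is_derive_C_loc (fun z => C_derive g (z - a)%C) _ a _ r Hr).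
    + intros y Hy. rewrite (is_C_derive_unique _ _ _ (Hg _ Hy)). f_equal. ring.
    + apply (is_derive_C_comp (C_derive g) (fun z => z - a)%C).
      * replace (a - a)%C with (RtoC 0) by ring. exact Hl.
      * apply is_derive_C_minus; [apply is_derive_C_id|apply is_derive_C_const].
  - change ((l * (1 - 0))%C = l). ring.
Qed.

(** * The exponential and the Wirtinger derivative *)

Lemma derivable_pt_lim_0_eps (f : R -> R) (l : R) : derivable_pt_lim f 0 l ->
  forall eps, 0 < eps -> exists d, 0 < d /\ forall h, Rabs h < d -> Rabs (f h - f 0 - l * h) <= eps * Rabs h.
Proof.
  intros H eps He. destruct (H eps He) as [d Hd]. exists d. split; [apply cond_pos|].
  intros h Hh. destruct (Req_dec h 0) as [->|H0].
  { rewrite Rmult_0_r, Rminus_diag, Rminus_0_r, Rabs_R0. lra. }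
  specialize (Hd h H0 Hh). rewrite Rplus_0_l in Hd.
  replace (f h - f 0 - l * h) with (((f h - f 0) / h - l) * h) by (field; auto).
  rewrite Rabs_mult. apply Rmult_le_compat_r; [apply Rabs_pos|lra].
Qed.

Lemma cexp_plus (x y : C) : cexp (x + y)%C = (cexp x * cexp y)%C.
Proof.
  unfold cexp. apply injective_projections; simpl; rewrite exp_plus; rewrite ?cos_plus, ?sin_plus; ring.
Qed.

Lemma cexp_neq_0 (w : C) : cexp w <> 0%C.
Proof.
  intros E. pose proof (cexp_plus w (- w)%C) as H. rewrite E in H.
  replace (w + - w)%C with (RtoC 0) in H by ring.
  apply (f_equal fst) in H. simpl in H. rewrite exp_0, cos_0 in H. lra.
Qed.

Lemma Cmod_cexp (w : C) : Cmod (cexp w) = exp (fst w).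
Proof.
  unfold cexp, Cmod; simpl. rewrite !Rmult_1_r.
  replace (_ + _) with (exp (fst w) * exp (fst w) * (Rsqr (sin (snd w)) + Rsqr (cos (snd w)))) by (unfold Rsqr; ring).
  rewrite sin2_cos2, Rmult_1_r. apply sqrt_square. left; apply exp_pos.
Qed.

Lemma cexp_near_0 (eps : R) : 0 < eps -> exists d, 0 < d /\ forall e, Cmod e < d ->
  Cmod (cexp e - 1 - e) <= eps * Cmod e.
Proof.
  intros He. set (k := Rmin 1 (eps / 8)).
  assert (Hk : 0 < k <= 1) by (unfold k; split; [apply Rmin_pos; lra|apply Rmin_l]).
  assert (Hk8 : k <= eps / 8) by apply Rmin_r.
  destruct (derivable_pt_lim_0_eps exp 1 derivable_pt_lim_exp_0 k ltac:(lra)) as [d1 [Hd1 H1]].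
  destruct (derivable_pt_lim_0_eps cos 0 derivable_pt_lim_cos_0 k ltac:(lra)) as [d2 [Hd2 H2]].
  destruct (derivable_pt_lim_0_eps sin 1 derivable_pt_lim_sin_0 k ltac:(lra)) as [d3 [Hd3 H3]].
  exists (Rmin (Rmin d1 d2) (Rmin d3 (k / 2))). split; [repeat apply Rmin_pos; lra|].
  intros [x y] Hm. pose proof (Rmax_Cmod (x, y)) as HM. simpl in HM.
  pose proof (Rmax_l (Rabs x) (Rabs y)) as Hx. pose proof (Rmax_r (Rabs x) (Rabs y)) as Hy.
  assert (Hb : Cmod (x, y) < d1 /\ Cmod (x, y) < d2 /\ Cmod (x, y) < d3 /\ Cmod (x, y) < k / 2).
  { revert Hm. unfold Rmin. repeat destruct (Rle_dec _ _); lra. }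
  set (m := Cmod (x, y)) in *.
  specialize (H1 x ltac:(lra)). specialize (H2 y ltac:(lra)). specialize (H3 y ltac:(lra)).
  rewrite exp_0 in H1. rewrite cos_0 in H2. rewrite sin_0 in H3.
  (* First order remainders of exp, cos and sin: each term of the error contains one of them or is a
     product of two small factors. *)
  set (u := exp x - 1 - 1 * x) in *. set (v := cos y - 1 - 0 * y) in *. set (s := sin y - 0 - 1 * y) in *.
  assert (E : (cexp (x, y) - 1 - (x, y))%C = (u * (1 + v) + (1 + x) * v, (1 + x + u) * s + (x + u) * y)).
  { unfold u, v, s, cexp. apply injective_projections; simpl; ring. }
  rewrite E. eapply Rle_trans; [apply Cmod_pair_le|].
  pose proof (Rabs_pos x) as Px. pose proof (Rabs_pos y) as Py.
  assert (Hkx : k * Rabs x <= k * m) by (apply Rmult_le_compat_l; lra).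
  assert (Hky : k * Rabs y <= k * m) by (apply Rmult_le_compat_l; lra).
  assert (Bu : Rabs u <= k * m) by lra. assert (Bv : Rabs v <= k * m) by lra. assert (Bs : Rabs s <= k * m) by lra.
  assert (Bx : Rabs x <= k / 2) by lra.
  assert (Hkm : k * m <= k / 2) by nra.
  assert (Hm0 : 0 <= m) by lra.
  assert (T1 : Rabs (u * (1 + v)) <= k * m * 2).
  { rewrite Rabs_mult. apply Rmult_le_compat; try apply Rabs_pos; auto.
    eapply Rle_trans; [apply Rabs_triang|]. rewrite Rabs_R1. lra. }
  assert (T2 : Rabs ((1 + x) * v) <= 2 * (k * m)).
  { rewrite Rabs_mult. apply Rmult_le_compat; try apply Rabs_pos; auto.
    eapply Rle_trans; [apply Rabs_triang|]. rewrite Rabs_R1. lra. }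
  assert (T3 : Rabs ((1 + x + u) * s) <= 2 * (k * m)).
  { rewrite Rabs_mult. apply Rmult_le_compat; try apply Rabs_pos; auto.
    eapply Rle_trans; [apply Rabs_triang|]. eapply Rle_trans; [apply Rplus_le_compat_r, Rabs_triang|].
    rewrite Rabs_R1. lra. }
  assert (T4 : Rabs ((x + u) * y) <= k * m).
  { rewrite Rabs_mult. apply Rmult_le_compat; try apply Rabs_pos; try lra.
    eapply Rle_trans; [apply Rabs_triang|]. lra. }
  pose proof (Rabs_triang (u * (1 + v)) ((1 + x) * v)).
  pose proof (Rabs_triang ((1 + x + u) * s) ((x + u) * y)).
  assert (0 <= k * m) by (apply Rmult_le_pos; lra).
  assert (k * m <= eps / 8 * m) by (apply Rmult_le_compat_r; lra). lra.
Qed.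

Lemma is_derive_cexp (w : C) : is_derive cexp w (cexp w).
Proof.
  apply is_derive_C_iff. intros eps He.
  pose proof (proj1 (Cmod_gt_0 _) (cexp_neq_0 w)) as Hw.
  destruct (cexp_near_0 (eps / Cmod (cexp w))) as [d [Hd0 Hd]]; [now apply Rdiv_lt_0_compat|].
  exists d. split; auto. intros y Hy. specialize (Hd _ Hy).
  replace (cexp y - cexp w - cexp w * (y - w))%C with (cexp w * (cexp (y - w) - 1 - (y - w)))%C.
  - rewrite Cmod_mult. replace (eps * Cmod (y - w)) with (Cmod (cexp w) * (eps / Cmod (cexp w) * Cmod (y - w))) by (field; lra).
    apply Rmult_le_compat_l; lra.
  - replace (cexp y) with (cexp w * cexp (y - w))%C by (rewrite <- cexp_plus; f_equal; ring). ring.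
Qed.

Lemma cexp_period (w : C) : cexp (w + two_pi_i)%C = cexp w.
Proof.
  rewrite cexp_plus. replace (cexp two_pi_i) with (RtoC 1); [ring|].
  unfold cexp, two_pi_i; simpl. rewrite exp_0, cos_2PI, sin_2PI. apply injective_projections; simpl; ring.
Qed.

(** Componentwise, to match the partial derivatives [dx] and [dy], which are taken of real and
    imaginary parts. *)
Definition rderiv (h : R -> C) (t : R) (l : C) : Prop :=
  is_derive (fun s => fst (h s)) t (fst l) /\ is_derive (fun s => snd (h s)) t (snd l).

Lemma rderiv_plus h k t a b : rderiv h t a -> rderiv k t b -> rderiv (fun s => h s + k s)%C t (a + b)%C.
Proof. intros [H1 H2] [K1 K2]. split; simpl; now apply (is_derive_plus (V := R_NormedModule)). Qed.

Lemma rderiv_mult h k t a b : rderiv h t a -> rderiv k t b ->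
  rderiv (fun s => h s * k s)%C t (a * k t + h t * b)%C.
Proof.
  intros [H1 H2] [K1 K2].
  assert (M : forall f g (x df dg : R), is_derive f x df -> is_derive g x dg ->
     is_derive (fun x => f x * g x) x (df * g x + f x * dg)).
  { intros f g x df dg Hf Hg. apply (is_derive_mult (K := R_AbsRing)); auto. exact Rmult_comm. }
  split; simpl.
  - eapply is_derive_ext_loc with (f := fun s => fst (h s) * fst (k s) - snd (h s) * snd (k s)).
    { now apply filter_forall. }
    replace (_ - _ + _) with ((fst a * fst (k t) + fst (h t) * fst b) - (snd a * snd (k t) + snd (h t) * snd b)) by ring.
    apply (is_derive_minus (V := R_NormedModule)); apply M; auto.
  - replace (_ + _ + _) with ((fst a * snd (k t) + fst (h t) * snd b) + (snd a * fst (k t) + snd (h t) * fst b)) by ring.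
    apply (is_derive_plus (V := R_NormedModule)); apply M; auto.
Qed.

Lemma rderiv_conj h t a : rderiv h t a -> rderiv (fun s => Cconj (h s)) t (Cconj a).
Proof. intros [H1 H2]. split; simpl; auto. now apply (is_derive_opp (V := R_NormedModule)). Qed.

Lemma rderiv_along_line (f : C -> C) (g : R -> C) (v l : C) (t : R) :
  (forall s, (g s - g t)%C = (v * RtoC (s - t))%C) -> is_derive f (g t) l ->
  rderiv (fun s => f (g s)) t (v * l)%C.
Proof.
  intros Hg Hf. destruct (is_derive_R_along_line f g v l t Hg Hf) as [_ H].
  specialize (H t (fun P HP => HP)).
  assert (N : forall z : C, Rabs (fst z) <= Cmod z /\ Rabs (snd z) <= Cmod z).
  { intros z. pose proof (Rmax_Cmod z). split; (eapply Rle_trans; [|exact H0]); [apply Rmax_l|apply Rmax_r]. }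
  split; (split; [apply @is_linear_scal_l|]); intros x Hx eps;
    (assert (Ex : x = t) by (symmetry; apply (is_filter_lim_locally_unique (V := R_NormedModule)); exact Hx));
    subst x; destruct (H eps) as [d Hd]; exists d; intros s Hs; specialize (Hd s Hs);
    change (@norm R_AbsRing C_R_NormedModule (f (g s) - f (g t) - scal (s - t)%R (v * l)%C)%C <= eps * Rabs (s - t)) in Hd;
    rewrite <- Cmod_norm in Hd;
    (eapply Rle_trans; [|exact Hd]).
  - eapply Rle_trans; [|apply (proj1 (N _))]. right. reflexivity.
  - eapply Rle_trans; [|apply (proj2 (N _))]. right. reflexivity.
Qed.

Lemma wirt_rderiv (F : C -> C) (w a b : C) :
  rderiv (fun s => F (s, snd w)) (fst w) a -> rderiv (fun s => F (fst w, s)) (snd w) b ->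
  wirt F w = ((a - Ci * b) / 2)%C.
Proof.
  intros [H1 H2] [H3 H4]. unfold wirt, dx, dy.
  rewrite (is_derive_unique (fun s : R => fst (F (s, snd w))) _ _ H1),
    (is_derive_unique (fun s : R => snd (F (s, snd w))) _ _ H2),
    (is_derive_unique (fun s : R => fst (F (fst w, s))) _ _ H3),
    (is_derive_unique (fun s : R => snd (F (fst w, s))) _ _ H4).
  now rewrite <- !surjective_pairing.
Qed.

(** The entries of [E E^*] have this shape. The conjugated factor contributes [Cconj g] to the
    x-derivative and [- Ci * Cconj g] to the y-derivative, and these cancel in the Wirtinger
    combination. *)
Lemma wirt_mult_conj (F1 G1 F2 G2 : C -> C) (w f1 g1 f2 g2 : C) :
  is_derive F1 w f1 -> is_derive G1 w g1 -> is_derive F2 w f2 -> is_derive G2 w g2 ->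
  wirt (fun x => F1 x * Cconj (G1 x) + F2 x * Cconj (G2 x))%C w = (f1 * Cconj (G1 w) + f2 * Cconj (G2 w))%C.
Proof.
  intros H1 H2 H3 H4. destruct w as [x y].
  assert (X : forall (F : C -> C) (f : C), is_derive F (x, y) f -> rderiv (fun s => F (s, y)) x f).
  { intros F f H. replace f with (1 * f)%C by apply Cmult_1_l.
    apply (rderiv_along_line F (fun s => (s, y))); auto. intros; apply injective_projections; simpl; ring. }
  assert (Y : forall (F : C -> C) (f : C), is_derive F (x, y) f -> rderiv (fun s => F (x, s)) y (Ci * f)%C).
  { intros F f H. apply (rderiv_along_line F (fun s => (x, s))); auto. intros; apply injective_projections; simpl; ring. }
  rewrite (wirt_rderiv _ _
    ((f1 * Cconj (G1 (x, y)) + F1 (x, y) * Cconj g1) + (f2 * Cconj (G2 (x, y)) + F2 (x, y) * Cconj g2))%C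
    ((Ci * f1 * Cconj (G1 (x, y)) + F1 (x, y) * Cconj (Ci * g1)) + (Ci * f2 * Cconj (G2 (x, y)) + F2 (x, y) * Cconj (Ci * g2)))%C).
  - rewrite !Cmult_conj. replace (Cconj Ci) with (- Ci)%C by (apply injective_projections; simpl; ring).
    replace (Ci * (Ci * f1 * Cconj (G1 (x, y)) + F1 (x, y) * (- Ci * Cconj g1) +
     (Ci * f2 * Cconj (G2 (x, y)) + F2 (x, y) * (- Ci * Cconj g2))))%C with
     ((Ci * Ci) * (f1 * Cconj (G1 (x, y)) - F1 (x, y) * Cconj g1 + (f2 * Cconj (G2 (x, y)) - F2 (x, y) * Cconj g2)))%C by ring.
    replace (Ci * Ci)%C with (- (1))%C by (apply injective_projections; simpl; ring).
    field.
  - simpl. apply rderiv_plus.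
    + apply (rderiv_mult (fun s => F1 (s, y)) (fun s => Cconj (G1 (s, y)))); [|apply (rderiv_conj (fun s => G1 (s, y)))]; auto.
    + apply (rderiv_mult (fun s => F2 (s, y)) (fun s => Cconj (G2 (s, y)))); [|apply (rderiv_conj (fun s => G2 (s, y)))]; auto.
  - simpl. apply rderiv_plus.
    + apply (rderiv_mult (fun s => F1 (x, s)) (fun s => Cconj (G1 (x, s)))); [|apply (rderiv_conj (fun s => G1 (x, s)))]; auto.
    + apply (rderiv_mult (fun s => F2 (x, s)) (fun s => Cconj (G2 (x, s)))); [|apply (rderiv_conj (fun s => G2 (x, s)))]; auto.
Qed.

(** * The flux as a period *)

Lemma mat2_ext (A B : mat2) : m11 A = m11 B -> m12 A = m12 B -> m21 A = m21 B -> m22 A = m22 B -> A = B.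
Proof. destruct A, B; simpl. now intros -> -> -> ->. Qed.

(** The adjugate, equal to the inverse at determinant 1. Being free of division, it keeps
    [log_deriv] polynomial in [E] and [E']. *)
Definition madj (A : mat2) : mat2 := Mat2 (m22 A) (- m12 A)%C (- m21 A)%C (m11 A).
Definition log_deriv (E : C -> mat2) (w : C) : mat2 := mmul (Ed E w) (madj (E w)).

Lemma mwirt_ffront (E : C -> mat2) (w : C) :
  ex_derive (fun x => m11 (E x)) w -> ex_derive (fun x => m12 (E x)) w ->
  ex_derive (fun x => m21 (E x)) w -> ex_derive (fun x => m22 (E x)) w ->
  mwirt (ffront E) w = mmul (Ed E w) (mstar (E w)).
Proof.
  intros H1 H2 H3 H4. apply is_derive_C_correct in H1. apply is_derive_C_correct in H2. apply is_derive_C_correct in H3. apply is_derive_C_correct in H4.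
  unfold mwirt, ffront, mmul, mstar, Ed; simpl.
  rewrite (wirt_mult_conj _ _ _ _ _ _ _ _ _ H1 H1 H2 H2).
  rewrite (wirt_mult_conj _ _ _ _ _ _ _ _ _ H1 H3 H2 H4).
  rewrite (wirt_mult_conj _ _ _ _ _ _ _ _ _ H3 H1 H4 H2).
  rewrite (wirt_mult_conj _ _ _ _ _ _ _ _ _ H3 H3 H4 H4).
  reflexivity.
Qed.

(** The inverse of [X X^*] begins with the inverse of [X^*], so the antiholomorphic factor
    cancels. *)
Lemma mmul_star_inv (D X : mat2) : mdet X = 1%C ->
  mmul (mmul D (mstar X)) (minv (mmul X (mstar X))) = mmul D (madj X).
Proof.
  intros Hd.
  assert (Hc : mdet (mstar X) = 1%C).
  { replace (mdet (mstar X)) with (Cconj (mdet X)).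
    - rewrite Hd. apply injective_projections; simpl; ring.
    - destruct X. unfold mdet, mstar; simpl. apply injective_projections; simpl; ring. }
  assert (Hm : mdet (mmul X (mstar X)) = 1%C).
  { replace (mdet (mmul X (mstar X))) with (mdet X * mdet (mstar X))%C; [rewrite Hd, Hc; ring|].
    destruct X. unfold mdet, mmul, mstar; simpl. ring. }
  unfold minv. rewrite Hm.
  destruct D as [d1 d2 d3 d4]. destruct X as [a b c d].
  unfold mdet, mstar in *; unfold mmul, mscale, madj; simpl in *.
  set (A := Cconj a) in *. set (B := Cconj b) in *. set (C' := Cconj c) in *. set (D := Cconj d) in *.
  replace (/ 1)%C with (RtoC 1) by (field).
  f_equal.
  - replace (d1 * d + d2 * - c)%C with ((A * D - C' * B) * (d1 * d + d2 * - c))%C by (rewrite Hc; ring). ring.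
  - replace (d1 * - b + d2 * a)%C with ((A * D - C' * B) * (d1 * - b + d2 * a))%C by (rewrite Hc; ring). ring.
  - replace (d3 * d + d4 * - c)%C with ((A * D - C' * B) * (d3 * d + d4 * - c))%C by (rewrite Hc; ring). ring.
  - replace (d3 * - b + d4 * a)%C with ((A * D - C' * B) * (d3 * - b + d4 * a))%C by (rewrite Hc; ring). ring.
Qed.

Lemma Derive_shift (f g : R -> R) (T x : R) : (forall t, f (t + T) = g t) -> Derive f (x + T) = Derive g x.
Proof.
  intros H. unfold Derive. f_equal. apply Lim_ext. intros h.
  rewrite <- !H. f_equal. f_equal. f_equal. ring.
Qed.

(** Periodicity is known only on [Omega]: the horizontal derivative uses it on a neighbourhood of
    radius [- x], whereas the vertical line through a point of [Omega] stays in [Omega]. *)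
Lemma wirt_periodic (F : C -> C) (w : C) : (forall w, Omega w -> F (w + two_pi_i)%C = F w) -> Omega w ->
  wirt F (w + two_pi_i)%C = wirt F w.
Proof.
  intros HF Hw. destruct w as [x y]. unfold Omega in Hw; simpl in Hw.
  assert (S : forall a b : R, a < 0 -> F (a, b + 2 * PI) = F (a, b)).
  { intros a b Ha. rewrite <- (HF (a, b)); [|exact Ha]. f_equal.
    apply injective_projections; simpl; ring. }
  replace ((x, y) + two_pi_i)%C with ((x, y + 2 * PI) : C) by (apply injective_projections; simpl; ring).
  unfold wirt. apply (f_equal (fun z => z / 2)%C).
  apply f_equal2; [|apply (f_equal (fun z => Ci * z)%C)].
  - unfold dx; simpl. apply f_equal2; apply Derive_ext_loc;
    (exists (mkposreal (- x) ltac:(lra)); intros a Ha; change (Rabs (a - x) < - x) in Ha; apply Rabs_def2 in Ha;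
     rewrite S; auto; lra).
  - unfold dy; simpl. apply f_equal2; apply Derive_shift; intros t; now rewrite S.
Qed.

Lemma log_deriv_wirt (E : C -> mat2) (w : C) : flat_front_end E -> Omega w ->
  mmul (mwirt (ffront E) w) (minv (ffront E w)) = log_deriv E w.
Proof.
  intros (Hh & Hd & _) Hw. destruct (Hh w Hw) as (H1 & H2 & H3 & H4).
  rewrite mwirt_ffront by assumption. apply mmul_star_inv; auto.
Qed.

Lemma Omega_shift (w : C) : Omega w -> Omega (w + two_pi_i)%C.
Proof. unfold Omega, two_pi_i. simpl. lra. Qed.

(** [E] itself may have monodromy; the form inherits its period from [f] through
    [log_deriv_wirt]. *)
Lemma log_deriv_periodic (E : C -> mat2) (w : C) : flat_front_end E -> Omega w ->
  log_deriv E (w + two_pi_i)%C = log_deriv E w.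
Proof.
  intros HE Hw. rewrite <- !log_deriv_wirt by auto using Omega_shift.
  destruct HE as (_ & _ & _ & _ & Hp). rewrite Hp by auto. f_equal.
  unfold mwirt.
  f_equal; apply (wirt_periodic (fun x => _ (ffront E x))); auto; intros x Hx; now rewrite Hp.
Qed.

(** Here Cauchy's formula enters the flux: [log_deriv] contains [E'], and Goursat's theorem applies
    to it only if [E'] is differentiable. *)
Lemma ex_derive_Omega (f : C -> C) (w : C) : (forall w, Omega w -> ex_derive f w) -> Omega w ->
  ex_derive (C_derive f) w.
Proof.
  intros Hf Hw. unfold Omega in *. apply ex_derive_C_derive with (- fst w); [lra|].
  intros z Hz. apply Hf. pose proof (Rmax_Cmod (z - w)%C) as H. simpl in H.
  pose proof (Rmax_l (Rabs (fst z + - fst w)) (Rabs (snd z + - snd w))).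
  pose proof (Rle_abs (fst z + - fst w)). lra.
Qed.

Lemma ex_derive_C_const (c z : C) : ex_derive (fun _ : C => c) z.
Proof. eexists; apply is_derive_C_const. Qed.
Lemma ex_derive_C_plus (f g : C -> C) (z : C) : ex_derive f z -> ex_derive g z -> ex_derive (fun x => f x + g x)%C z.
Proof. intros [a Ha] [b Hb]. eexists; exact (is_derive_C_plus f g z a b Ha Hb). Qed.
Lemma ex_derive_C_minus (f g : C -> C) (z : C) : ex_derive f z -> ex_derive g z -> ex_derive (fun x => f x - g x)%C z.
Proof. intros [a Ha] [b Hb]. eexists; exact (is_derive_C_minus f g z a b Ha Hb). Qed.
Lemma ex_derive_C_mult (f g : C -> C) (z : C) : ex_derive f z -> ex_derive g z -> ex_derive (fun x => f x * g x)%C z.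
Proof. intros [a Ha] [b Hb]. eexists; exact (is_derive_C_mult f g z a b Ha Hb). Qed.
Lemma ex_derive_C_opp (f : C -> C) (z : C) : ex_derive f z -> ex_derive (fun x => - f x)%C z.
Proof. intros [a Ha]. eexists. exact (is_derive_opp (V := C_NormedModule) f z a Ha). Qed.

Lemma ex_derive_C_log_deriv (E : C -> mat2) (w : C) : flat_front_end E -> Omega w ->
  ex_derive (fun x => m11 (log_deriv E x)) w /\ ex_derive (fun x => m12 (log_deriv E x)) w /\
  ex_derive (fun x => m21 (log_deriv E x)) w /\ ex_derive (fun x => m22 (log_deriv E x)) w.
Proof.
  intros (Hh & _) Hw. destruct (Hh w Hw) as (H1 & H2 & H3 & H4).
  assert (D1 := ex_derive_Omega _ w (fun x Hx => proj1 (Hh x Hx)) Hw).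
  assert (D2 := ex_derive_Omega _ w (fun x Hx => proj1 (proj2 (Hh x Hx))) Hw).
  assert (D3 := ex_derive_Omega _ w (fun x Hx => proj1 (proj2 (proj2 (Hh x Hx)))) Hw).
  assert (D4 := ex_derive_Omega _ w (fun x Hx => proj2 (proj2 (proj2 (Hh x Hx)))) Hw).
  unfold log_deriv, mmul, Ed, madj; simpl.
  repeat split; apply ex_derive_C_plus; apply ex_derive_C_mult; auto; now apply ex_derive_C_opp.
Qed.

(** The segment is the loop around the puncture in the coordinate [w]; the factor [Ci] of
    [dw = Ci dt] is left out. *)
Definition vint (p : C -> C) (x : R) : C := CI (fun t => p (x, t)) 0 (2 * PI).

Lemma exCI_vert (p : C -> C) (x a b : R) : a <= b -> (forall t, a <= t <= b -> ex_derive p (x, t)) ->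
  exCI (fun t => p (x, t)) a b.
Proof. intros Hab H. apply exCI_cont; auto. intros; apply ccont_vert; auto. Qed.

(** Goursat's theorem on the rectangle between the two segments, whose horizontal sides cancel by
    periodicity. *)
Lemma vint_const_le (p : C -> C) (x1 x2 : R) :
  (forall w, Omega w -> ex_derive p w) -> (forall w, Omega w -> p (w + two_pi_i)%C = p w) ->
  x1 <= x2 < 0 -> vint p x1 = vint p x2.
Proof.
  intros Hp Hper Hx. pose proof PI_RGT_0 as HPI.
  assert (G : rect_int p x1 x2 0 (2 * PI) = 0%C).
  { apply goursat; try lra. intros x y Hx' _. apply Hp. unfold Omega; simpl; lra. }
  unfold rect_int in G.
  assert (Eh : CI (fun x => p (x, 2 * PI)) x1 x2 = CI (fun x => p (x, 0)) x1 x2).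
  { apply CI_ext; [lra|]. intros t Ht. rewrite <- (Hper (t, 0)); [|unfold Omega; simpl; lra].
    f_equal. apply injective_projections; simpl; ring. }
  rewrite Eh in G. unfold vint.
  set (u := CI (fun x => p (x, 0)) x1 x2) in *.
  set (A := CI (fun t => p (x1, t)) 0 (2 * PI)) in *. set (B := CI (fun t => p (x2, t)) 0 (2 * PI)) in *.
  (* Since [Ci * Ci + 1 = 0], this identity solves [Ci * (B - A) = 0] for [A] without dividing by
     [Ci]. *)
  replace A with (Ci * (u + Ci * B - u - Ci * A) + B + (Ci * Ci + 1) * (A - B))%C by ring.
  rewrite G. replace (Ci * Ci + 1)%C with (RtoC 0) by (apply injective_projections; simpl; ring). ring.
Qed.

Lemma vint_const (p : C -> C) (x1 x2 : R) :
  (forall w, Omega w -> ex_derive p w) -> (forall w, Omega w -> p (w + two_pi_i)%C = p w) ->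
  x1 < 0 -> x2 < 0 -> vint p x1 = vint p x2.
Proof.
  intros. destruct (Rle_dec x1 x2); [|symmetry]; apply vint_const_le; auto; lra.
Qed.

(* The filter of the end [z = exp w -> 0] in the coordinate [w]. *)
Definition near_end (P : C -> Prop) : Prop := exists a : R, a < 0 /\ forall w : C, fst w < a -> P w.

Definition tends (F : C -> C) (l : C) : Prop :=
  forall eps : R, 0 < eps -> near_end (fun w => Cmod (F w - l)%C < eps).

(** Takes the place of the residue theorem. The integral can be moved arbitrarily far towards the
    end, [L'] integrates to zero because [L] is periodic, and what remains is uniformly close to
    [l]. *)
Lemma vint_limit (p L L' : C -> C) (a x : R) (l : C) :
  (forall w, Omega w -> ex_derive p w) -> (forall w, Omega w -> p (w + two_pi_i)%C = p w) ->
  a < 0 -> (forall w, fst w < a -> is_derive L w (L' w)) -> (forall w, fst w < a -> ex_derive L' w) ->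
  (forall w, fst w < a -> L (w + two_pi_i)%C = L w) ->
  tends (fun w => p w - L' w)%C l -> x < 0 -> vint p x = (RtoC (2 * PI) * l)%C.
Proof.
  intros Hp Hper Ha HL HL' HLp Ht Hx. pose proof PI_RGT_0 as HPI.
  assert (K : forall eps, 0 < eps -> Cmod (vint p x - RtoC (2 * PI) * l) <= 2 * PI * eps).
  { intros eps He. destruct (Ht eps He) as [a' [Ha' H]].
    set (y := Rmin a a' - 1). assert (Hy : y < a /\ y < a').
    { unfold y. pose proof (Rmin_l a a'). pose proof (Rmin_r a a'). lra. }
    rewrite (vint_const p x y) by (auto; lra). unfold vint.
    assert (X1 : exCI (fun t => p (y, t)) 0 (2 * PI)) by (apply exCI_vert; [lra|]; intros; apply Hp; unfold Omega; simpl; lra).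
    assert (X2 : exCI (fun t => L' (y, t)) 0 (2 * PI)) by (apply exCI_vert; [lra|]; intros; apply HL'; simpl; lra).
    assert (Z : CI (fun t => L' (y, t)) 0 (2 * PI) = 0%C).
    { assert (E : (Ci * CI (fun t => L' (y, t)) 0 (2 * PI))%C = 0%C).
      { rewrite (CI_derive_along_line L L' (fun t => (y, t)) Ci 0 (2 * PI)); try lra.
        - replace ((y, 2 * PI) : C) with ((y, 0) + two_pi_i)%C by (apply injective_projections; simpl; ring).
          rewrite HLp by (simpl; lra). ring.
        - intros; apply injective_projections; simpl; ring.
        - intros; apply HL; simpl; lra.
        - intros; apply HL'; simpl; lra. }
      destruct (Ceq_dec (CI (fun t => L' (y, t)) 0 (2 * PI)) 0%C) as [|N]; auto.
      exfalso. apply (Cmult_neq_0 Ci _) in N; auto. apply C_neq_of_snd. simpl. lra. }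
    replace (CI (fun t => p (y, t)) 0 (2 * PI) - RtoC (2 * PI) * l)%C
     with (CI (fun t => p (y, t) - L' (y, t) - l) 0 (2 * PI))%C.
    - replace (2 * PI * eps) with ((2 * PI - 0) * eps) by ring.
      apply CI_bound; [lra| |].
      + apply exCI_minus; [now apply exCI_minus|apply exCI_const].
      + intros t _. left. apply H. simpl. lra.
    - rewrite CI_minus; [|now apply exCI_minus|apply exCI_const]. rewrite CI_minus by auto.
      rewrite Z, CI_const. rewrite Rminus_0_r. ring. }
  assert (M : Cmod (vint p x - RtoC (2 * PI) * l) = 0).
  { destruct (Req_dec (Cmod (vint p x - RtoC (2 * PI) * l)) 0) as [|N]; auto. exfalso.
    set (m := Cmod (vint p x - RtoC (2 * PI) * l)) in *.
    assert (Hm : 0 < m) by (pose proof (Cmod_ge_0 (vint p x - RtoC (2 * PI) * l)); fold m in H; lra).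
    specialize (K (m / (4 * PI)) ltac:(apply Rdiv_lt_0_compat; lra)).
    replace (2 * PI * (m / (4 * PI))) with (m / 2) in K by (field; lra). lra. }
  apply Cmod_eq_0 in M.
  replace (vint p x) with (vint p x - RtoC (2 * PI) * l + RtoC (2 * PI) * l)%C by ring. rewrite M. ring.
Qed.

Definition mvint (P : C -> mat2) (x : R) : mat2 :=
  Mat2 (vint (fun w => m11 (P w)) x) (vint (fun w => m12 (P w)) x)
       (vint (fun w => m21 (P w)) x) (vint (fun w => m22 (P w)) x).

(** One factor [Ci] stands in front of the integral and another comes from [dw = Ci dt]; their
    product produces the sign. *)
Lemma flux_eq (E : C -> mat2) (x : R) : flat_front_end E -> x < 0 ->
  flux E x = mscale (- / RtoC (2 * PI))%C (mvint (log_deriv E) x).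
Proof.
  intros HE Hx. pose proof PI_RGT_0 as HPI.
  assert (EX : forall t, Omega (x, t)) by (intros; exact Hx).
  assert (N : RtoC (2 * PI) <> 0%C) by (apply C_neq_of_fst; simpl; lra).
  assert (K : forall (m : mat2 -> C), (forall c A, m (mscale c A) = (c * m A)%C) ->
    (forall w, Omega w -> ex_derive (fun x => m (log_deriv E x)) w) ->
    (Ci / RtoC (2 * PI) * cRInt (fun t => m (mscale Ci (mmul (mwirt (ffront E) (x, t)) (minv (ffront E (x, t)))))) 0 (2 * PI)
    = - / RtoC (2 * PI) * vint (fun w => m (log_deriv E w)) x)%C).
  { intros m Hm Hd.
    assert (X : exCI (fun t => m (log_deriv E (x, t))) 0 (2 * PI)).
    { apply (exCI_vert (fun w => m (log_deriv E w))); [lra|]. intros; apply Hd, EX. }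
    rewrite CI_cRInt.
    - rewrite (CI_ext _ (fun t => Ci * m (log_deriv E (x, t)))%C); [|lra|].
      + rewrite CI_scal by auto. unfold vint.
        replace (- / RtoC (2 * PI))%C with ((Ci * Ci) / RtoC (2 * PI))%C; [unfold Cdiv; ring|].
        replace (Ci * Ci)%C with (- (1))%C by (apply injective_projections; simpl; ring). field; auto.
      + intros t _. now rewrite Hm, log_deriv_wirt by auto.
    - apply exCI_ext with (fun t => Ci * m (log_deriv E (x, t)))%C; [lra| |now apply exCI_scal].
      intros t _. now rewrite Hm, log_deriv_wirt by auto. }
  apply mat2_ext.
  - apply (K m11); [reflexivity|]. exact (fun w Hw => proj1 (ex_derive_C_log_deriv E w HE Hw)).
  - apply (K m12); [reflexivity|]. exact (fun w Hw => proj1 (proj2 (ex_derive_C_log_deriv E w HE Hw))).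
  - apply (K m21); [reflexivity|]. exact (fun w Hw => proj1 (proj2 (proj2 (ex_derive_C_log_deriv E w HE Hw)))).
  - apply (K m22); [reflexivity|]. exact (fun w Hw => proj2 (proj2 (proj2 (ex_derive_C_log_deriv E w HE Hw)))).
Qed.

(** * Germs at the end *)

Lemma near_end_and P Q : near_end P -> near_end Q -> near_end (fun w => P w /\ Q w).
Proof.
  intros [a [Ha HP]] [b [Hb HQ]]. exists (Rmin a b). split; [unfold Rmin; destruct (Rle_dec a b); lra|].
  intros w Hw. pose proof (Rmin_l a b). pose proof (Rmin_r a b). split; [apply HP|apply HQ]; lra.
Qed.
Lemma near_end_imp (P Q : C -> Prop) : (forall w, P w -> Q w) -> near_end P -> near_end Q.
Proof. intros H [a [Ha HP]]. exists a; auto. Qed.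
Lemma near_end_all (P : C -> Prop) : (forall w, P w) -> near_end P.
Proof. intros H. exists (-1). split; [lra|auto]. Qed.
Lemma near_end_ex (P : C -> Prop) : near_end P -> exists w, P w.
Proof. intros [a [Ha HP]]. exists (a - 1, 0). apply HP. simpl; lra. Qed.
Lemma near_end_Omega : near_end Omega.
Proof. exists (-1). split; [lra|]. unfold Omega. intros; lra. Qed.

Lemma tends_const (c : C) : tends (fun _ => c) c.
Proof. intros eps He. apply near_end_all. intros _. replace (c - c)%C with (RtoC 0) by ring. now rewrite Cmod_0. Qed.

Lemma tends_ext F G l : near_end (fun w => F w = G w) -> tends F l -> tends G l.
Proof.
  intros H HF eps He. generalize (near_end_and _ _ H (HF eps He)).
  apply near_end_imp. now intros w [<- K].
Qed.

Lemma tends_plus F G a b : tends F a -> tends G b -> tends (fun w => F w + G w)%C (a + b)%C.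
Proof.
  intros HF HG eps He. generalize (near_end_and _ _ (HF (eps / 2) ltac:(lra)) (HG (eps / 2) ltac:(lra))).
  apply near_end_imp. intros w [K1 K2]. replace (F w + G w - (a + b))%C with ((F w - a) + (G w - b))%C by ring.
  eapply Rle_lt_trans; [apply Cmod_triangle|]. lra.
Qed.

Lemma tends_mult F G a b : tends F a -> tends G b -> tends (fun w => F w * G w)%C (a * b)%C.
Proof.
  intros HF HG eps He. pose proof (Cmod_ge_0 a) as Pa. pose proof (Cmod_ge_0 b) as Pb.
  set (K := Cmod a + Cmod b + 1). set (e := Rmin 1 (eps / K)).
  assert (He' : 0 < e) by (apply Rmin_pos; [lra|apply Rdiv_lt_0_compat; unfold K; lra]).
  generalize (near_end_and _ _ (HF e He') (HG e He')).
  apply near_end_imp. intros w [K1 K2].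
  replace (F w * G w - a * b)%C with ((F w - a) * (G w - b) + (F w - a) * b + a * (G w - b))%C by ring.
  eapply Rle_lt_trans; [apply Cmod_triangle|]. eapply Rle_lt_trans; [apply Rplus_le_compat_r, Cmod_triangle|].
  rewrite !Cmod_mult. pose proof (Cmod_ge_0 (F w - a)). pose proof (Cmod_ge_0 (G w - b)).
  assert (E1 : e <= 1) by apply Rmin_l.
  assert (E2 : e * K <= eps).
  { replace eps with (eps / K * K) by (field; unfold K; lra). apply Rmult_le_compat_r; [unfold K; lra|apply Rmin_r]. }
  unfold K in E2.
  assert (T1 : Cmod (F w - a) * Cmod (G w - b) < e * 1) by (apply Rmult_le_0_lt_compat; lra).
  assert (T2 : Cmod (F w - a) * Cmod b <= e * Cmod b) by (apply Rmult_le_compat_r; lra).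
  assert (T3 : Cmod a * Cmod (G w - b) <= Cmod a * e) by (apply Rmult_le_compat_l; lra).
  lra.
Qed.

Lemma tends_opp F a : tends F a -> tends (fun w => - F w)%C (- a)%C.
Proof.
  intros H eps He. generalize (H eps He). apply near_end_imp. intros w K.
  replace (- F w - - a)%C with (- (F w - a))%C by ring. now rewrite Cmod_opp.
Qed.
Lemma tends_minus F G a b : tends F a -> tends G b -> tends (fun w => F w - G w)%C (a - b)%C.
Proof. intros HF HG. apply tends_plus; auto. now apply tends_opp. Qed.

Lemma tends_eq F (a b : C) : tends F a -> a = b -> tends F b.
Proof. now intros H <-. Qed.

Lemma tends_neq F (l c : C) : tends F l -> l <> c -> near_end (fun w => F w <> c).
Proof.
  intros HF Hl. assert (P : 0 < Cmod (c - l)) by (apply Cmod_gt_0, Cminus_neq_0; auto).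
  generalize (HF _ P). apply near_end_imp. intros w K E. rewrite E in K. lra.
Qed.

Lemma tends_unique F (a b : C) : tends F a -> tends F b -> a = b.
Proof.
  intros HF HG. destruct (Ceq_dec a b) as [|N]; auto. exfalso.
  assert (P : 0 < Cmod (a - b)) by (apply Cmod_gt_0, Cminus_neq_0; auto).
  destruct (near_end_ex _ (near_end_and _ _ (HF (Cmod (a - b) / 2) ltac:(lra)) (HG (Cmod (a - b) / 2) ltac:(lra)))) as [w [K1 K2]].
  pose proof (Cmod_triangle (a - F w) (F w - b)) as T. replace (a - F w + (F w - b))%C with (a - b)%C in T by ring.
  rewrite (Cmod_minus_sym a (F w)) in T. lra.
Qed.

Lemma tends_comp (f : C -> C) F l : tends F l -> ex_derive f l -> tends (fun w => f (F w)) (f l).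
Proof.
  intros HF Hf eps He. destruct (ex_derive_C_cont f l Hf eps He) as [d [Hd0 Hd]].
  generalize (HF d Hd0). apply near_end_imp. intros w K. auto.
Qed.

Lemma tends_inv F (l : C) : l <> 0%C -> tends F l -> tends (fun w => / F w)%C (/ l)%C.
Proof. intros Hl HF. apply (tends_comp Cinv); auto. exact (ex_intro _ _ (is_derive_C_inv_id l Hl)). Qed.
Lemma tends_div F G (a b : C) : b <> 0%C -> tends F a -> tends G b -> tends (fun w => F w / G w)%C (a / b)%C.
Proof. intros Hb HF HG. apply tends_mult; auto. now apply tends_inv. Qed.

Lemma near_end_cexp (r : R) : 0 < r -> near_end (fun w => 0 < Cmod (cexp w) < r).
Proof.
  intros Hr. exists (Rmin (ln r) 0 - 1). pose proof (Rmin_l (ln r) 0). pose proof (Rmin_r (ln r) 0).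
  split; [lra|]. intros w Hw. rewrite Cmod_cexp. split; [apply exp_pos|].
  rewrite <- (exp_ln r) by auto. apply exp_increasing. lra.
Qed.
Lemma tends_cexp : tends cexp 0%C.
Proof.
  intros eps He. generalize (near_end_cexp eps He). apply near_end_imp. intros w [_ K].
  now replace (cexp w - 0)%C with (cexp w) by ring.
Qed.
Lemma tends_at0 (f : C -> C) : ex_derive f (RtoC 0) -> tends (fun w => f (cexp w)) (f 0%C).
Proof. apply (tends_comp f cexp). exact tends_cexp. Qed.

Lemma cpow_neq_0 (z : C) (k : nat) : z <> 0%C -> cpow z k <> 0%C.
Proof. intros Hz. induction k; simpl; [apply C_neq_of_fst; simpl; lra|now apply Cmult_neq_0]. Qed.
Lemma cpow_add (z : C) (j k : nat) : cpow z (j + k) = (cpow z j * cpow z k)%C.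
Proof. induction j; simpl; [ring|rewrite IHj; ring]. Qed.
Lemma Cmod_cpow (z : C) (k : nat) : Cmod (cpow z k) = Cmod z ^ k.
Proof. induction k; simpl; [apply Cmod_1|now rewrite Cmod_mult, IHk]. Qed.
Lemma is_derive_C_cpow (k : nat) (z : C) : is_derive (fun z => cpow z k) z (RtoC (INR k) * cpow z (pred k))%C.
Proof.
  induction k.
  - simpl. eapply is_derive_C_eq; [apply is_derive_C_const|]. ring.
  - eapply is_derive_C_eq.
    + apply (is_derive_C_mult (fun z => z) (fun z => cpow z k)); [apply is_derive_C_id|exact IHk].
    + rewrite S_INR, RtoC_plus. destruct k; simpl pred; simpl cpow; [simpl INR; ring|ring].
Qed.
Lemma ex_derive_C_cpow (k : nat) (z : C) : ex_derive (fun z => cpow z k) z.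
Proof. eexists. apply is_derive_C_cpow. Qed.

Lemma cpowZ_of_nat (z : C) (k : nat) : cpowZ z (Z.of_nat k) = cpow z k.
Proof. destruct k; [reflexivity|]. simpl Z.of_nat. unfold cpowZ. now rewrite SuccNat2Pos.id_succ. Qed.
Lemma cpowZ_opp_nat (z : C) (k : nat) : cpowZ z (- Z.of_nat k) = (/ cpow z k)%C.
Proof.
  destruct k; [simpl; field|]. simpl Z.of_nat. simpl Z.opp. unfold cpowZ. now rewrite SuccNat2Pos.id_succ.
Qed.

Lemma tends_cpow (k : nat) : (0 < k)%nat -> tends (fun w => cpow (cexp w) k) 0%C.
Proof.
  intros Hk. eapply tends_eq; [apply (tends_at0 (fun z => cpow z k)), ex_derive_C_cpow|].
  destruct k; [lia|]. simpl. ring.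
Qed.

Lemma ex_derive_C_inv (f : C -> C) (z : C) : f z <> 0%C -> ex_derive f z -> ex_derive (fun x => / f x)%C z.
Proof. intros Hz [a Ha]. eexists; exact (is_derive_C_inv f z a Hz Ha). Qed.
Lemma ex_derive_C_div (f g : C -> C) (z : C) : g z <> 0%C -> ex_derive f z -> ex_derive g z -> ex_derive (fun x => f x / g x)%C z.
Proof. intros Hz Hf Hg. apply ex_derive_C_mult; auto. now apply ex_derive_C_inv. Qed.
Lemma ex_derive_C_comp (f g : C -> C) (z : C) : ex_derive f (g z) -> ex_derive g z -> ex_derive (fun x => f (g x)) z.
Proof. intros [a Ha] [b Hb]. eexists; exact (is_derive_C_comp f g z a b Ha Hb). Qed.
Lemma ex_derive_C_loc (f g : C -> C) (z : C) (d : R) : 0 < d -> (forall y, Cmod (y - z) < d -> f y = g y) ->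
  ex_derive f z -> ex_derive g z.
Proof. intros Hd H [a Ha]. eexists; exact (is_derive_C_loc f g z a d Hd H Ha). Qed.

Definition holo0 (r : R) (phi : C -> C) : Prop := forall z, Cmod z < r -> ex_derive phi z.

Lemma holo0_le r r' phi : r' <= r -> holo0 r phi -> holo0 r' phi.
Proof. intros H K z Hz. apply K. lra. Qed.

Lemma holo0_nonzero r phi : 0 < r -> holo0 r phi -> phi 0%C <> 0%C ->
  exists r', 0 < r' <= r /\ forall z, Cmod z < r' -> phi z <> 0%C.
Proof.
  intros Hr H H0. destruct (ex_derive_C_cont phi 0%C) with (eps := Cmod (phi 0%C)) as [d [Hd0 Hd]].
  - apply H. now rewrite Cmod_0.
  - now apply Cmod_gt_0.
  - exists (Rmin d r). split; [split; [now apply Rmin_pos|apply Rmin_r]|]. intros z Hz E.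
    specialize (Hd z). replace (z - 0)%C with z in Hd by ring. rewrite E in Hd.
    replace (0 - phi 0)%C with (- phi 0)%C in Hd by ring. rewrite Cmod_opp in Hd.
    pose proof (Rmin_l d r). specialize (Hd ltac:(lra)). lra.
Qed.

Lemma holo0_C_derive r phi : holo0 r phi -> holo0 r (C_derive phi).
Proof.
  intros H z Hz. apply ex_derive_C_derive with (r - Cmod z); [lra|]. intros y Hy. apply H.
  pose proof (Cmod_triangle (y - z) z) as T. replace (y - z + z)%C with y in T by ring. lra.
Qed.

(* [h] takes the value [p] at 0 with multiplicity [k]. *)
Definition sph_order (h : C -> C) (p : sphere) (k : nat) : Prop :=
  match p with
  | Some c => mero_order (fun z => h z - c)%C (Z.of_nat k)
  | None => mero_order h (- Z.of_nat k)
  end.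

Lemma ram_order_sph h k : ram_order h (Some k) -> (0 < k)%nat /\ exists p, sph_order h p k.
Proof. intros [Hk [H|[c H]]]; split; auto; [now exists None|now exists (Some c)]. Qed.

Lemma sph_order_finite h c k : sph_order h (Some c) k -> exists r phi, 0 < r /\ holo0 r phi /\ phi 0%C <> 0%C /\
  forall z, 0 < Cmod z < r -> h z = (c + cpow z k * phi z)%C.
Proof.
  intros (r & phi & Hr & Hp & H0 & E). exists r, phi. repeat split; auto.
  intros z Hz. specialize (E z Hz). rewrite cpowZ_of_nat in E. rewrite <- E. ring.
Qed.
Lemma sph_order_pole h k : sph_order h None k -> exists r phi, 0 < r /\ holo0 r phi /\ phi 0%C <> 0%C /\
  forall z, 0 < Cmod z < r -> h z = (phi z / cpow z k)%C.
Proof.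
  intros (r & phi & Hr & Hp & H0 & E). exists r, phi. repeat split; auto.
  intros z Hz. rewrite (E z Hz), cpowZ_opp_nat. unfold Cdiv. ring.
Qed.

Lemma Cmod_pos_neq (z : C) : 0 < Cmod z -> z <> 0%C.
Proof. intros H. now apply Cmod_gt_0. Qed.

Lemma tends_sph_finite h c k : (0 < k)%nat -> sph_order h (Some c) k -> tends (fun w => h (cexp w)) c.
Proof.
  intros Hk H. destruct (sph_order_finite _ _ _ H) as (r & phi & Hr & Hp & H0 & E).
  apply tends_ext with (fun w => c + cpow (cexp w) k * phi (cexp w))%C.
  { generalize (near_end_cexp r Hr). apply near_end_imp. intros w K. now rewrite E. }
  eapply tends_eq; [apply tends_plus; [apply tends_const|apply tends_mult; [now apply tends_cpow|apply tends_at0, Hp; now rewrite Cmod_0]]|].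
  ring.
Qed.

(** A finite limit of [h] would force [phi = z^k h] to tend to 0, against [phi 0 <> 0]. *)
Lemma sph_pole_not_tends h c k : (0 < k)%nat -> sph_order h None k -> ~ tends (fun w => h (cexp w)) c.
Proof.
  intros Hk H T. destruct (sph_order_pole _ _ H) as (r & phi & Hr & Hp & H0 & E).
  apply H0. apply (tends_unique (fun w => phi (cexp w))).
  - apply tends_at0, Hp. now rewrite Cmod_0.
  - apply tends_ext with (fun w => cpow (cexp w) k * h (cexp w))%C.
    + generalize (near_end_cexp r Hr). apply near_end_imp. intros w K. rewrite E by auto. field.
      apply cpow_neq_0, Cmod_pos_neq; lra.
    + eapply tends_eq; [apply tends_mult; [now apply tends_cpow|exact T]|]. ring.
Qed.

Lemma vanishes_tends h c : vanishes_near0 (fun z => h z - c)%C -> tends (fun w => h (cexp w)) c.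
Proof.
  intros [r [Hr H]]. apply tends_ext with (fun _ => c); [|apply tends_const].
  generalize (near_end_cexp r Hr). apply near_end_imp. intros w K. specialize (H _ K).
  replace (h (cexp w)) with ((h (cexp w) - c) + c)%C by ring. rewrite H. ring.
Qed.

(** The value is recovered from the behaviour at the end: finite limits are unique, and a pole has
    none. *)
Lemma mero_val_sph_order h p p' k : (0 < k)%nat -> sph_order h p k -> mero_val h p' -> p' = p.
Proof.
  intros Hk H H'.
  assert (T : match p' with Some c => tends (fun w => h (cexp w)) c
      | None => exists j, (0 < j)%nat /\ sph_order h None j end).
  { destruct p' as [c|].
    - destruct H' as [V|[n [Hn V]]]; [now apply vanishes_tends|].
      apply (tends_sph_finite h c (Z.to_nat n)); [lia|]. unfold sph_order. now rewrite Z2Nat.id by lia.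
    - destruct H' as [n [Hn V]]. exists (Z.to_nat (- n)). split; [lia|]. unfold sph_order.
      rewrite Z2Nat.id by lia. now rewrite Z.opp_involutive. }
  destruct p' as [c'|]; destruct p as [c|]; auto.
  - f_equal. apply (tends_unique _ _ _ T). now apply tends_sph_finite with k.
  - now apply sph_pole_not_tends with (c := c') in H.
  - destruct T as [j [Hj T]]. apply sph_pole_not_tends with (c := c) in T; auto.
    exfalso; apply T. now apply tends_sph_finite with k.
Qed.

Lemma Cinv_neq_0 (z : C) : z <> 0%C -> (/ z)%C <> 0%C.
Proof.
  intros Hz E. assert (F : (z * / z)%C = 1%C) by (field; auto). rewrite E in F.
  apply (f_equal fst) in F. simpl in F. lra.
Qed.

(** Moebius maps are local biholomorphisms of the sphere, so the order [k] is preserved. Explicitly,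
    [det u = 1] makes the difference to [q] equal to [x / ((c (p + x) + d) (c p + d))] for
    [h = p + x] at a finite value [p], and to [- 1 / (c (c h + d))] at a pole. *)
Lemma mob_germ u h p k q : (0 < k)%nat -> mdet u = 1%C -> sph_order h p k -> mob_rel u p (Some q) ->
  exists r phi, 0 < r /\ holo0 r phi /\ phi 0%C <> 0%C /\
  forall z, 0 < Cmod z < r -> (m21 u * h z + m22 u)%C <> 0%C /\ mob u h z = (q + cpow z k * phi z)%C.
Proof.
  intros Hk Hd Hh Hu. destruct u as [a b c d]. unfold mdet, mob in *; simpl in *.
  assert (Z0 : cpow 0%C k = 0%C) by (destruct k; [lia|simpl; ring]).
  destruct p as [p|]; cbn [mob_rel m11 m12 m21 m22] in Hu.
  - destruct Hu as [Hn Hq]. destruct (sph_order_finite _ _ _ Hh) as (r & phi & Hr & Hp & H0 & E).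
    set (den := fun z => (c * (p + cpow z k * phi z) + d)%C).
    assert (Hden : holo0 r den).
    { intros z Hz. apply ex_derive_C_plus; [|apply ex_derive_C_const]. apply ex_derive_C_mult; [apply ex_derive_C_const|].
      apply ex_derive_C_plus; [apply ex_derive_C_const|]. apply ex_derive_C_mult; [apply ex_derive_C_cpow|auto]. }
    assert (Hden0 : den 0%C <> 0%C).
    { unfold den. rewrite Z0. now replace (c * (p + 0 * phi 0%C) + d)%C with (c * p + d)%C by ring. }
    destruct (holo0_nonzero r den Hr Hden Hden0) as (r' & Hr' & Hnz).
    exists r', (fun z => phi z / (den z * (c * p + d)))%C. repeat split.
    + lra.
    + intros z Hz. apply ex_derive_C_div.
      * apply Cmult_neq_0; auto.
      * apply Hp; lra.
      * apply ex_derive_C_mult; [apply Hden; lra|apply ex_derive_C_const].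
    + apply Cmult_neq_0; auto. apply Cinv_neq_0. now apply Cmult_neq_0.
    + rewrite E by lra. apply Hnz. lra.
    + assert (N := Hnz z ltac:(lra)). rewrite E by lra. unfold den in *. rewrite Hq.
      set (x := (cpow z k * phi z)%C) in *.
      replace (cpow z k * (phi z / ((c * (p + x) + d) * (c * p + d))))%C
        with (x * (a * d - b * c) / ((c * (p + x) + d) * (c * p + d)))%C by (rewrite Hd; unfold x; field; auto).
      field; auto.
  - destruct Hu as [Hc Hq]. destruct (sph_order_pole _ _ Hh) as (r & phi & Hr & Hp & H0 & E).
    set (den := fun z => (c * phi z + d * cpow z k)%C).
    assert (Hden : holo0 r den).
    { intros z Hz. apply ex_derive_C_plus; apply ex_derive_C_mult; auto using ex_derive_C_const, ex_derive_C_cpow. }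
    assert (Hden0 : den 0%C <> 0%C).
    { unfold den. rewrite Z0. replace (c * phi 0%C + d * 0)%C with (c * phi 0%C)%C by ring. now apply Cmult_neq_0. }
    destruct (holo0_nonzero r den Hr Hden Hden0) as (r' & Hr' & Hnz).
    exists r', (fun z => - / (c * den z))%C.
    assert (Hcd : forall z, Cmod z < r' -> (c * den z)%C <> 0%C) by (intros; apply Cmult_neq_0; auto).
    assert (Hdz : forall z, 0 < Cmod z < r' -> (c * h z + d)%C = (den z / cpow z k)%C /\ cpow z k <> 0%C).
    { intros z Hz. assert (N : cpow z k <> 0%C) by (apply cpow_neq_0, Cmod_pos_neq; lra). split; auto.
      rewrite E by lra. unfold den. field; auto. }
    repeat split.
    + lra.
    + intros z Hz. apply ex_derive_C_opp, ex_derive_C_inv; auto. apply ex_derive_C_mult; [apply ex_derive_C_const|apply Hden; lra].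
    + intros K. apply (Cinv_neq_0 (c * den 0%C)); [apply Hcd; rewrite Cmod_0; lra|].
      replace (/ (c * den 0%C))%C with (- - / (c * den 0%C))%C by ring. rewrite K. ring.
    + destruct (Hdz z H) as [-> N]. apply Cmult_neq_0; [apply Hnz; lra|now apply Cinv_neq_0].
    + destruct (Hdz z H) as [-> N]. assert (N' := Hnz z ltac:(lra)). rewrite Hq, E by lra.
      replace (cpow z k * - / (c * den z))%C with (- (a * d - b * c) * cpow z k / (c * den z))%C by (rewrite Hd; field; auto).
      unfold den in *. field; auto.
Qed.

(** The vanishing diagonal of [E^{-1} E'] and [det E = 1] let [E'] be solved as [E] times an
    off-diagonal matrix: differentiation exchanges the columns of [E] up to the factors [omega_hat]
    and [theta_hat]. *)
Lemma legendrian_ode (E : C -> mat2) (w : C) : flat_front_end E -> Omega w ->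
  C_derive (fun x => m11 (E x)) w = (m12 (E w) * omega_hat E w)%C /\
  C_derive (fun x => m12 (E x)) w = (m11 (E w) * theta_hat E w)%C /\
  C_derive (fun x => m21 (E x)) w = (m22 (E w) * omega_hat E w)%C /\
  C_derive (fun x => m22 (E x)) w = (m21 (E w) * theta_hat E w)%C.
Proof.
  intros (_ & Hd & _ & HL & _) Hw. specialize (Hd w Hw). specialize (HL w Hw).
  unfold omega_hat, theta_hat, MC, minv in *. rewrite Hd in *.
  unfold mmul, mscale, Ed in *; simpl in *. unfold mdet in Hd.
  set (a := m11 (E w)) in *. set (b := m12 (E w)) in *. set (c := m21 (E w)) in *. set (d := m22 (E w)) in *.
  set (a' := C_derive (fun x => m11 (E x)) w) in *. set (b' := C_derive (fun x => m12 (E x)) w) in *.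
  set (c' := C_derive (fun x => m21 (E x)) w) in *. set (d' := C_derive (fun x => m22 (E x)) w) in *.
  replace (/ 1)%C with (RtoC 1) in * by field.
  destruct HL as [L1 L2].
  assert (K1 : (d * a' - b * c')%C = 0%C) by (rewrite <- L1; ring).
  assert (K2 : (a * d' - c * b')%C = 0%C) by (rewrite <- L2; ring).
  repeat split.
  - replace a' with ((a * d - b * c) * a')%C at 1 by (rewrite Hd; ring).
    replace ((a * d - b * c) * a')%C with (a * (d * a' - b * c') + b * (a * c' - c * a'))%C by ring. rewrite K1. ring.
  - replace b' with ((a * d - b * c) * b')%C at 1 by (rewrite Hd; ring).
    replace ((a * d - b * c) * b')%C with (b * (a * d' - c * b') + a * (d * b' - b * d'))%C by ring. rewrite K2. ring.
  - replace c' with ((a * d - b * c) * c')%C at 1 by (rewrite Hd; ring).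
    replace ((a * d - b * c) * c')%C with (c * (d * a' - b * c') + d * (a * c' - c * a'))%C by ring. rewrite K1. ring.
  - replace d' with ((a * d - b * c) * d')%C at 1 by (rewrite Hd; ring).
    replace ((a * d - b * c) * d')%C with (d * (a * d' - c * b') + c * (d * b' - b * d'))%C by ring. rewrite K2. ring.
Qed.

(** [gauss_maps] prescribes nothing where the denominator vanishes, so a pole of [A / B] has to be
    excluded by the regularity of [G]: the continuous function [G B - A] would be zero at nearby
    points with [B <> 0] but equal to [- A w <> 0] at [w]. *)
Lemma quotient_pole_singular (A B G : C -> C) (w : C) (d : R) : 0 < d ->
  ex_derive A w -> ex_derive B w -> ex_derive G w -> B w = 0%C ->
  (C_derive A w * B w - A w * C_derive B w)%C <> 0%C ->
  (forall y, Cmod (y - w) < d -> B y <> 0%C -> G y = (A y / B y)%C) -> False.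
Proof.
  intros Hd HA HB HG H0 Hne HGe.
  assert (HA0 : A w <> 0%C) by (intros K; apply Hne; rewrite H0, K; ring).
  assert (HB0 : C_derive B w <> 0%C) by (intros K; apply Hne; rewrite H0, K; ring).
  assert (HF : ex_derive (fun y => G y * B y - A y)%C w) by (apply ex_derive_C_minus; auto; now apply ex_derive_C_mult).
  pose proof (proj1 (Cmod_gt_0 _) HA0) as PA. pose proof (proj1 (Cmod_gt_0 _) HB0) as PB.
  destruct (ex_derive_C_cont _ _ HF (Cmod (A w)) PA) as [d1 [Hd1 K1]].
  (* The zero of [B] at [w] is simple, so [B] does not vanish at the nearby point [y] chosen
     below. *)
  destruct (proj1 (is_derive_C_iff _ _ _) (is_derive_C_correct B w HB) (Cmod (C_derive B w) / 2) ltac:(lra)) as [d2 [Hd2 K2]].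
  set (t := Rmin d (Rmin d1 d2) / 2).
  assert (Ht : 0 < t < d /\ t < d1 /\ t < d2).
  { unfold t. pose proof (Rmin_l d (Rmin d1 d2)). pose proof (Rmin_r d (Rmin d1 d2)).
    pose proof (Rmin_l d1 d2). pose proof (Rmin_r d1 d2).
    assert (0 < Rmin d (Rmin d1 d2)) by (repeat apply Rmin_pos; auto). lra. }
  set (y := (w + RtoC t)%C).
  assert (Ey : (y - w)%C = RtoC t) by (unfold y; ring).
  assert (My : Cmod (y - w) = t) by (rewrite Ey, Cmod_R; apply Rabs_right; lra).
  specialize (K1 y ltac:(lra)). specialize (K2 y ltac:(lra)). specialize (HGe y ltac:(lra)).
  rewrite My in K2.
  assert (By : B y <> 0%C).
  { intros E. rewrite E, H0 in K2.
    replace (0 - 0 - C_derive B w * (y - w))%C with (- (C_derive B w * (y - w)))%C in K2 by ring.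
    rewrite Cmod_opp, Cmod_mult, My in K2. assert (0 < Cmod (C_derive B w) * t) by (apply Rmult_lt_0_compat; lra). lra. }
  specialize (HGe By). rewrite HGe, H0 in K1.
  replace (A y / B y * B y - A y - (G w * 0 - A w))%C with (A w) in K1 by (field; auto). lra.
Qed.

Lemma Omega_nbhd (w y : C) (a : R) : Cmod (y - w) < a - fst w -> fst y < a.
Proof.
  intros H. pose proof (Rmax_Cmod (y - w)%C) as K. simpl in K.
  pose proof (Rmax_l (Rabs (fst y + - fst w)) (Rabs (snd y + - snd w))).
  pose proof (Rle_abs (fst y + - fst w)). lra.
Qed.

Lemma ram_order_ed (h : C -> C) (l : option nat) : ram_order h l ->
  exists r, 0 < r /\ forall z, 0 < Cmod z < r -> ex_derive h z.
Proof.
  intros H.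
  assert (G : exists r F, 0 < r /\ (forall z, 0 < Cmod z < r -> ex_derive F z) /\ forall z, 0 < Cmod z < r -> F z = h z).
  { destruct l as [k|].
    - destruct (ram_order_sph _ _ H) as [_ [[p|] Hp]].
      + destruct (sph_order_finite _ _ _ Hp) as (r & phi & Hr & Hh & _ & E).
        exists r, (fun z => p + cpow z k * phi z)%C. split; auto. split; [|intros; now rewrite E].
        intros z Hz. apply ex_derive_C_plus; [apply ex_derive_C_const|]. apply ex_derive_C_mult; [apply ex_derive_C_cpow|apply Hh; lra].
      + destruct (sph_order_pole _ _ Hp) as (r & phi & Hr & Hh & _ & E).
        exists r, (fun z => phi z / cpow z k)%C. split; auto. split; [|intros; now rewrite E].
        intros z Hz. apply ex_derive_C_div; [apply cpow_neq_0, Cmod_pos_neq; lra|apply Hh; lra|apply ex_derive_C_cpow].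
    - destruct H as [c [r [Hr E]]]. exists r, (fun _ => c). split; auto. split; [intros; apply ex_derive_C_const|].
      intros z Hz. specialize (E z Hz). change (c = h z :> C).
      transitivity ((h z - c) + c)%C; [rewrite E|]; ring. }
  destruct G as (r & F & Hr & HF & E). exists r. split; auto. intros z Hz.
  (* This radius keeps the neighbourhood of [z] inside the punctured disc. *)
  apply (ex_derive_C_loc F h z (Rmin (Cmod z) (r - Cmod z))); [apply Rmin_pos; lra| |auto].
  intros y Hy. apply E. pose proof (Rmin_l (Cmod z) (r - Cmod z)). pose proof (Rmin_r (Cmod z) (r - Cmod z)).
  pose proof (Cmod_triangle (y - z) z) as T. replace (y - z + z)%C with y in T by ring.
  pose proof (Cmod_triangle (z - y) y) as T'. replace (z - y + y)%C with z in T' by ring.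
  rewrite Cmod_minus_sym in T'. lra.
Qed.

(** Equals [B^2 (A / B)'] but makes sense at zeros of [B], and is unchanged when a matrix of
    determinant 1 acts on the pair. For the columns of [E] it is [- omega_hat] and [theta_hat]. *)
Definition wronskian (A B : C -> C) (w : C) : C := (C_derive A w * B w - A w * C_derive B w)%C.

(** A nonzero Wronskian yields both conclusions: a zero of [B] would be a pole of the quotient,
    impossible for a function differentiable there, and a constant quotient would make the Wronskian
    vanish. *)
Lemma quotient_germ (A B h : C -> C) (l : option nat) :
  (forall w, Omega w -> ex_derive A w) -> (forall w, Omega w -> ex_derive B w) ->
  (forall w, Omega w -> B w <> 0%C -> h (cexp w) = (A w / B w)%C) ->
  near_end (fun w => wronskian A B w <> 0%C) -> ram_order h l ->
  near_end (fun w => B w <> 0%C /\ h (cexp w) = (A w / B w)%C) /\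
  exists k p, l = Some k /\ (0 < k)%nat /\ sph_order h p k.
Proof.
  intros HA HB Hh HW Hl.
  assert (G : near_end (fun w => B w <> 0%C /\ h (cexp w) = (A w / B w)%C)).
  { destruct (ram_order_ed _ _ Hl) as (r & Hr & Hed).
    generalize (near_end_and _ _ (near_end_and _ _ HW near_end_Omega) (near_end_cexp r Hr)). apply near_end_imp.
    intros w [[W O] Z]. assert (N : B w <> 0%C); [|split; auto].
    intros N. apply (quotient_pole_singular A B (fun x => h (cexp x)) w (0 - fst w)); auto.
    - unfold Omega in O; lra.
    - apply (ex_derive_C_comp h cexp); [apply Hed; auto|]. eexists; apply is_derive_cexp.
    - intros y Hy Hy0. apply Hh; auto. apply Omega_nbhd with w; auto. }
  split; auto.
  destruct l as [k|].
  - destruct (ram_order_sph _ _ Hl) as [Hk [p Hp]]. exists k, p. auto.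
  - exfalso. destruct Hl as [c Hc]. destruct Hc as [r [Hr Hc]].
    destruct (near_end_and _ _ (near_end_and _ _ HW near_end_Omega) (near_end_and _ _ G (near_end_cexp r Hr))) as (a & Ha & K).
    set (w := (a - 1, 0) : C). assert (Hw : fst w < a) by (simpl; lra).
    assert (X : forall y, fst y < a -> A y = (c * B y)%C).
    { intros y Hy. destruct (K y Hy) as [_ [[N E] Z]]. specialize (Hc _ Z).
      replace (A y) with ((A y / B y - c) * B y + c * B y)%C by (field; auto). rewrite <- E, Hc. ring. }
    destruct (K w Hw) as [[W O] _]. apply W. unfold wronskian.
    assert (D : C_derive A w = (c * C_derive B w)%C).
    { apply is_C_derive_unique. apply (is_derive_C_loc (fun y => c * B y)%C A w _ (a - fst w)); [lra| |].
      - intros y Hy. symmetry. apply X. now apply Omega_nbhd with w.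
      - eapply is_derive_C_eq; [apply is_derive_C_mult; [apply is_derive_C_const|apply is_derive_C_correct, HB, O]|cbv beta; ring]. }
    rewrite D, (X w Hw). ring.
Qed.

(** [z d/dz] of [z^k phi] is [z^k psi]; with [z = exp w] this is the derivative in [w]. *)
Definition psi_of (k : nat) (phi : C -> C) (z : C) : C := (RtoC (INR k) * phi z + z * C_derive phi z)%C.

Lemma psi_of_holo k r phi : holo0 r phi -> holo0 r (psi_of k phi).
Proof.
  intros H z Hz. apply ex_derive_C_plus; apply ex_derive_C_mult; auto using ex_derive_C_const.
  - eexists; apply is_derive_C_id.
  - now apply (holo0_C_derive r).
Qed.
Lemma psi_of_0 k phi : psi_of k phi 0%C = (RtoC (INR k) * phi 0%C)%C.
Proof. unfold psi_of. ring. Qed.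

Lemma INR_neq_0 (k : nat) : (0 < k)%nat -> RtoC (INR k) <> 0%C.
Proof. intros Hk. apply C_neq_of_fst. simpl. apply not_0_INR. lia. Qed.

Lemma is_derive_C_monomial k phi z : (0 < k)%nat -> ex_derive phi z ->
  is_derive (fun z => cpow z k * phi z)%C z (cpow z (pred k) * psi_of k phi z)%C.
Proof.
  intros Hk Hp. eapply is_derive_C_eq; [apply is_derive_C_mult; [apply is_derive_C_cpow|now apply is_derive_C_correct]|].
  unfold psi_of. destruct k; [lia|]. simpl pred. simpl cpow. ring.
Qed.

Lemma is_derive_C_monomial_cexp k q phi w : (0 < k)%nat -> ex_derive phi (cexp w) ->
  is_derive (fun w => q + cpow (cexp w) k * phi (cexp w))%C w (cpow (cexp w) k * psi_of k phi (cexp w))%C.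
Proof.
  intros Hk Hp. eapply is_derive_C_eq.
  - apply is_derive_C_plus; [apply is_derive_C_const|].
    apply (is_derive_C_comp (fun z => cpow z k * phi z)%C cexp); [now apply is_derive_C_monomial|apply is_derive_cexp].
  - destruct k; [lia|]. simpl. ring.
Qed.

(* In the frame [u E] the Gauss map is [q + z^k phi], with derivative [z^k psi] in the coordinate [w = log z]. *)
Lemma frame_germ (A B h : C -> C) (u : mat2) (p : sphere) (q : C) (k : nat) :
  (forall w, Omega w -> ex_derive A w) -> (forall w, Omega w -> ex_derive B w) ->
  near_end (fun w => B w <> 0%C /\ h (cexp w) = (A w / B w)%C) ->
  (0 < k)%nat -> sph_order h p k -> mdet u = 1%C -> mob_rel u p (Some q) ->
  exists r phi, 0 < r /\ holo0 r phi /\ (forall z, Cmod z < r -> phi z <> 0%C) /\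
   (forall z, Cmod z < r -> psi_of k phi z <> 0%C) /\
   (forall z, 0 < Cmod z < r -> mob u h z = (q + cpow z k * phi z)%C) /\
   near_end (fun w => (m21 u * A w + m22 u * B w)%C <> 0%C /\
      (m11 u * A w + m12 u * B w)%C = ((q + cpow (cexp w) k * phi (cexp w)) * (m21 u * A w + m22 u * B w))%C /\
      wronskian A B w = (cpow (cexp w) k * psi_of k phi (cexp w) *
        ((m21 u * A w + m22 u * B w) * (m21 u * A w + m22 u * B w)))%C).
Proof.
  intros HA HB HE Hk Hp Hd Hu.
  destruct (mob_germ u h p k q Hk Hd Hp Hu) as (r0 & phi & Hr0 & Hphi & Hphi0 & Hm).
  destruct (holo0_nonzero r0 phi Hr0 Hphi Hphi0) as (r1 & Hr1 & N1).
  destruct (holo0_nonzero r1 (psi_of k phi)) as (r & Hr & N2).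
  { lra. } { apply psi_of_holo, (holo0_le r0); auto; lra. }
  { rewrite psi_of_0. apply Cmult_neq_0; auto. now apply INR_neq_0. }
  exists r, phi. split; [lra|]. split; [apply (holo0_le r0); auto; lra|].
  split; [intros; apply N1; lra|]. split; [auto|]. split; [intros; apply Hm; lra|].
  assert (G : near_end (fun w => (m21 u * A w + m22 u * B w)%C <> 0%C /\
      (m11 u * A w + m12 u * B w)%C = ((q + cpow (cexp w) k * phi (cexp w)) * (m21 u * A w + m22 u * B w))%C)).
  { generalize (near_end_and _ _ HE (near_end_cexp r0 Hr0)). apply near_end_imp. intros w [[N E] Z].
    destruct (Hm _ Z) as [D M]. rewrite <- M. unfold mob. rewrite E in *.
    assert (X : (m21 u * A w + m22 u * B w)%C = ((m21 u * (A w / B w) + m22 u) * B w)%C) by (field; auto).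
    split.
    - rewrite X. now apply Cmult_neq_0.
    - rewrite X. set (t := (A w / B w)%C) in *.
      transitivity ((m11 u * t + m12 u) * B w)%C; [unfold t; field; auto|]. field. auto. }
  destruct (near_end_and _ _ (near_end_and _ _ G near_end_Omega) (near_end_cexp r0 Hr0)) as (a & Ha & K).
  exists a. split; auto. intros w Hw. destruct (K w Hw) as [[[N E] O] Z]. split; auto. split; auto.
  set (FA := fun w => (m11 u * A w + m12 u * B w)%C).
  set (FB := fun w => (m21 u * A w + m22 u * B w)%C).
  set (H := fun w => (q + cpow (cexp w) k * phi (cexp w))%C).
  assert (DA := is_derive_C_correct A w (HA w O)). assert (DB := is_derive_C_correct B w (HB w O)).
  assert (L : forall c1 c2, is_derive (fun w => c1 * A w + c2 * B w)%C w (c1 * C_derive A w + c2 * C_derive B w)%C).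
  { intros c1 c2. eapply is_derive_C_eq; [apply is_derive_C_plus; (apply is_derive_C_mult; [apply is_derive_C_const|eassumption])|cbv beta; ring]. }
  assert (DH : is_derive H w (cpow (cexp w) k * psi_of k phi (cexp w))%C).
  { apply is_derive_C_monomial_cexp; auto. apply Hphi. lra. }
  (* The relation [FA = H * FB] holds on a neighbourhood, so it may be differentiated. Comparison
     with the linear expression for the derivative of [FA] gives the Wronskian of [FA] and [FB],
     which is [det u] times that of [A] and [B]. *)
  assert (D1 : is_derive FA w (cpow (cexp w) k * psi_of k phi (cexp w) * FB w + H w * (m21 u * C_derive A w + m22 u * C_derive B w))%C).
  { apply (is_derive_C_loc (fun w => H w * FB w)%C FA w _ (a - fst w)); [lra| |].
    - intros y Hy. symmetry. apply (K y). now apply Omega_nbhd with w.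
    - apply is_derive_C_mult; [exact DH|apply L]. }
  apply is_C_derive_unique in D1.
  rewrite (is_C_derive_unique FA w _ (L (m11 u) (m12 u))) in D1.
  change (FA w = (H w * FB w)%C) in E. unfold mdet in Hd.
  change ((m21 u * A w + m22 u * B w)%C) with (FB w).
  unfold wronskian.
  replace (C_derive A w * B w - A w * C_derive B w)%C with
    ((m11 u * m22 u - m12 u * m21 u) * (C_derive A w * B w - A w * C_derive B w))%C by (rewrite Hd; ring).
  replace ((m11 u * m22 u - m12 u * m21 u) * (C_derive A w * B w - A w * C_derive B w))%C with
   ((m11 u * C_derive A w + m12 u * C_derive B w) * FB w - FA w * (m21 u * C_derive A w + m22 u * C_derive B w))%C
   by (unfold FA, FB; ring).
  rewrite D1, E. ring.
Qed.

(** * The Gauss maps in a frame *)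

Lemma wronskian_left (E : C -> mat2) (w : C) : flat_front_end E -> Omega w ->
  wronskian (fun x => m11 (E x)) (fun x => m21 (E x)) w = (- omega_hat E w)%C.
Proof.
  intros HE Hw. destruct (legendrian_ode E w HE Hw) as (D1 & D2 & D3 & D4).
  destruct HE as (_ & Hd & _). specialize (Hd w Hw). unfold mdet in Hd. unfold wronskian. rewrite D1, D3.
  transitivity (- ((m11 (E w) * m22 (E w) - m12 (E w) * m21 (E w)) * omega_hat E w))%C; [ring|rewrite Hd; ring].
Qed.
Lemma wronskian_right (E : C -> mat2) (w : C) : flat_front_end E -> Omega w ->
  wronskian (fun x => m12 (E x)) (fun x => m22 (E x)) w = theta_hat E w.
Proof.
  intros HE Hw. destruct (legendrian_ode E w HE Hw) as (D1 & D2 & D3 & D4).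
  destruct HE as (_ & Hd & _). specialize (Hd w Hw). unfold mdet in Hd. unfold wronskian. rewrite D2, D4.
  transitivity ((m11 (E w) * m22 (E w) - m12 (E w) * m21 (E w)) * theta_hat E w)%C; [ring|rewrite Hd; ring].
Qed.

Definition germ_of (A B h : C -> C) (p : sphere) (k : nat) : Prop :=
  (0 < k)%nat /\ sph_order h p k /\ near_end (fun w => B w <> 0%C /\ h (cexp w) = (A w / B w)%C).

(** The nonzero limit of [omega_hat * theta_hat] makes both factors, hence both Wronskians, nonzero
    near the end; so neither Gauss map is constant and both ramification orders are finite. *)
Lemma end_germs (E : C -> mat2) (g gs : C -> C) (G0 : sphere) (m : nat) (q : C) :
  flat_front_end E -> gauss_maps E g gs -> q <> 0%C ->
  tends (fun w => omega_hat E w * theta_hat E w)%C q -> mero_val g G0 -> multiplicity g gs m ->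
  exists k1 k2 p2, germ_of (fun x => m11 (E x)) (fun x => m21 (E x)) g G0 k1 /\
     germ_of (fun x => m12 (E x)) (fun x => m22 (E x)) gs p2 k2 /\ Nat.min k1 k2 = m.
Proof.
  intros HE Hg Hq HQ Hv (l1 & l2 & R1 & R2 & Hm).
  assert (N := near_end_and _ _ (tends_neq _ _ 0%C HQ Hq) near_end_Omega).
  destruct (HE) as (Hh & _).
  destruct (quotient_germ (fun x => m11 (E x)) (fun x => m21 (E x)) g l1) as [G1 (k1 & p1 & E1 & Hk1 & S1)]; auto.
  { intros w Hw. apply (Hh w Hw). } { intros w Hw. apply (Hh w Hw). }
  { intros w Hw. apply (Hg w Hw). }
  { revert N. apply near_end_imp. intros w [K O] W. rewrite wronskian_left in W by auto. apply K.
    replace (omega_hat E w) with (- - omega_hat E w)%C by ring. rewrite W. ring. }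
  destruct (quotient_germ (fun x => m12 (E x)) (fun x => m22 (E x)) gs l2) as [G2 (k2 & p2 & E2 & Hk2 & S2)]; auto.
  { intros w Hw. apply (Hh w Hw). } { intros w Hw. apply (Hh w Hw). }
  { intros w Hw. apply (Hg w Hw). }
  { revert N. apply near_end_imp. intros w [K O] W. rewrite wronskian_right in W by auto. apply K.
    rewrite W. ring. }
  rewrite E1, E2 in Hm. simpl in Hm. injection Hm as Hm.
  rewrite (mero_val_sph_order g p1 G0 k1 Hk1 S1 Hv).
  exists k1, k2, p2. repeat split; auto.
Qed.

(** Each column of [u E] is its lower entry times the vector formed by the transformed Gauss map and
    1. The determinant then becomes the relation between [H - Hs] and [F21 F22], and the Wronskians
    express [omega_hat] and [theta_hat] through the derivatives of the Gauss maps. *)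
Lemma frame_pair (E : C -> mat2) (g gs : C -> C) (p1 p2 : sphere) (k1 k2 : nat) (u : mat2) (q1 q2 : C) :
  flat_front_end E ->
  germ_of (fun x => m11 (E x)) (fun x => m21 (E x)) g p1 k1 ->
  germ_of (fun x => m12 (E x)) (fun x => m22 (E x)) gs p2 k2 ->
  mdet u = 1%C -> mob_rel u p1 (Some q1) -> mob_rel u p2 (Some q2) ->
  exists r phi1 phi2, 0 < r /\ (holo0 r phi1 /\ holo0 r phi2) /\
    (forall z, Cmod z < r -> phi1 z <> 0%C /\ phi2 z <> 0%C /\ psi_of k1 phi1 z <> 0%C /\ psi_of k2 phi2 z <> 0%C) /\
    (forall z, 0 < Cmod z < r -> mob u g z = (q1 + cpow z k1 * phi1 z)%C /\ mob u gs z = (q2 + cpow z k2 * phi2 z)%C) /\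
    near_end (fun w => exists F21 F22 : C, let H := (q1 + cpow (cexp w) k1 * phi1 (cexp w))%C in
       let Hs := (q2 + cpow (cexp w) k2 * phi2 (cexp w))%C in
       mmul u (E w) = Mat2 (H * F21)%C (Hs * F22)%C F21 F22 /\ ((H - Hs) * (F21 * F22))%C = 1%C /\
       (- omega_hat E w)%C = (cpow (cexp w) k1 * psi_of k1 phi1 (cexp w) * (F21 * F21))%C /\
       theta_hat E w = (cpow (cexp w) k2 * psi_of k2 phi2 (cexp w) * (F22 * F22))%C).
Proof.
  intros HE (Hk1 & S1 & V1) (Hk2 & S2 & V2) Hd U1 U2. destruct (HE) as (Hh & Hdet & _).
  destruct (frame_germ _ _ g u p1 q1 k1 (fun w Hw => proj1 (Hh w Hw))
     (fun w Hw => proj1 (proj2 (proj2 (Hh w Hw)))) V1 Hk1 S1 Hd U1) as (r1 & phi1 & R1 & P1 & N1 & M1 & B1 & X1).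
  destruct (frame_germ _ _ gs u p2 q2 k2 (fun w Hw => proj1 (proj2 (Hh w Hw)))
     (fun w Hw => proj2 (proj2 (proj2 (Hh w Hw)))) V2 Hk2 S2 Hd U2) as (r2 & phi2 & R2 & P2 & N2 & M2 & B2 & X2).
  pose proof (Rmin_l r1 r2) as L1. pose proof (Rmin_r r1 r2) as L2.
  exists (Rmin r1 r2), phi1, phi2. split; [now apply Rmin_pos|].
  split; [split; [exact (holo0_le _ _ _ L1 P1)|exact (holo0_le _ _ _ L2 P2)]|].
  split; [intros z Hz; split; [apply N1; lra|split; [apply N2; lra|split; [apply M1; lra|apply M2; lra]]]|].
  split; [intros z Hz; split; [apply B1|apply B2]; lra|].
  generalize (near_end_and _ _ near_end_Omega (near_end_and _ _ X1 X2)). apply near_end_imp.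
  intros w [O [(N & Q1 & W1) (N' & Q2 & W2)]].
  rewrite wronskian_left in W1 by auto. rewrite wronskian_right in W2 by auto.
  exists (m21 u * m11 (E w) + m22 u * m21 (E w))%C, (m21 u * m12 (E w) + m22 u * m22 (E w))%C.
  cbv zeta. split; [|split; [|auto]].
  - unfold mmul. rewrite Q1, Q2. reflexivity.
  - specialize (Hdet w O). unfold mdet in Hdet, Hd.
    set (F21 := (m21 u * m11 (E w) + m22 u * m21 (E w))%C) in *.
    set (F22 := (m21 u * m12 (E w) + m22 u * m22 (E w))%C) in *.
    transitivity ((q1 + cpow (cexp w) k1 * phi1 (cexp w)) * F21 * F22 - (q2 + cpow (cexp w) k2 * phi2 (cexp w)) * F22 * F21)%C; [ring|].
    rewrite <- Q1, <- Q2. unfold F21, F22.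
    transitivity ((m11 u * m22 u - m12 u * m21 u) * (m11 (E w) * m22 (E w) - m12 (E w) * m21 (E w)))%C; [ring|].
    rewrite Hd, Hdet. ring.
Qed.

(* The Hopf differential in a frame: [Q = - H' Hs' / (H - Hs)^2]. *)
Lemma frame_hopf (x y om th F21 F22 d : C) : (d * (F21 * F22))%C = 1%C ->
  (- om)%C = (x * (F21 * F21))%C -> th = (y * (F22 * F22))%C -> (x * y)%C = (- (om * th) * (d * d))%C.
Proof.
  intros H1 H2 H3.
  transitivity ((x * (F21 * F21)) * (y * (F22 * F22)) * (d * d))%C; [|rewrite <- H2, <- H3; ring].
  transitivity (x * y * ((d * (F21 * F22)) * (d * (F21 * F22))))%C; [rewrite H1; ring|ring].
Qed.

(** In a frame where the two values [q1], [q2] are finite and distinct, [H' Hs'] would tend to 0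
    while [- Q (H - Hs)^2] tends to [- q (q1 - q2)^2], which is nonzero. *)
Lemma gauss_values_agree (E : C -> mat2) (g gs : C -> C) (p1 p2 : sphere) (k1 k2 : nat) (q : C) :
  flat_front_end E -> q <> 0%C -> tends (fun w => omega_hat E w * theta_hat E w)%C q ->
  germ_of (fun x => m11 (E x)) (fun x => m21 (E x)) g p1 k1 ->
  germ_of (fun x => m12 (E x)) (fun x => m22 (E x)) gs p2 k2 -> p1 = p2.
Proof.
  intros HE Hq HQ G1 G2. destruct (classic (p1 = p2)) as [|Hne]; auto. exfalso.
  assert (exists u q1 q2, mdet u = 1%C /\ mob_rel u p1 (Some q1) /\ mob_rel u p2 (Some q2) /\ q1 <> q2)
    as (u & q1 & q2 & Hd & U1 & U2 & Hq12).
  { assert (N1 : RtoC 1 <> 0%C) by (apply C_neq_of_fst; simpl; lra).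
    destruct p1 as [c1|], p2 as [c2|]; [| | |contradiction].
    - exists (Mat2 1 0 0 1)%C, c1, c2. unfold mdet, mob_rel; simpl.
      split; [ring|]. split; [|split].
      + split; [replace (0 * c1 + 1)%C with (RtoC 1) by ring; auto|field].
      + split; [replace (0 * c2 + 1)%C with (RtoC 1) by ring; auto|field].
      + congruence.
    (* The map [z -> 1 / (c1 + 1 - z)] sends [c1] to 1 and infinity to 0. *)
    - exists (Mat2 0 1 (- (1)) (c1 + 1))%C, (RtoC 1), (RtoC 0). unfold mdet, mob_rel; simpl.
      split; [ring|]. split; [|split].
      + replace (- (1) * c1 + (c1 + 1))%C with (RtoC 1) by ring. split; auto. field.
      + assert ((- (1))%C <> 0%C) by (apply C_neq_of_fst; simpl; lra). split; auto. field.
      + exact N1.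
    - exists (Mat2 0 1 (- (1)) (c2 + 1))%C, (RtoC 0), (RtoC 1). unfold mdet, mob_rel; simpl.
      split; [ring|]. split; [|split].
      + assert ((- (1))%C <> 0%C) by (apply C_neq_of_fst; simpl; lra). split; auto. field.
      + replace (- (1) * c2 + (c2 + 1))%C with (RtoC 1) by ring. split; auto. field.
      + intros K; apply N1; auto. }
  destruct (frame_pair E g gs p1 p2 k1 k2 u q1 q2 HE G1 G2 Hd U1 U2) as (r & phi1 & phi2 & Hr & (H1 & H2) & N & M & X).
  destruct G1 as (Hk1 & _). destruct G2 as (Hk2 & _).
  assert (Z : Cmod 0%C < r) by (rewrite Cmod_0; auto).
  set (x1 := fun w => cpow (cexp w) k1). set (x2 := fun w => cpow (cexp w) k2).
  assert (T1 : tends x1 0%C) by now apply tends_cpow. assert (T2 : tends x2 0%C) by now apply tends_cpow.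
  assert (F1 := tends_at0 phi1 (H1 _ Z)). assert (F2 := tends_at0 phi2 (H2 _ Z)).
  assert (S1 := tends_at0 _ (psi_of_holo k1 r phi1 H1 _ Z)). assert (S2 := tends_at0 _ (psi_of_holo k2 r phi2 H2 _ Z)).
  assert (D := tends_minus _ _ _ _ (tends_plus _ _ _ _ (tends_const q1) (tends_mult _ _ _ _ T1 F1))
                 (tends_plus _ _ _ _ (tends_const q2) (tends_mult _ _ _ _ T2 F2))).
  assert (L := tends_mult _ _ _ _ (tends_mult _ _ _ _ T1 S1) (tends_mult _ _ _ _ T2 S2)).
  assert (Rr := tends_mult _ _ _ _ (tends_opp _ _ HQ) (tends_mult _ _ _ _ D D)).
  assert (EQ : (0 * psi_of k1 phi1 0%C * (0 * psi_of k2 phi2 0%C))%C =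
     (- q * ((q1 + 0 * phi1 0%C - (q2 + 0 * phi2 0%C)) * (q1 + 0 * phi1 0%C - (q2 + 0 * phi2 0%C))))%C).
  { eapply tends_unique; [exact L|]. eapply tends_ext; [|exact Rr].
    revert X. apply near_end_imp. intros w (F21 & F22 & _ & K1 & K2 & K3).
    symmetry. exact (frame_hopf _ _ _ _ _ _ _ K1 K2 K3). }
  assert (Nq : (q1 - q2)%C <> 0%C) by now apply Cminus_neq_0.
  apply (Cmult_neq_0 q ((q1 - q2) * (q1 - q2))%C Hq); [now apply Cmult_neq_0|].
  transitivity (- (- q * ((q1 + 0 * phi1 0%C - (q2 + 0 * phi2 0%C)) * (q1 + 0 * phi1 0%C - (q2 + 0 * phi2 0%C)))))%C; [ring|].
  rewrite <- EQ. ring.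
Qed.

(** Divide the Hopf identity by [z^(2 k1)]: for [k1 < k2] the left side tends to 0 and the right
    side to [- q phi1(0)^2]. *)
Lemma gauss_order_not_lt (k1 k2 : nat) (r : R) (phi1 phi2 : C -> C) (Q : C -> C) (q : C) :
  (0 < k1)%nat -> (0 < k2)%nat -> q <> 0%C -> tends Q q -> 0 < r -> holo0 r phi1 -> holo0 r phi2 ->
  phi1 0%C <> 0%C -> phi2 0%C <> 0%C ->
  near_end (fun w => let z := cexp w in
    (cpow z k1 * psi_of k1 phi1 z * (cpow z k2 * psi_of k2 phi2 z))%C =
    (- Q w * ((cpow z k1 * phi1 z - cpow z k2 * phi2 z) * (cpow z k1 * phi1 z - cpow z k2 * phi2 z)))%C) ->
  ~ (k1 < k2)%nat.
Proof.
  intros Hk1 Hk2 Hq HQ Hr H1 H2 N1 N2 X.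
  assert (Z : Cmod 0%C < r) by (rewrite Cmod_0; auto).
  assert (F1 := tends_at0 phi1 (H1 _ Z)). assert (F2 := tends_at0 phi2 (H2 _ Z)).
  assert (S1 := tends_at0 _ (psi_of_holo k1 r phi1 H1 _ Z)). assert (S2 := tends_at0 _ (psi_of_holo k2 r phi2 H2 _ Z)).
  intros Hlt.
  set (x := fun w => cpow (cexp w) (k2 - k1)).
  assert (T : tends x 0%C) by (apply tends_cpow; lia).
  assert (D := tends_minus _ _ _ _ F1 (tends_mult _ _ _ _ T F2)).
  assert (L := tends_mult _ _ _ _ T (tends_mult _ _ _ _ S1 S2)).
  assert (Rr := tends_mult _ _ _ _ (tends_opp _ _ HQ) (tends_mult _ _ _ _ D D)).
  assert (EQ := fun b => tends_unique (fun w => x w * (psi_of k1 phi1 (cexp w) * psi_of k2 phi2 (cexp w)))%C _ b L).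
  cut ((0 * (psi_of k1 phi1 0%C * psi_of k2 phi2 0%C))%C = (- q * ((phi1 0%C - 0 * phi2 0%C) * (phi1 0%C - 0 * phi2 0%C)))%C).
  + intros K. apply (Cmult_neq_0 q (phi1 0%C * phi1 0%C)%C Hq); [now apply Cmult_neq_0|].
    transitivity (- (- q * ((phi1 0%C - 0 * phi2 0%C) * (phi1 0%C - 0 * phi2 0%C))))%C; [ring|]. rewrite <- K. ring.
  + apply EQ. eapply tends_ext; [|exact Rr]. revert X. apply near_end_imp. intros w K. cbv zeta in K.
    assert (P : cpow (cexp w) k2 = (cpow (cexp w) k1 * x w)%C).
    { unfold x. rewrite <- cpow_add. f_equal. lia. }
    assert (P0 : cpow (cexp w) k1 <> 0%C) by apply cpow_neq_0, cexp_neq_0.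
    rewrite P in K. set (y := cpow (cexp w) k1) in *.
    apply (f_equal (fun t => t / (y * y))%C) in K.
    transitivity ((- Q w * ((y * phi1 (cexp w) - y * x w * phi2 (cexp w)) * (y * phi1 (cexp w) - y * x w * phi2 (cexp w)))) / (y * y))%C; [field; auto|].
    rewrite <- K. field; auto.
Qed.

(** Unequal orders are excluded by [gauss_order_not_lt] in both directions. For equal orders [k],
    division by [z^(2 k)] gives [k^2 phi1(0) phi2(0) = - q (phi1(0) - phi2(0))^2], so the leading
    coefficients differ. *)
Lemma gauss_orders_agree (k1 k2 : nat) (r : R) (phi1 phi2 : C -> C) (Q : C -> C) (q : C) :
  (0 < k1)%nat -> (0 < k2)%nat -> q <> 0%C -> tends Q q -> 0 < r -> holo0 r phi1 -> holo0 r phi2 ->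
  phi1 0%C <> 0%C -> phi2 0%C <> 0%C ->
  near_end (fun w => let z := cexp w in
    (cpow z k1 * psi_of k1 phi1 z * (cpow z k2 * psi_of k2 phi2 z))%C =
    (- Q w * ((cpow z k1 * phi1 z - cpow z k2 * phi2 z) * (cpow z k1 * phi1 z - cpow z k2 * phi2 z)))%C) ->
  k1 = k2 /\ phi1 0%C <> phi2 0%C.
Proof.
  intros Hk1 Hk2 Hq HQ Hr H1 H2 N1 N2 X.
  assert (Z : Cmod 0%C < r) by (rewrite Cmod_0; auto).
  assert (F1 := tends_at0 phi1 (H1 _ Z)). assert (F2 := tends_at0 phi2 (H2 _ Z)).
  assert (S1 := tends_at0 _ (psi_of_holo k1 r phi1 H1 _ Z)). assert (S2 := tends_at0 _ (psi_of_holo k2 r phi2 H2 _ Z)).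
  destruct (Nat.lt_trichotomy k1 k2) as [Hlt|[Heq|Hlt]].
  - exfalso. now apply (gauss_order_not_lt k1 k2 r phi1 phi2 Q q).
  - subst k2. split; auto. intros E.
    assert (D := tends_minus _ _ _ _ F1 F2).
    assert (L := tends_mult _ _ _ _ S1 S2).
    assert (Rr := tends_mult _ _ _ _ (tends_opp _ _ HQ) (tends_mult _ _ _ _ D D)).
    assert (EQ := fun b => tends_unique (fun w => psi_of k1 phi1 (cexp w) * psi_of k1 phi2 (cexp w))%C _ b L).
    apply (Cmult_neq_0 (psi_of k1 phi1 0%C) (psi_of k1 phi2 0%C)).
    + rewrite psi_of_0. apply Cmult_neq_0; auto. now apply INR_neq_0.
    + rewrite psi_of_0. apply Cmult_neq_0; auto. now apply INR_neq_0.
    + rewrite (EQ (- q * ((phi1 0%C - phi2 0%C) * (phi1 0%C - phi2 0%C)))%C); [rewrite E; ring|].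
      eapply tends_ext; [|exact Rr]. revert X. apply near_end_imp. intros w K. cbv zeta in K.
      assert (P0 : cpow (cexp w) k1 <> 0%C) by apply cpow_neq_0, cexp_neq_0.
      set (y := cpow (cexp w) k1) in *. apply (f_equal (fun t => t / (y * y))%C) in K.
      transitivity ((- Q w * ((y * phi1 (cexp w) - y * phi2 (cexp w)) * (y * phi1 (cexp w) - y * phi2 (cexp w)))) / (y * y))%C; [field; auto|].
      rewrite <- K. field; auto.
  - exfalso. apply (gauss_order_not_lt k2 k1 r phi2 phi1 Q q); auto.
    revert X. apply near_end_imp. intros w K. cbv zeta in K |- *. rewrite Cmult_comm, K. ring.
Qed.

(** * Asymptotics and the flux matrix *)

(** At a finite value the ramification order is the vanishing order of [A] minus that value, and
    here it exceeds [n]. A pole contradicts the finite limit, and a constant [A] gives zero. *)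
Lemma indentation_asymptotics (A : C -> C) (l : option nat) (n : nat) (c : C) :
  tends (fun w => A (cexp w)) c -> ram_order A l -> opt_gt l n ->
  tends (fun w => (A (cexp w) - c) / cpow (cexp w) n)%C 0%C.
Proof.
  intros HA Hl Hn. destruct l as [k|]; simpl in Hn.
  - destruct (ram_order_sph _ _ Hl) as [Hk [[p|] Hp]].
    + rewrite (tends_unique _ _ _ HA (tends_sph_finite _ _ _ Hk Hp)).
      destruct (sph_order_finite _ _ _ Hp) as (r & phi & Hr & Hphi & _ & E).
      apply tends_ext with (fun w => cpow (cexp w) (k - n) * phi (cexp w))%C.
      * generalize (near_end_cexp r Hr). apply near_end_imp. intros w Z. rewrite E by auto.
        replace k with (n + (k - n))%nat at 2 by lia. rewrite cpow_add. field.
        apply cpow_neq_0, cexp_neq_0.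
      * eapply tends_eq; [apply tends_mult; [apply tends_cpow; lia|apply tends_at0, Hphi; now rewrite Cmod_0]|]. ring.
    + exfalso. now apply (sph_pole_not_tends A c k).
  - destruct Hl as [c' Hc']. rewrite (tends_unique _ _ _ HA (vanishes_tends _ _ Hc')).
    destruct Hc' as (r & Hr & E). apply tends_ext with (fun _ => RtoC 0); [|apply tends_const].
    generalize (near_end_cexp r Hr). apply near_end_imp. intros w Z. rewrite E by auto. field.
    apply cpow_neq_0, cexp_neq_0.
Qed.

Lemma holo0_comb (c : C) r phi1 phi2 : holo0 r phi1 -> holo0 r phi2 -> holo0 r (fun z => phi2 z - c * phi1 z)%C.
Proof. intros H1 H2 z Hz. apply ex_derive_C_minus; auto. apply ex_derive_C_mult; auto using ex_derive_C_const. Qed.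

Lemma psi_of_comb (n : nat) (c : C) r phi1 phi2 z : holo0 r phi1 -> holo0 r phi2 -> Cmod z < r ->
  psi_of n (fun z => phi2 z - c * phi1 z)%C z = (psi_of n phi2 z - c * psi_of n phi1 z)%C.
Proof.
  intros H1 H2 Hz. unfold psi_of.
  rewrite (is_C_derive_unique (fun z => phi2 z - c * phi1 z)%C z (C_derive phi2 z - c * C_derive phi1 z)%C); [ring|].
  eapply is_derive_C_eq.
  - apply is_derive_C_minus; [apply is_derive_C_correct, H2, Hz|apply is_derive_C_mult; [apply is_derive_C_const|apply is_derive_C_correct, H1, Hz]].
  - cbv beta. ring.
Qed.

(* Integrating [(z^n delta)' = z^(n-1) psi] along the segment from 0 to [z] transfers the vanishing order of [psi] to [delta]. *)
Lemma integrate_vanishing (n : nat) (r : R) (delta : C -> C) : (0 < n)%nat -> 0 < r -> holo0 r delta ->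
  psi_of n delta 0%C = 0%C ->
  tends (fun w => psi_of n delta (cexp w) / cpow (cexp w) n)%C 0%C ->
  tends (fun w => delta (cexp w) / cpow (cexp w) n)%C 0%C.
Proof.
  intros Hn Hr Hd H0 HT eps He.
  destruct (near_end_and _ _ (HT (eps / 2) ltac:(lra)) (near_end_cexp r Hr)) as (a & Ha & K).
  exists a. split; auto. intros w Hw. destruct (K w Hw) as [_ Z].
  (* The hypothesis bounds [psi] only on a punctured disc, so [t = 0] uses [psi 0 = 0]. For [t > 0]
     the point [t z] is [exp (w + ln t)] with [ln t <= 0], still within the range of the bound. *)
  assert (Hb : forall t, 0 <= t <= 1 -> Cmod (psi_of n delta (RtoC t * cexp w)) <= eps / 2 * Cmod (cexp w) ^ n).
  { intros t Ht. destruct (Req_dec t 0) as [->|Ht0].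
    - replace (RtoC 0 * cexp w)%C with (RtoC 0) by ring. rewrite H0, Cmod_0.
      apply Rmult_le_pos; [lra|apply pow_le; lra].
    - set (w' := (w + RtoC (ln t))%C).
      assert (Ew : cexp w' = (RtoC t * cexp w)%C).
      { unfold w'. rewrite cexp_plus. replace (cexp (RtoC (ln t))) with (RtoC t); [ring|].
        unfold cexp, RtoC; simpl. rewrite exp_ln, cos_0, sin_0 by lra. f_equal; ring. }
      assert (Hl : ln t <= 0) by (rewrite <- ln_1; destruct (Req_dec t 1) as [->|]; [lra|left; apply ln_increasing; lra]).
      destruct (K w') as [K1 _]; [unfold w'; simpl; lra|]. rewrite Ew in K1.
      assert (N : cpow (RtoC t * cexp w)%C n <> 0%C) by (rewrite <- Ew; apply cpow_neq_0, cexp_neq_0).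
      set (P := psi_of n delta (RtoC t * cexp w)%C) in *. set (y := cpow (RtoC t * cexp w)%C n) in *.
      replace (P / y - 0)%C with (P / y)%C in K1 by ring. rewrite Cmod_div in K1 by auto.
      pose proof (proj1 (Cmod_gt_0 _) N) as Py.
      apply (Rmult_lt_compat_r (Cmod y)) in K1; auto.
      replace (Cmod P / Cmod y * Cmod y) with (Cmod P) in K1 by (field; lra).
      left. eapply Rlt_le_trans; [exact K1|]. apply Rmult_le_compat_l; [lra|].
      unfold y. rewrite Cmod_cpow, Cmod_mult, Cmod_R, Rabs_right by lra. apply pow_incr. split.
      + apply Rmult_le_pos; lra.
      + rewrite <- (Rmult_1_l (Cmod (cexp w))) at 2. apply Rmult_le_compat_r; lra. }
  set (z := cexp w) in *. set (M := Cmod z) in *.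
  set (D' := fun z => (cpow z (pred n) * psi_of n delta z)%C).
  assert (Hin : forall t, 0 <= t <= 1 -> Cmod (RtoC t * z) < r).
  { intros t Ht. rewrite Cmod_mult, Cmod_R, Rabs_right by lra. fold M. apply Rle_lt_trans with (1 * M); [|lra].
    apply Rmult_le_compat_r; lra. }
  assert (HD' : forall t, 0 <= t <= 1 -> ex_derive D' (RtoC t * z)%C).
  { intros t Ht. apply ex_derive_C_mult; [apply ex_derive_C_cpow|]. apply (psi_of_holo n r); auto. }
  assert (FTC : (z * CI (fun t => D' (RtoC t * z)) 0 1)%C = (cpow z n * delta z)%C).
  { rewrite (CI_derive_along_line (fun z => cpow z n * delta z)%C D' (fun t => RtoC t * z)%C z 0 1); [|lra| | |exact HD'].
    - replace (RtoC 1 * z)%C with z by ring. replace (RtoC 0 * z)%C with (RtoC 0) by ring.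
      destruct n; [lia|]. simpl. ring.
    - intros. rewrite RtoC_minus. ring.
    - intros t Ht. apply is_derive_C_monomial; auto. }
  (* The length [M] of the segment and the factor [M^(n-1)] of the integrand together match the
     [z^n] in front of [delta]. *)
  assert (B : Cmod (cpow z n * delta z) <= M * ((1 - 0) * (M ^ pred n * (eps / 2 * M ^ n)))).
  { rewrite <- FTC, Cmod_mult. fold M. apply Rmult_le_compat_l; [lra|]. apply CI_bound; [lra| |].
    - apply exCI_cont; [lra|]. intros t Ht. apply (ccont_comp D' (fun t => RtoC t * z)%C t M); auto.
      intros s. replace (RtoC s * z - RtoC t * z)%C with (z * RtoC (s - t))%C by (rewrite RtoC_minus; ring).
      rewrite Cmod_mult, Cmod_R. fold M. lra.
    - intros t Ht. unfold D'. rewrite Cmod_mult, Cmod_cpow. apply Rmult_le_compat; auto using Cmod_ge_0.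
      + apply pow_le, Cmod_ge_0.
      + apply pow_incr. split; [apply Cmod_ge_0|]. rewrite Cmod_mult, Cmod_R, Rabs_right by lra. fold M.
        rewrite <- (Rmult_1_l M) at 2. apply Rmult_le_compat_r; lra. }
  assert (N : cpow z n <> 0%C) by apply cpow_neq_0, cexp_neq_0.
  assert (PM : 0 < M ^ n) by (apply pow_lt; lra).
  replace (delta z / cpow z n - 0)%C with (delta z / cpow z n)%C by ring.
  rewrite Cmod_div by auto. rewrite Cmod_mult, Cmod_cpow in B. rewrite Cmod_cpow. fold M in B |- *.
  replace (M * ((1 - 0) * (M ^ pred n * (eps / 2 * M ^ n)))) with (M ^ n * (eps / 2 * M ^ n)) in B
    by (destruct n; [lia|]; simpl; ring).
  apply Rmult_le_reg_l in B; auto.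
  apply Rmult_lt_reg_r with (M ^ n); auto.
  replace (Cmod (delta z) / M ^ n * M ^ n) with (Cmod (delta z)) by (field; lra).
  apply Rle_lt_trans with (eps / 2 * M ^ n); auto. apply Rmult_lt_compat_r; lra.
Qed.

(** * Conjugation of the form and of its period by a frame *)

Lemma mmul_assoc (A B D : mat2) : mmul (mmul A B) D = mmul A (mmul B D).
Proof. apply mat2_ext; unfold mmul; simpl; ring. Qed.
Lemma madj_mmul (A B : mat2) : madj (mmul A B) = mmul (madj B) (madj A).
Proof. apply mat2_ext; unfold mmul, madj; simpl; ring. Qed.

(** For [det u = 1] this is conjugation by [u]; written with the adjugate it is visibly linear in
    [P], with coefficients polynomial in [u]. *)
Definition conj_by (u P : mat2) : mat2 := mmul (mmul u P) (madj u).

Lemma frame_log_deriv (E : C -> mat2) (u : mat2) (w : C) : flat_front_end E -> Omega w ->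
  conj_by u (log_deriv E w) =
  mmul (mmul (mmul u (E w)) (Mat2 0 (theta_hat E w) (omega_hat E w) 0)%C) (madj (mmul u (E w))).
Proof.
  intros HE Hw. destruct (legendrian_ode E w HE Hw) as (D1 & D2 & D3 & D4).
  assert (X : Ed E w = mmul (E w) (Mat2 0 (theta_hat E w) (omega_hat E w) 0)%C).
  { apply mat2_ext; unfold Ed, mmul; cbn [m11 m12 m21 m22]; [rewrite D1|rewrite D2|rewrite D3|rewrite D4]; ring. }
  unfold conj_by, log_deriv. rewrite X, madj_mmul, !mmul_assoc. reflexivity.
Qed.

(** After [om] and [th] are substituted, [F21] and [F22] occur in every entry only through
    [(F21 F22)^2], which [det F = 1] expresses by the Gauss maps. The entries thus depend on germs
    in [z] alone. *)
Lemma frame_log_deriv_entries (x ph1 ph2 ps1 ps2 om th F21 F22 : C) :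
  x <> 0%C -> (ph1 - ph2)%C <> 0%C ->
  ((x * ph1 - x * ph2) * (F21 * F22))%C = 1%C -> (- om)%C = (x * ps1 * (F21 * F21))%C -> th = (x * ps2 * (F22 * F22))%C ->
  let F := Mat2 (x * ph1 * F21)%C (x * ph2 * F22)%C F21 F22 in
  mmul (mmul F (Mat2 0 th om 0)%C) (madj F) =
  Mat2 (- (ps1 * ph2 + ps2 * ph1) / ((ph1 - ph2) * (ph1 - ph2)))%C
       (x * (ph2 * ph2 * ps1 + ph1 * ph1 * ps2) / ((ph1 - ph2) * (ph1 - ph2)))%C
       (- (ps1 + ps2) / (x * ((ph1 - ph2) * (ph1 - ph2))))%C
       ((ps1 * ph2 + ps2 * ph1) / ((ph1 - ph2) * (ph1 - ph2)))%C.
Proof.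
  intros Hx Hp HD Hom Hth F.
  assert (HK : (F21 * F22)%C = (/ (x * (ph1 - ph2)))%C).
  { transitivity ((x * ph1 - x * ph2) * (F21 * F22) / (x * (ph1 - ph2)))%C; [field; auto|].
    rewrite HD. field; auto. }
  assert (Hom' : om = (- (x * ps1 * (F21 * F21)))%C) by (rewrite <- Hom; ring).
  subst om th. unfold F. apply mat2_ext; unfold mmul, madj; cbn [m11 m12 m21 m22].
  - transitivity (- (x * x * (ps1 * ph2 + ps2 * ph1) * ((F21 * F22) * (F21 * F22))))%C; [ring|]. rewrite HK. field; auto.
  - transitivity (x * x * x * (ph2 * ph2 * ps1 + ph1 * ph1 * ps2) * ((F21 * F22) * (F21 * F22)))%C; [ring|]. rewrite HK. field; auto.
  - transitivity (- (x * (ps1 + ps2) * ((F21 * F22) * (F21 * F22))))%C; [ring|]. rewrite HK. field; auto.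
  - transitivity (x * x * (ps1 * ph2 + ps2 * ph1) * ((F21 * F22) * (F21 * F22)))%C; [ring|]. rewrite HK. field; auto.
Qed.

(** With [a = ps2 / ps1] and [b = ph2 / ph1] the entry is [- (ps1 / (x ph1^2)) (1 + a) / (1 - b)^2],
    and the subtracted term is its value at [a = b = c]. The numerator of the difference of the last
    factors is [(a - c) (1 - c)^2 + (1 + c) (b - c) (2 - c - b)], so the pole [1 / x] is absorbed by
    [(a - c) / x] and [(b - c) / x]. *)
Lemma offdiagonal_expansion (x ph1 ph2 ps1 ps2 c : C) :
  x <> 0%C -> ph1 <> 0%C -> ps1 <> 0%C -> (ph1 - ph2)%C <> 0%C -> (1 - c)%C <> 0%C ->
  (- (ps1 + ps2) / (x * ((ph1 - ph2) * (ph1 - ph2)))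
     - (- ((1 + c) / ((1 - c) * (1 - c))) * (x * ps1) / ((x * ph1) * (x * ph1))))%C =
  (- (ps1 / (ph1 * ph1)) * ((ps2 / ps1 - c) / x * ((1 - c) * (1 - c))
      + (1 + c) * ((ph2 / ph1 - c) / x) * (2 - c - ph2 / ph1))
     / (((1 - ph2 / ph1) * (1 - ph2 / ph1)) * ((1 - c) * (1 - c))))%C.
Proof. intros. field. repeat split; auto. Qed.

Lemma ex_derive_C_lin4 (c1 c2 c3 c4 : C) (p1 p2 p3 p4 : C -> C) (w : C) :
  ex_derive p1 w -> ex_derive p2 w -> ex_derive p3 w -> ex_derive p4 w ->
  ex_derive (fun w => c1 * p1 w + c2 * p2 w + c3 * p3 w + c4 * p4 w)%C w.
Proof.
  intros H1 H2 H3 H4.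
  assert (S : forall (c : C) p, ex_derive p w -> ex_derive (fun w => c * p w)%C w)
    by (intros; apply ex_derive_C_mult; [apply ex_derive_C_const|assumption]).
  exact (ex_derive_C_plus _ _ w (ex_derive_C_plus _ _ w (ex_derive_C_plus _ _ w (S c1 p1 H1) (S c2 p2 H2)) (S c3 p3 H3)) (S c4 p4 H4)).
Qed.

Lemma vint_lin4 (c1 c2 c3 c4 : C) (p1 p2 p3 p4 : C -> C) (x : R) :
  (forall t, ex_derive p1 (x, t)) -> (forall t, ex_derive p2 (x, t)) ->
  (forall t, ex_derive p3 (x, t)) -> (forall t, ex_derive p4 (x, t)) ->
  vint (fun w => c1 * p1 w + c2 * p2 w + c3 * p3 w + c4 * p4 w)%C x =
  (c1 * vint p1 x + c2 * vint p2 x + c3 * vint p3 x + c4 * vint p4 x)%C.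
Proof.
  intros H1 H2 H3 H4. unfold vint. pose proof PI_RGT_0.
  assert (X : forall p : C -> C, (forall t, ex_derive p (x, t)) -> exCI (fun t => p (x, t)) 0 (2 * PI))
    by (intros; apply exCI_vert; [lra|auto]).
  assert (Y := X p1 H1). assert (Y2 := X p2 H2). assert (Y3 := X p3 H3). assert (Y4 := X p4 H4).
  assert (S1 := exCI_scal _ _ _ c1 Y). assert (S2 := exCI_scal _ _ _ c2 Y2).
  assert (S3 := exCI_scal _ _ _ c3 Y3). assert (S4 := exCI_scal _ _ _ c4 Y4).
  assert (S12 := exCI_plus _ _ _ _ S1 S2). assert (S123 := exCI_plus _ _ _ _ S12 S3).
  rewrite (CI_plus _ _ _ _ S123 S4), (CI_plus _ _ _ _ S12 S3), (CI_plus _ _ _ _ S1 S2).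
  rewrite !CI_scal by assumption. reflexivity.
Qed.

Lemma vint_ext (p p' : C -> C) (x : R) : (forall w, p w = p' w) -> vint p x = vint p' x.
Proof.
  intros H. unfold vint. apply (CI_ext (fun t => p (x, t)) (fun t => p' (x, t))); [pose proof PI_RGT_0; lra|].
  intros; apply H.
Qed.

(** Such functionals commute with the period integral and preserve holomorphy; every entry of
    [conj_by u] is one of them. *)
Definition mlin (L : mat2 -> C) (c1 c2 c3 c4 : C) : Prop :=
  forall P, L P = (c1 * m11 P + c2 * m12 P + c3 * m21 P + c4 * m22 P)%C.

Lemma vint_mlin (E : C -> mat2) (L : mat2 -> C) c1 c2 c3 c4 x : flat_front_end E -> x < 0 -> mlin L c1 c2 c3 c4 ->
  vint (fun w => L (log_deriv E w)) x = L (mvint (log_deriv E) x).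
Proof.
  intros HE Hx HL. rewrite HL. unfold mvint. cbn [m11 m12 m21 m22].
  rewrite (vint_ext _ _ x (fun w => HL (log_deriv E w))).
  assert (D := fun t => ex_derive_C_log_deriv E (x, t) HE Hx).
  apply (vint_lin4 c1 c2 c3 c4 (fun w => m11 (log_deriv E w)) (fun w => m12 (log_deriv E w))
    (fun w => m21 (log_deriv E w)) (fun w => m22 (log_deriv E w))); intros t; apply (D t).
Qed.

Lemma ex_derive_C_mlin (E : C -> mat2) (L : mat2 -> C) c1 c2 c3 c4 w : flat_front_end E -> mlin L c1 c2 c3 c4 -> Omega w ->
  ex_derive (fun w => L (log_deriv E w)) w.
Proof.
  intros HE HL Hw. destruct (ex_derive_C_log_deriv E w HE Hw) as (D1 & D2 & D3 & D4).
  destruct (ex_derive_C_lin4 c1 c2 c3 c4 _ _ _ _ w D1 D2 D3 D4) as [l Hl].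
  exists l. apply (is_derive_C_ext _ _ w l (fun y => eq_sym (HL (log_deriv E y)))). exact Hl.
Qed.

Lemma conj_by_mlin (u : mat2) :
  mlin (fun P => m11 (conj_by u P)) (m11 u * m22 u) (- (m11 u * m21 u)) (m12 u * m22 u) (- (m12 u * m21 u)) /\
  mlin (fun P => m12 (conj_by u P)) (- (m11 u * m12 u)) (m11 u * m11 u) (- (m12 u * m12 u)) (m12 u * m11 u) /\
  mlin (fun P => m21 (conj_by u P)) (m21 u * m22 u) (- (m21 u * m21 u)) (m22 u * m22 u) (- (m22 u * m21 u)) /\
  mlin (fun P => m22 (conj_by u P)) (- (m21 u * m12 u)) (m21 u * m11 u) (- (m22 u * m12 u)) (m22 u * m11 u).
Proof. repeat split; intros P; unfold conj_by, mmul, madj; cbn [m11 m12 m21 m22]; ring. Qed.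

(* [L'] is the derivative of a function of [z = exp w], so it does not contribute to the period. *)
Lemma mlin_period (E : C -> mat2) (L : mat2 -> C) c1 c2 c3 c4 (p p' : C -> C) (a x : R) (l : C) :
  flat_front_end E -> mlin L c1 c2 c3 c4 -> x < 0 -> a < 0 ->
  (forall w, fst w < a -> is_derive (fun w => p (cexp w)) w (p' w)) -> (forall w, fst w < a -> ex_derive p' w) ->
  tends (fun w => L (log_deriv E w) - p' w)%C l ->
  L (mvint (log_deriv E) x) = (RtoC (2 * PI) * l)%C.
Proof.
  intros HE HL Hx Ha Hp Hp' HT. rewrite <- (vint_mlin E L c1 c2 c3 c4 x) by auto.
  apply (vint_limit _ (fun w => p (cexp w)) p' a); auto.
  - intros w Hw. now apply (ex_derive_C_mlin E L c1 c2 c3 c4).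
  - intros w Hw. now rewrite log_deriv_periodic.
  - intros w _. now rewrite cexp_period.
Qed.

(** Three entries of the conjugated form have limits at the end, which determine their periods
    directly. The lower left entry needs its polar part removed, and only there is the bound on the
    indentation number used. *)
Lemma mvint_diagonal (E : C -> mat2) (g gs : C -> C) (G0 : sphere) (n : nat) (u : mat2) (q : C) (l : option nat) (x : R) :
  flat_front_end E -> q <> 0%C -> tends (fun w => omega_hat E w * theta_hat E w)%C q ->
  forall k1 k2, Nat.min k1 k2 = n ->
  germ_of (fun x => m11 (E x)) (fun x => m21 (E x)) g G0 k1 ->
  germ_of (fun x => m12 (E x)) (fun x => m22 (E x)) gs G0 k2 ->
  mdet u = 1%C -> mob_rel u G0 (Some (RtoC 0)) ->
  ram_order (A_fun u g gs) l -> opt_gt l n -> x < 0 ->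
  exists mu : C, mu <> 0%C /\ conj_by u (mvint (log_deriv E) x) = Mat2 mu 0%C 0%C (- mu)%C.
Proof.
  intros HE Hq HQ k1 k2 Hn G1 G2 Hd Hu Hl Hgt Hx.
  destruct (frame_pair E g gs G0 G0 k1 k2 u _ _ HE G1 G2 Hd Hu Hu) as (r & ph1 & ph2 & Hr & (H1 & H2) & N & M & X).
  destruct G1 as (Hk1 & _). destruct G2 as (Hk2 & _).
  assert (Z : Cmod 0%C < r) by (rewrite Cmod_0; auto).
  destruct (N _ Z) as (N1 & N2 & _).
  destruct (gauss_orders_agree k1 k2 r ph1 ph2 _ q Hk1 Hk2 Hq HQ Hr H1 H2 N1 N2) as [Ek N12].
  { revert X. apply near_end_imp. intros w (F21 & F22 & _ & K1 & K2 & K3). cbv zeta.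
    replace (cpow (cexp w) k1 * ph1 (cexp w) - cpow (cexp w) k2 * ph2 (cexp w))%C
      with (0 + cpow (cexp w) k1 * ph1 (cexp w) - (0 + cpow (cexp w) k2 * ph2 (cexp w)))%C by ring.
    exact (frame_hopf _ _ _ _ _ _ _ K1 K2 K3). }
  subst k2. rewrite Nat.min_id in Hn. subst k1. clear Hk2.
  set (ps1 := psi_of n ph1) in *. set (ps2 := psi_of n ph2) in *.
  assert (P1 : holo0 r ps1) by now apply psi_of_holo. assert (P2 : holo0 r ps2) by now apply psi_of_holo.
  assert (Hn0 : RtoC (INR n) <> 0%C) by now apply INR_neq_0.
  assert (Z1 : ps1 0%C = (RtoC (INR n) * ph1 0%C)%C) by apply psi_of_0.
  assert (Z2 : ps2 0%C = (RtoC (INR n) * ph2 0%C)%C) by apply psi_of_0.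
  assert (F1 := tends_at0 ph1 (H1 _ Z)). assert (F2 := tends_at0 ph2 (H2 _ Z)).
  assert (S1 := tends_at0 ps1 (P1 _ Z)). assert (S2 := tends_at0 ps2 (P2 _ Z)).
  assert (Nps1 : ps1 0%C <> 0%C) by apply (N _ Z).
  (* The limit of [Hs / H]. Since [psi 0 = n phi 0] for both germs, it is also the limit of
     [Hs' / H'], that is of [A_fun]. *)
  set (c := (ph2 0%C / ph1 0%C)%C).
  assert (Hc1 : (1 - c)%C <> 0%C).
  { replace (1 - c)%C with ((ph1 0%C - ph2 0%C) / ph1 0%C)%C by (unfold c; field; auto).
    apply Cmult_neq_0; [now apply Cminus_neq_0|now apply Cinv_neq_0]. }
  assert (X1 := tends_cpow n Hk1).
  assert (EA : forall z, 0 < Cmod z < r -> A_fun u g gs z = (ps2 z / ps1 z)%C).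
  { intros z Hz. destruct (N z ltac:(lra)) as (_ & _ & N3 & _).
    assert (D : forall h ph, holo0 r ph -> (forall z, 0 < Cmod z < r -> mob u h z = (0 + cpow z n * ph z)%C) ->
       C_derive (mob u h) z = (cpow z (pred n) * psi_of n ph z)%C).
    { intros h ph Hph Hm. apply is_C_derive_unique.
      apply (is_derive_C_loc (fun z => cpow z n * ph z)%C (mob u h) z _ (Rmin (Cmod z) (r - Cmod z))); [apply Rmin_pos; lra| |].
      - intros y Hy. pose proof (Rmin_l (Cmod z) (r - Cmod z)). pose proof (Rmin_r (Cmod z) (r - Cmod z)).
        pose proof (Cmod_triangle (y - z) z) as T. replace (y - z + z)%C with y in T by ring.
        pose proof (Cmod_triangle (z - y) y) as T'. replace (z - y + y)%C with z in T' by ring.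
        rewrite (Cmod_minus_sym z y) in T'. rewrite Hm by lra. ring.
      - apply is_derive_C_monomial; auto. apply Hph; lra. }
    unfold A_fun. rewrite (D g ph1 H1 (fun z Hz => proj1 (M z Hz))), (D gs ph2 H2 (fun z Hz => proj2 (M z Hz))).
    fold ps1 ps2. field. split; auto. apply cpow_neq_0, Cmod_pos_neq; lra. }
  assert (TA0 : tends (fun w => A_fun u g gs (cexp w)) c).
  { apply tends_ext with (fun w => ps2 (cexp w) / ps1 (cexp w))%C.
    - generalize (near_end_cexp r Hr). apply near_end_imp. intros w Hw. now rewrite EA.
    - eapply tends_eq; [apply tends_div; [exact Nps1|exact S2|exact S1]|].
      rewrite Z1, Z2. unfold c. field. auto. }
  assert (TA : tends (fun w => (ps2 (cexp w) / ps1 (cexp w) - c) / cpow (cexp w) n)%C 0%C).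
  { eapply tends_ext; [|exact (indentation_asymptotics _ l n c TA0 Hl Hgt)].
    generalize (near_end_cexp r Hr). apply near_end_imp. intros w Hw. now rewrite EA. }
  assert (TB : tends (fun w => (ph2 (cexp w) / ph1 (cexp w) - c) / cpow (cexp w) n)%C 0%C).
  (* [z^n delta] is [Hs - c H], whose derivative is controlled by [TA]. *)
  { set (delta := fun z => (ph2 z - c * ph1 z)%C).
    assert (Ps : forall z, Cmod z < r -> psi_of n delta z = (ps2 z - c * ps1 z)%C)
      by (intros; now apply (psi_of_comb n c r)).
    assert (Td : tends (fun w => delta (cexp w) / cpow (cexp w) n)%C 0%C).
    { apply (integrate_vanishing n r); auto.
      - now apply holo0_comb.
      - rewrite Ps by auto. rewrite Z1, Z2. unfold c. field; auto.
      - apply tends_ext with (fun w => (ps2 (cexp w) / ps1 (cexp w) - c) / cpow (cexp w) n * ps1 (cexp w))%C.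
        + generalize (near_end_cexp r Hr). apply near_end_imp. intros w Hw. rewrite Ps by lra.
          destruct (N (cexp w) ltac:(lra)) as (_ & _ & N3 & _). field. split; auto. apply cpow_neq_0, cexp_neq_0.
        + eapply tends_eq; [apply tends_mult; [exact TA|exact S1]|]. ring. }
    apply tends_ext with (fun w => delta (cexp w) / cpow (cexp w) n * / ph1 (cexp w))%C.
    - generalize (near_end_cexp r Hr). apply near_end_imp. intros w Hw.
      destruct (N (cexp w) ltac:(lra)) as (N3 & _). unfold delta. field. split; auto. apply cpow_neq_0, cexp_neq_0.
    - eapply tends_eq; [apply tends_mult; [exact Td|apply tends_inv; [exact N1|exact F1]]|]. ring. }
  assert (TD := tends_minus _ _ _ _ F1 F2).
  assert (N12' : (ph1 0%C - ph2 0%C)%C <> 0%C) by now apply Cminus_neq_0.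
  assert (ENT : near_end (fun w => (ph1 (cexp w) - ph2 (cexp w))%C <> 0%C /\ 0 < Cmod (cexp w) < r /\
     conj_by u (log_deriv E w) =
     let z := cexp w in let D2 := ((ph1 z - ph2 z) * (ph1 z - ph2 z))%C in
     Mat2 (- (ps1 z * ph2 z + ps2 z * ph1 z) / D2)%C
       (cpow z n * (ph2 z * ph2 z * ps1 z + ph1 z * ph1 z * ps2 z) / D2)%C
       (- (ps1 z + ps2 z) / (cpow z n * D2))%C
       ((ps1 z * ph2 z + ps2 z * ph1 z) / D2)%C)).
  { generalize (near_end_and _ _ (near_end_and _ _ near_end_Omega (near_end_cexp r Hr)) (near_end_and _ _ X (tends_neq _ _ 0%C TD N12'))). apply near_end_imp.
    intros w [[O Hz] [(F21 & F22 & K0 & K1 & K2 & K3) ND]]. split; auto. split; auto.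
    rewrite frame_log_deriv, K0 by auto. cbv zeta. rewrite !Cplus_0_l. rewrite !Cplus_0_l in K1.
    apply (frame_log_deriv_entries _ _ _ _ _ (omega_hat E w) (theta_hat E w) F21 F22); auto.
    apply cpow_neq_0, cexp_neq_0. }
  (* By [psi 0 = n phi 0] this equals [2 n ph1(0) ph2(0) / (ph1(0) - ph2(0))^2], which is
     nonzero. *)
  set (ell := ((ps1 0%C * ph2 0%C + ps2 0%C * ph1 0%C) / ((ph1 0%C - ph2 0%C) * (ph1 0%C - ph2 0%C)))%C).
  assert (Tell : tends (fun w => (ps1 (cexp w) * ph2 (cexp w) + ps2 (cexp w) * ph1 (cexp w)) /
       ((ph1 (cexp w) - ph2 (cexp w)) * (ph1 (cexp w) - ph2 (cexp w))))%C ell).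
  { apply tends_div; [now apply Cmult_neq_0| |apply tends_mult; exact TD].
    apply tends_plus; apply tends_mult; assumption. }
  assert (Hell : ell <> 0%C).
  { replace ell with (2 * (RtoC (INR n) * (ph1 0%C * ph2 0%C)) / ((ph1 0%C - ph2 0%C) * (ph1 0%C - ph2 0%C)))%C
      by (unfold ell; rewrite Z1, Z2; field; auto).
    apply Cmult_neq_0; [|apply Cinv_neq_0; now apply Cmult_neq_0].
    apply Cmult_neq_0; [apply C_neq_of_fst; simpl; lra|]. repeat apply Cmult_neq_0; auto. }
  destruct (conj_by_mlin u) as (L11 & L12 & L21 & L22).
  (* An entry with a finite limit requires no correction, so the subtracted primitive is zero. *)
  assert (PZ : forall L c1 c2 c3 c4 (v : C), mlin L c1 c2 c3 c4 -> tends (fun w => L (log_deriv E w)) v ->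
     L (mvint (log_deriv E) x) = (RtoC (2 * PI) * v)%C).
  { intros L c1 c2 c3 c4 v HL HT.
    apply (mlin_period E L c1 c2 c3 c4 (fun _ => RtoC 0) (fun _ => RtoC 0) (-1)); auto; try lra.
    - intros; apply is_derive_C_const.
    - intros; apply ex_derive_C_const.
    - eapply tends_eq; [apply tends_minus; [exact HT|apply tends_const]|]. ring. }
  assert (V11 := PZ _ _ _ _ _ (- ell)%C L11). assert (V22 := PZ _ _ _ _ _ ell L22). assert (V12 := PZ _ _ _ _ _ (RtoC 0) L12).
  assert (V21 : m21 (conj_by u (mvint (log_deriv E) x)) = (RtoC (2 * PI) * 0)%C).
  (* Putting [Hs = c H] and [Hs' = c H'] turns the entry into [- kap H' / H^2], the derivative of
     [kap / H]. *)
  { set (kap := ((1 + c) / ((1 - c) * (1 - c)))%C).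
    destruct (near_end_cexp r Hr) as (a & Ha & Hza).
    assert (Nx : forall w, fst w < a -> (cpow (cexp w) n * ph1 (cexp w))%C <> 0%C).
    { intros w Hw. apply Cmult_neq_0; [apply cpow_neq_0, cexp_neq_0|]. apply (N (cexp w)). apply Hza; auto. }
    assert (De : forall w, ex_derive cexp w) by (intros; eexists; apply is_derive_cexp).
    assert (Dx : forall w, ex_derive (fun w => cpow (cexp w) n) w)
      by (intros; apply (ex_derive_C_comp (fun z => cpow z n) cexp); auto using ex_derive_C_cpow).
    apply (mlin_period E _ _ _ _ _ (fun z => kap / (cpow z n * ph1 z))%C
      (fun w => - kap * (cpow (cexp w) n * ps1 (cexp w)) / ((cpow (cexp w) n * ph1 (cexp w)) * (cpow (cexp w) n * ph1 (cexp w))))%C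
      a x (RtoC 0) HE L21 Hx Ha).
    - intros w Hw. eapply is_derive_C_eq.
      + apply (is_derive_C_div (fun _ => kap) (fun w => cpow (cexp w) n * ph1 (cexp w))%C); [now apply Nx|apply is_derive_C_const|].
        apply (is_derive_C_ext (fun w => 0 + cpow (cexp w) n * ph1 (cexp w))%C); [intros; apply Cplus_0_l|].
        apply is_derive_C_monomial_cexp; auto. apply H1, Hza, Hw.
      + cbv beta. fold ps1. set (y := (cpow (cexp w) n * ph1 (cexp w))%C).
        assert (Hy : y <> 0%C) by now apply Nx. unfold ps1. field. auto.
    - intros w Hw. apply ex_derive_C_div; [apply Cmult_neq_0; now apply Nx| |].
      + apply ex_derive_C_mult; [apply ex_derive_C_const|]. apply ex_derive_C_mult; [apply Dx|].
        apply (ex_derive_C_comp ps1 cexp); auto. apply P1, Hza, Hw.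
      + assert (ex_derive (fun w => cpow (cexp w) n * ph1 (cexp w))%C w); [|now apply ex_derive_C_mult].
        apply ex_derive_C_mult; [apply Dx|]. apply (ex_derive_C_comp ph1 cexp); auto. apply H1, Hza, Hw.
    - assert (B : tends (fun w => ph2 (cexp w) / ph1 (cexp w))%C c) by (apply tends_div; assumption).
      assert (T : tends (fun w => - (ps1 (cexp w) / (ph1 (cexp w) * ph1 (cexp w))) *
          ((ps2 (cexp w) / ps1 (cexp w) - c) / cpow (cexp w) n * ((1 - c) * (1 - c))
          + (1 + c) * ((ph2 (cexp w) / ph1 (cexp w) - c) / cpow (cexp w) n) * (2 - c - ph2 (cexp w) / ph1 (cexp w)))
          / (((1 - ph2 (cexp w) / ph1 (cexp w)) * (1 - ph2 (cexp w) / ph1 (cexp w))) * ((1 - c) * (1 - c))))%C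
         (- (ps1 0 / (ph1 0 * ph1 0)) * (0 * ((1 - c) * (1 - c)) + (1 + c) * 0 * (2 - c - c))
          / (((1 - c) * (1 - c)) * ((1 - c) * (1 - c))))%C).
      { assert (TC := fun d : C => tends_const d).
        apply tends_div; [repeat apply Cmult_neq_0; auto| |].
        - apply tends_mult; [apply tends_opp, tends_div; [now apply Cmult_neq_0|exact S1|apply tends_mult; exact F1]|].
          apply tends_plus; [apply tends_mult; [exact TA|apply TC]|].
          apply tends_mult; [apply tends_mult; [apply TC|exact TB]|apply tends_minus; [apply TC|exact B]].
        - apply tends_mult; [apply tends_mult; (apply tends_minus; [apply TC|exact B])|apply TC]. }
      apply (fun H => tends_ext _ _ _ H (tends_eq _ _ (RtoC 0) T ltac:(field; auto))).
      revert ENT. apply near_end_imp. intros w (ND & Hz & ->). cbv zeta. cbn [m21].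
      destruct (N (cexp w) ltac:(lra)) as (N3 & N4 & N5 & N6). symmetry.
      apply (offdiagonal_expansion (cpow (cexp w) n) (ph1 (cexp w)) (ph2 (cexp w)) (ps1 (cexp w)) (ps2 (cexp w)) c); auto.
      apply cpow_neq_0, cexp_neq_0. }
  exists (RtoC (2 * PI) * - ell)%C. split.
  { apply Cmult_neq_0; [apply C_neq_of_fst; simpl; pose proof PI_RGT_0; lra|].
    intros K. apply Hell. replace ell with (- - ell)%C by ring. rewrite K. ring. }
  apply mat2_ext; cbn [m11 m12 m21 m22].
  - apply V11. eapply tends_ext; [|exact (tends_opp _ _ Tell)]. revert ENT. apply near_end_imp.
    intros w (ND & Hz & ->). cbn [m11]. field. auto.
  - rewrite V12; [ring|].
    assert (T : tends (fun w => cpow (cexp w) n * (ph2 (cexp w) * ph2 (cexp w) * ps1 (cexp w) +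
        ph1 (cexp w) * ph1 (cexp w) * ps2 (cexp w)) / ((ph1 (cexp w) - ph2 (cexp w)) * (ph1 (cexp w) - ph2 (cexp w))))%C
       (0 * (ph2 0 * ph2 0 * ps1 0 + ph1 0 * ph1 0 * ps2 0) / ((ph1 0 - ph2 0) * (ph1 0 - ph2 0)))%C).
    { apply tends_div; [now apply Cmult_neq_0| |apply tends_mult; exact TD].
      apply tends_mult; [exact X1|].
      apply tends_plus; (apply tends_mult; [apply tends_mult|]); assumption. }
    apply (fun H => tends_ext _ _ _ H (tends_eq _ _ (RtoC 0) T ltac:(field; auto))).
    revert ENT. apply near_end_imp. intros w (ND & Hz & ->). reflexivity.
  - rewrite V21. ring.
  - rewrite V22; [ring|]. eapply tends_ext; [|exact Tell]. revert ENT. apply near_end_imp.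
    intros w (ND & Hz & ->). cbn [m22]. reflexivity.
Qed.

(** * From the diagonal form of the flux to its axis *)

(** The maps are [(z - b) / (z - a)] scaled to determinant 1, [1 / (a - z)] when [G0] is infinity,
    and [z - b] when [s] is infinity. Such a [u] is admissible in the definition of
    [indentation]. *)
Lemma mob_normalization (s G0 : sphere) : s <> G0 ->
  exists u, mdet u = 1%C /\ mob_rel u s None /\ mob_rel u G0 (Some (RtoC 0)).
Proof.
  intros Hne. assert (N1 : RtoC 1 <> 0%C) by (apply C_neq_of_fst; simpl; lra).
  assert (Nm : (- (1))%C <> 0%C) by (apply C_neq_of_fst; simpl; lra).
  destruct s as [a|], G0 as [b|]; [| | |contradiction].
  - assert (H : (b - a)%C <> 0%C) by (apply Cminus_neq_0; congruence).
    exists (Mat2 (/ (b - a)) (- (b / (b - a))) 1 (- a))%C. unfold mdet, mob_rel; simpl.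
    split; [field; auto|]. split; [ring|]. replace (1 * b + - a)%C with (b - a)%C by ring.
    split; auto. field; auto.
  - exists (Mat2 0 1 (- (1)) a)%C. unfold mdet, mob_rel; simpl.
    split; [ring|]. split; [ring|]. split; auto. field.
  - exists (Mat2 1 (- b) 0 1)%C. unfold mdet, mob_rel; simpl.
    split; [ring|]. split; auto. replace (0 * b + 1)%C with (RtoC 1) by ring. split; auto. field.
Qed.

Lemma Cmult_integral (x y : C) : (x * y)%C = 0%C -> x = 0%C \/ y = 0%C.
Proof.
  intros H. destruct (Ceq_dec x 0%C) as [|Hx]; auto. destruct (Ceq_dec y 0%C) as [|Hy]; auto.
  exfalso. now apply (Cmult_neq_0 x y).
Qed.

Lemma conj_by_diag_inv (u M : mat2) (mu : C) : mdet u = 1%C -> conj_by u M = Mat2 mu 0%C 0%C (- mu)%C ->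
  mmul u M = mmul (Mat2 mu 0%C 0%C (- mu)%C) u.
Proof.
  intros Hd H. rewrite <- H. unfold conj_by. rewrite mmul_assoc.
  assert (I : mmul (madj u) u = Mat2 1%C 0%C 0%C 1%C).
  { unfold mdet in Hd. apply mat2_ext; unfold mmul, madj; cbn [m11 m12 m21 m22]; try ring; rewrite <- Hd; ring. }
  rewrite I. apply mat2_ext; unfold mmul; cbn [m11 m12 m21 m22]; ring.
Qed.

Lemma mvec_mmul (A B : mat2) (v : C * C) : mvec (mmul A B) v = mvec A (mvec B v).
Proof. unfold mvec, mmul; simpl. f_equal; ring. Qed.

Lemma mvec_inj (u : mat2) (v w : C * C) : mdet u = 1%C -> mvec u v = mvec u w -> v = w.
Proof.
  intros Hd H. destruct v as [x y], w as [x' y']. unfold mvec in H; cbn [fst snd] in H.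
  apply pair_equal_spec in H. destruct H as [H1 H2].
  unfold mdet in Hd. f_equal.
  - transitivity ((m11 u * m22 u - m12 u * m21 u) * x)%C; [rewrite Hd; ring|].
    transitivity (m22 u * (m11 u * x + m12 u * y) - m12 u * (m21 u * x + m22 u * y))%C; [ring|].
    rewrite H1, H2. transitivity ((m11 u * m22 u - m12 u * m21 u) * x')%C; [ring|rewrite Hd; ring].
  - transitivity ((m11 u * m22 u - m12 u * m21 u) * y)%C; [rewrite Hd; ring|].
    transitivity (m11 u * (m21 u * x + m22 u * y) - m21 u * (m11 u * x + m12 u * y))%C; [ring|].
    rewrite H1, H2. transitivity ((m11 u * m22 u - m12 u * m21 u) * y')%C; [ring|rewrite Hd; ring].
Qed.

(** The image [u v] is an eigenvector of [diag (mu, - mu)]; the eigenvalues differ as [mu <> 0], so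
    one coordinate of [u v] vanishes. *)
Lemma diag_eigvec (u M : mat2) (mu : C) (v : C * C) : mu <> 0%C ->
  mmul u M = mmul (Mat2 mu 0%C 0%C (- mu)%C) u -> eigvec M v ->
  (m11 u * fst v + m12 u * snd v)%C = 0%C \/ (m21 u * fst v + m22 u * snd v)%C = 0%C.
Proof.
  intros Hmu HM [Hv [lam Hl]].
  assert (E : mvec u (mvec M v) = mvec (Mat2 mu 0%C 0%C (- mu)%C) (mvec u v)) by now rewrite <- !mvec_mmul, HM.
  rewrite Hl in E. unfold mvec in E; cbn [fst snd m11 m12 m21 m22] in E.
  set (y1 := (m11 u * fst v + m12 u * snd v)%C) in *. set (y2 := (m21 u * fst v + m22 u * snd v)%C) in *.
  apply pair_equal_spec in E. destruct E as [E1 E2].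
  destruct (Ceq_dec y1 0%C) as [|H1]; [auto|right].
  assert (L : lam = mu).
  { destruct (Cmult_integral (lam - mu)%C y1) as [K|K]; [|  |contradiction].
    - transitivity (m11 u * (lam * fst v) + m12 u * (lam * snd v) - mu * y1)%C; [unfold y1; ring|]. rewrite E1. ring.
    - transitivity (lam - mu + mu)%C; [ring|rewrite K; ring]. }
  subst lam.
  (* With [lam = mu] the second coordinate satisfies [- mu y2 = mu y2]. *)
  destruct (Cmult_integral (2 * mu)%C y2) as [K|K]; auto.
  - transitivity (m21 u * (mu * fst v) + m22 u * (mu * snd v) + mu * y2)%C; [unfold y2; ring|]. rewrite E2. ring.
  - exfalso. revert K. apply Cmult_neq_0; auto. apply C_neq_of_fst; simpl; lra.
Qed.

(** [u] acts compatibly on vectors and on the ideal points they project to, so a vanishing second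
    coordinate of [u v] means that [p] is sent to infinity, like [s]. The second row of [u] is
    nonzero, hence determines that point. *)
Lemma proj_pole (u : mat2) (v : C * C) (p s : sphere) : mdet u = 1%C -> v <> (RtoC 0, RtoC 0) ->
  (m21 u * fst v + m22 u * snd v)%C = 0%C -> proj v p -> mob_rel u s None -> p = s.
Proof.
  intros Hd Hv H Hp Hs. unfold mdet in Hd. destruct v as [x y]; simpl in *.
  assert (NC : m21 u <> 0%C \/ m22 u <> 0%C).
  { destruct (Ceq_dec (m21 u) 0%C) as [K|]; auto. right. intros K'. rewrite K, K' in Hd.
    apply (f_equal fst) in Hd. simpl in Hd. lra. }
  destruct p as [z|], s as [z'|]; simpl in Hp, Hs; auto.
  - destruct Hp as [Hy Hz]. f_equal.
    destruct (Cmult_integral (m21 u) (z - z')%C) as [K|K].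
    + transitivity ((m21 u * x + m22 u * y) / y - (m21 u * z' + m22 u))%C; [rewrite Hz; field; auto|].
      rewrite H, Hs. field; auto.
    + exfalso. rewrite K in Hs. destruct NC as [NC|NC]; [auto|]. apply NC. rewrite <- Hs. ring.
    + transitivity (z - z' + z')%C; [ring|rewrite K; ring].
  - exfalso. destruct Hp as [Hy Hz]. rewrite Hs in H. destruct NC as [NC|NC]; auto.
    apply (Cmult_neq_0 _ _ NC Hy). rewrite <- H. ring.
  - exfalso. rewrite Hp in H. assert (Hx : x <> 0%C) by (intros ->; apply Hv; now rewrite Hp).
    destruct (Cmult_integral (m21 u) x) as [K|K]; auto; [rewrite <- H; ring|].
    rewrite K in Hs. destruct NC as [NC|NC]; [auto|]. apply NC. rewrite <- Hs. ring.
Qed.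

(** Multiplying [u] on the left by the matrix with rows [(0, -1)] and [(1, 0)] exchanges 0 and
    infinity, which reduces the claim to [proj_pole]. *)
Lemma proj_zero (u : mat2) (v : C * C) (p G0 : sphere) : mdet u = 1%C -> v <> (RtoC 0, RtoC 0) ->
  (m11 u * fst v + m12 u * snd v)%C = 0%C -> proj v p -> mob_rel u G0 (Some (RtoC 0)) -> p = G0.
Proof.
  intros Hd Hv H Hp HG.
  apply (proj_pole (Mat2 (- m21 u) (- m22 u) (m11 u) (m12 u))%C v); auto.
  - rewrite <- Hd. unfold mdet; simpl. ring.
  - destruct G0 as [z|]; simpl in *; destruct HG as [N E].
    + transitivity ((m11 u * z + m12 u) / (m21 u * z + m22 u) * (m21 u * z + m22 u))%C; [field; auto|]. rewrite <- E. ring.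
    + transitivity (m11 u / m21 u * m21 u)%C; [field; auto|]. rewrite <- E. ring.
Qed.

(** A geodesic is determined by its two ideal endpoints, so coincidence of the axes is equality of
    endpoint pairs up to order, for every choice of independent eigenvectors. The existence of such
    eigenvectors keeps the second part from being vacuous. *)
Theorem theorem2p11 (E : C -> mat2) (g gs : C -> C) (G0 s : sphere) (m : nat) (x0 : R) :
  flat_front_end E -> WCF_end E -> gauss_maps E g gs -> regular g gs ->
  dominant g gs -> centered E g gs ->
  mero_val g G0 -> multiplicity g gs m -> principal_axis_end g gs G0 m s ->
  x0 < 0 ->
  (exists v1 v2, eigvec (flux E x0) v1 /\ eigvec (flux E x0) v2 /\ lin_indep v1 v2) /\
  (forall v1 v2, eigvec (flux E x0) v1 -> eigvec (flux E x0) v2 -> lin_indep v1 v2 ->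
   forall p1 p2, proj v1 p1 -> proj v2 p2 ->
   (p1 = s /\ p2 = G0) \/ (p1 = G0 /\ p2 = s)).
Proof.
  intros HE _ Hg _ _ [(q & Hq & HQ) _] Hv Hm (Hs & (l & Hl & Hgt) & _) Hx.
  change (tends (fun w => omega_hat E w * theta_hat E w)%C q) in HQ.
  destruct (mob_normalization s G0 Hs) as (u & Hd & Us & UG).
  destruct (end_germs E g gs G0 m q HE Hg Hq HQ Hv Hm) as (k1 & k2 & p2 & G1 & G2 & Hmin).
  (* The second Gauss map also takes the value [G0], so a single condition on [u] sends both values
     to 0. *)
  rewrite <- (gauss_values_agree E g gs G0 p2 k1 k2 q HE Hq HQ G1 G2) in G2.
  destruct (mvint_diagonal E g gs G0 m u q l x0 HE Hq HQ k1 k2 Hmin G1 G2 Hd UG (Hl u Hd Us UG) Hgt Hx) as (mu0 & Hmu0 & HJ).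
  assert (H2pi : RtoC (2 * PI) <> 0%C) by (apply C_neq_of_fst; simpl; pose proof PI_RGT_0; lra).
  set (mu := (- / RtoC (2 * PI) * mu0)%C).
  assert (Hmu : mu <> 0%C).
  { intros K. apply Hmu0. transitivity (- RtoC (2 * PI) * mu)%C; [unfold mu; field; auto|]. rewrite K. ring. }
  assert (HF : conj_by u (flux E x0) = Mat2 mu 0%C 0%C (- mu)%C).
  { rewrite flux_eq by auto.
    transitivity (mscale (- / RtoC (2 * PI))%C (conj_by u (mvint (log_deriv E) x0))).
    - apply mat2_ext; unfold conj_by, mmul, mscale, madj; cbn [m11 m12 m21 m22]; ring.
    - rewrite HJ. apply mat2_ext; unfold mscale; cbn [m11 m12 m21 m22]; unfold mu; ring. }
  apply conj_by_diag_inv in HF; auto.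
  set (M := flux E x0) in *. split.
  (* The vectors are [u^{-1} (y1, y2)], written with the adjugate; the two coordinate vectors then
     give a basis of eigenvectors. *)
  - assert (V : forall y1 y2 lam : C, (y1, y2) <> (RtoC 0, RtoC 0) -> (mu * y1)%C = (lam * y1)%C -> (- mu * y2)%C = (lam * y2)%C ->
      eigvec M (m22 u * y1 - m12 u * y2, m11 u * y2 - m21 u * y1)%C).
    { intros y1 y2 lam Hy E1 E2. unfold mdet in Hd.
      assert (Y : mvec u (m22 u * y1 - m12 u * y2, m11 u * y2 - m21 u * y1)%C = (y1, y2)).
      { unfold mvec; simpl. f_equal.
        - transitivity ((m11 u * m22 u - m12 u * m21 u) * y1)%C; [ring|rewrite Hd; ring].
        - transitivity ((m11 u * m22 u - m12 u * m21 u) * y2)%C; [ring|rewrite Hd; ring]. }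
      split.
      - intros K. apply Hy. rewrite <- Y, K. unfold mvec; simpl. f_equal; ring.
      - exists lam. apply (mvec_inj u); auto. rewrite <- mvec_mmul, HF, mvec_mmul, Y.
        transitivity ((lam * y1)%C, (lam * y2)%C).
        + unfold mvec; simpl. f_equal; [rewrite <- E1|rewrite <- E2]; ring.
        + apply (f_equal (fun v => (lam * fst v, lam * snd v)%C)) in Y. simpl in Y.
          rewrite <- Y. unfold mvec; simpl. f_equal; ring. }
    assert (N1 : RtoC 1 <> 0%C) by (apply C_neq_of_fst; simpl; lra).
    exists (m22 u * 1 - m12 u * 0, m11 u * 0 - m21 u * 1)%C, (m22 u * 0 - m12 u * 1, m11 u * 1 - m21 u * 0)%C.
    split; [|split].
    + apply (V _ _ mu); [intros K; injection K; auto with real|ring|ring].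
    + apply (V _ _ (- mu)%C); [intros K; injection K; auto with real|ring|ring].
    + unfold lin_indep; simpl. unfold mdet in Hd. intros K. apply N1. rewrite <- Hd, <- K. ring.
  - intros v1 v2 E1 E2 Hi q1 q2 Q1 Q2.
    (* Two independent vectors cannot be annihilated by the same nonzero row. *)
    assert (L : forall a b : C, a <> 0%C \/ b <> 0%C -> (a * fst v1 + b * snd v1)%C = 0%C -> (a * fst v2 + b * snd v2)%C = 0%C -> False).
    { intros a b Hab K1 K2. unfold lin_indep in Hi. destruct Hab as [Ha|Hb].
      - apply (Cmult_neq_0 _ _ Ha Hi).
        transitivity ((a * fst v1 + b * snd v1) * snd v2 - (a * fst v2 + b * snd v2) * snd v1)%C; [ring|rewrite K1, K2; ring].
      - apply (Cmult_neq_0 _ _ Hb Hi).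
        transitivity ((a * fst v2 + b * snd v2) * fst v1 - (a * fst v1 + b * snd v1) * fst v2)%C; [ring|rewrite K1, K2; ring]. }
    assert (R1 : m11 u <> 0%C \/ m12 u <> 0%C).
    { destruct (Ceq_dec (m11 u) 0%C) as [K|]; auto. right. intros K'. unfold mdet in Hd. rewrite K, K' in Hd.
      apply (f_equal fst) in Hd. simpl in Hd. lra. }
    assert (R2 : m21 u <> 0%C \/ m22 u <> 0%C).
    { destruct (Ceq_dec (m21 u) 0%C) as [K|]; auto. right. intros K'. unfold mdet in Hd. rewrite K, K' in Hd.
      apply (f_equal fst) in Hd. simpl in Hd. lra. }
    (* Each eigenvector is annihilated by a row of [u], the first row belonging to [G0] and the
       second to [s]; independence excludes the two cases with a common row. *)
    destruct (diag_eigvec u M mu v1 Hmu HF E1) as [K1|K1], (diag_eigvec u M mu v2 Hmu HF E2) as [K2|K2];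
      destruct E1 as [Z1 _]; destruct E2 as [Z2 _].
    + exfalso. exact (L _ _ R1 K1 K2).
    + right. split; [now apply (proj_zero u v1)|now apply (proj_pole u v2)].
    + left. split; [now apply (proj_pole u v1)|now apply (proj_zero u v2)].
    + exfalso. exact (L _ _ R2 K1 K2).
Qed.
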